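(* Let $D\subseteq\mathbb R^n$, $f_i\in C^3(D;\mathbb R^n)$ for $i=1,\dots,m$, and $g:\mathbb R\times D\to\mathbb R^n$, and consider the control system $$\dot x=g(t,x)+\sum_{i=1}^m f_i(x)u_i,\qquad x\in D\subseteq\mathbb R^n,\ u=(u_1,\dots,u_m)^\top\in\mathbb R^m. \qquad (\ast)$$ Let $S_1\subseteq\{1,\dots,m\}$, $S_2\subseteq\{1,\dots,m\}^2$, $S_3\subseteq\{1,\dots,m\}^3$ be sets of indices such that $|S_1|+|S_2|+|S_3|=n$ and, for each $x\in D$, $$\mathrm{span}\big\{f_i(x),\,[f_{j_1},f_{j_2}](x),\,[[f_{\ell_1},f_{\ell_2}],f_{\ell_3}](x)\ \big|\ i\in S_1,\ (j_1,j_2)\in S_2,\ (\ell_1,\ell_2,\ell_3)\in S_3\big\}=\mathbb R^n .$$ Suppose that for each compact set $\xi\subseteq D$ there exist $\tau>0$ and $\mathcal M_g\ge 0$ such that, for any $t_0\ge 0$, $\|g(t,x)\|\le \mathcal M_g$ for all $t\in[t_0,t_0+\tau]$, $x\in\xi$. Suppose also that there exists an $\alpha>0$ such that $\|\mathcal F^{-1}(x)\|\le\alpha$ for all $x\in D$, where $\mathcal F(x)$ is the $n\times n$ matrix $$\mathcal F(x)=\Big(\big(f_i(x)\big)_{i\in S_1}\ \big([f_{j_1},f_{j_2}](x)\big)_{(j_1,j_2)\in S_2}\ \big([[f_{\ell_1},f_{\ell_2}],f_{\ell_3}](x)\big)_{(\ell_1,\ell_2,\ell_3)\in S_3}\Big).$$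 Let the controls be $u_k=h_k^\varepsilon(t,x)$, $k=1,\dots,m$, with $h_k^\varepsilon$ the control functions (depending on $\varepsilon>0$ and on the gain $\gamma>0$) defined in the context, with integer parameters $\kappa$ satisfying the absence-of-resonances assumption stated in the context. Then for any $\delta,\rho>0$ there exist $\gamma,\bar\varepsilon>0$ such that, for any $\varepsilon\in(0,\bar\varepsilon]$, the $\pi_\varepsilon$-solution $x(t)$ of system $(\ast)$ corresponding to the feedback $u=h^\varepsilon(t,x)$ with the initial data $x(0)=x^0\in B_\delta(0)$ is well-defined on $t\in[0,+\infty)$ and $$\|x(t)\|\le\|x^0\|e^{-\lambda t}+\rho\ \text{ for all } t\in[0,t_1),\qquad\text{and}\qquad \|x(t)\|\le\rho\ \text{ for all } t\in[t_1,\infty),$$ with some $\lambda,t_1>0$.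
   Context: **Notation.** $\|a\|$ is the Euclidean norm of a vector $a\in\mathbb R^n$; for an $n\times n$ matrix, $\|\mathcal F\|=\sup_{\|y\|=1}\|\mathcal F y\|$. $B_r(0)$ is the ball of radius $r$ centred at the origin of $\mathbb R^n$. $L_gf(x)=\lim_{s\to0}\frac{f(x+sg(x))-f(x)}{s}$ is the directional derivative, and $[f,g](x)=L_fg(x)-L_gf(x)$ is the Lie bracket. $\delta_{ki}$ is the Kronecker delta; $\sqrt[3]{\cdot}$ is the real cube root. **$\pi_\varepsilon$-solution.** For $\varepsilon>0$ put $t_j=\varepsilon j$, $j=0,1,2,\dots$ (these sampling times are unrelated to the $t_0$ and $t_1$ of the claim). Given a feedback $u=h(t,x)$, $h:[0,+\infty)\times D\to\mathbb R^m$, and $x^0\in D$, a $\pi_\varepsilon$-solution of $\dot x=g(t,x)+\sum_{i=1}^m f_i(x)u_i$ corresponding to $x^0$ and $h$ is an absolutely continuous function $x(t)\in D$, defined for $t\in[0,+\infty)$, such that $x(0)=x^0$ and, for each $j=0,1,2,\dots$, $\dot x(t)=g(t,x(t))+\sum_{i=1}^m f_i(x(t))\,h_i(t,x(t_j))$ for $t\in[t_j,t_{j+1})$. **Control functions.** Given $\varepsilon,\gamma>0$, for $k=1,\dots,m$, $$h_k^\varepsilon(t,x)=\sum_{i_1\in S_1}a_{i_1}(x)\phi^{(k,\varepsilon)}_{i_1}(t)+\varepsilon^{-1/2}\sum_{(j_1,j_2)\in S_2}\sqrt{|a_{j_1j_2}(x)|}\,\phi^{(k,\varepsilon)}_{j_1j_2}(t,x)+\varepsilon^{-2/3}\sum_{(\ell_1,\ell_2,\ell_3)\in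 S_3}\sqrt[3]{a_{\ell_1\ell_2\ell_3}(x)}\,\phi^{(k,\varepsilon)}_{\ell_1\ell_2\ell_3}(t),$$ where the vector function $a(x)=\big(a_{i_1}(x)|_{i_1\in S_1},\,a_{j_1j_2}(x)|_{(j_1,j_2)\in S_2},\,a_{\ell_1\ell_2\ell_3}(x)|_{(\ell_1,\ell_2,\ell_3)\in S_3}\big)^\top\in\mathbb R^n$ (ordered as the columns of $\mathcal F$) is $$a(x)=-\gamma\,\mathcal F^{-1}(x)\,x,$$ and $\phi^{(k,\varepsilon)}_{i_1}(t)=\delta_{ki_1}$, $$\phi^{(k,\varepsilon)}_{j_1j_2}(t,x)=2\sqrt{\pi\kappa_{j_1j_2}}\Big(\delta_{kj_1}\,\mathrm{sign}(a_{j_1j_2}(x))\cos\tfrac{2\pi\kappa_{j_1j_2}t}{\varepsilon}+\delta_{kj_2}\sin\tfrac{2\pi\kappa_{j_1j_2}t}{\varepsilon}\Big),$$ $$\phi^{(k,\varepsilon)}_{\ell_1\ell_2\ell_3}(t)=2\sqrt[3]{2\pi^2\kappa_{3\ell_1\ell_2\ell_3}\kappa_{4\ell_1\ell_2\ell_3}}\Big(\delta_{k\ell_1}\cos\tfrac{2\pi\kappa_{1\ell_1\ell_2\ell_3}t}{\varepsilon}+\delta_{k\ell_2}\sin\tfrac{2\pi\kappa_{2\ell_1\ell_2\ell_3}t}{\varepsilon}+\delta_{k\ell_3}\cos\tfrac{2\pi\kappa_{1\ell_1\ell_2\ell_3}t}{\varepsilon}\sin\tfrac{2\pi\kappa_{2\ell_1\ell_2\ell_3}t}{\varepsilon}\Big).$$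 **Resonance.** There is a resonance of order $N\in\mathbb N$ between pairwise distinct numbers $k_1,\dots,k_p$ if there exist relatively prime integers $c_1,\dots,c_p$ with $|c_1|+\dots+|c_p|=N$ and $c_1k_1+\dots+c_pk_p=0$. **Absence-of-resonances assumption.** The positive integers $\kappa_{j_1j_2}$ ($(j_1,j_2)\in S_2$), $\kappa_{1\ell_1\ell_2\ell_3}$, $\kappa_{2\ell_1\ell_2\ell_3}$, $\kappa_{3\ell_1\ell_2\ell_3}=\kappa_{1\ell_1\ell_2\ell_3}+\kappa_{2\ell_1\ell_2\ell_3}$ and $\kappa_{4\ell_1\ell_2\ell_3}=\kappa_{2\ell_1\ell_2\ell_3}-\kappa_{1\ell_1\ell_2\ell_3}$ ($(\ell_1,\ell_2,\ell_3)\in S_3$) are pairwise distinct, and there are no third-order resonances between the numbers $\kappa_{s\ell_1\ell_2\ell_3}$ ($s=1,\dots,4$), except those imposed by the definition of $\kappa_{3\ell_1\ell_2\ell_3}$ and $\kappa_{4\ell_1\ell_2\ell_3}$.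
   Formalization: Added: for every t₀≥0, y∈D and continuous input u, (∗) has a local absolutely continuous solution in D (a merely bounded g may admit none); D is open and the closed ball B_δ(0) lies in D; the equation holds for almost every t. *)

(* Defs.v *)
From HB Require Import structures.
From mathcomp Require Export all_boot all_order all_algebra.
From mathcomp Require Export all_classical all_reals all_analysis.
Export Order.TTheory GRing.Theory Num.Theory.
Export numFieldNormedType.Exports.

Set Implicit Arguments.
Unset Strict Implicit.
Unset Printing Implicit Defensive.

Local Open Scope classical_set_scope.
Local Open Scope ring_scope.

(* The library norm on ['cV[R]_n] is the max norm; it is only used through its
   topology.  All quantitative bounds use the Euclidean norm. *)
Definition enorm (R : realType) (n : nat) (v : 'cV[R]_n) : R :=
  Num.sqrt (\sum_(i < n) v i 0 ^+ 2).

Definition opnorm (R : realType) (n : nat) (A : 'M[R]_n) : R :=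
  sup [set enorm (A *m y) | y in [set y : 'cV[R]_n | enorm y = 1]].

Definition eball (R : realType) (n : nat) (r : R) : set 'cV[R]_n :=
  [set x | enorm x <= r].

(* C^k on an open set [D]: continuity of all partial derivatives up to
   order [k]. *)
Fixpoint Ck_on (R : realType) (n : nat) (k : nat) (D : set 'cV[R]_n)
    (f : 'cV[R]_n -> 'cV[R]_n) {struct k} : Prop :=
  (forall x, D x -> {for x, continuous f}) /\
  match k with
  | 0%N => True
  | k'.+1 => forall i : 'I_n,
      (forall x, D x -> derivable f x (delta_mx i 0)) /\
      Ck_on k' D (fun x => 'D_(delta_mx i 0) f x)
  end.

Definition Lie_der (R : realType) (n : nat) (g f : 'cV[R]_n -> 'cV[R]_n)
    (x : 'cV[R]_n) : 'cV[R]_n := 'D_(g x) f x.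

Definition bracket (R : realType) (n : nat) (f g : 'cV[R]_n -> 'cV[R]_n)
    (x : 'cV[R]_n) : 'cV[R]_n := Lie_der f g x - Lie_der g f x.

Definition bracket2 (R : realType) (n m : nat)
    (f : 'I_m -> 'cV[R]_n -> 'cV[R]_n) (j : 'I_m * 'I_m) :=
  bracket (f j.1) (f j.2).

(* A triple [(l1, l2, l3)] is the nested pair [((l1, l2), l3)]. *)
Definition bracket3 (R : realType) (n m : nat)
    (f : 'I_m -> 'cV[R]_n -> 'cV[R]_n) (l : 'I_m * 'I_m * 'I_m) :=
  bracket (bracket (f l.1.1) (f l.1.2)) (f l.2).

Definition spanning_fields (R : realType) (n m : nat)
    (f : 'I_m -> 'cV[R]_n -> 'cV[R]_n)
    (S1 : {set 'I_m}) (S2 : {set 'I_m * 'I_m}) (S3 : {set 'I_m * 'I_m * 'I_m})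
    (x : 'cV[R]_n) : seq 'cV[R]_n :=
  [seq f i x | i <- enum S1] ++ [seq bracket2 f j x | j <- enum S2] ++
  [seq bracket3 f l x | l <- enum S3].

(* Columns are ordered by [enum S1], then [enum S2], then [enum S3]. *)
Definition Fmx (R : realType) (n m : nat) (f : 'I_m -> 'cV[R]_n -> 'cV[R]_n)
    (S1 : {set 'I_m}) (S2 : {set 'I_m * 'I_m}) (S3 : {set 'I_m * 'I_m * 'I_m})
    (hn : (#|S1| + #|S2| + #|S3|)%N = n) (x : 'cV[R]_n) : 'M[R]_n :=
  castmx (erefl n, hn)
    (row_mx (row_mx
      (\matrix_(r < n, p < #|S1|) f (enum_val p) x r 0)
      (\matrix_(r < n, p < #|S2|) bracket2 f (enum_val p) x r 0))
      (\matrix_(r < n, p < #|S3|) bracket3 f (enum_val p) x r 0)).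

(* The coefficient vector a(x), reindexed so that it splits along S1, S2, S3. *)
Definition coef (R : realType) (n m : nat) (f : 'I_m -> 'cV[R]_n -> 'cV[R]_n)
    (S1 : {set 'I_m}) (S2 : {set 'I_m * 'I_m}) (S3 : {set 'I_m * 'I_m * 'I_m})
    (hn : (#|S1| + #|S2| + #|S3|)%N = n) (gamma : R) (x : 'cV[R]_n) :
    'cV[R]_(#|S1| + #|S2| + #|S3|) :=
  castmx (esym hn, erefl 1%N) (- gamma *: (invmx (Fmx f hn x) *m x)).

Definition cbrt (R : realType) (a : R) : R := Num.sg a * (`|a| `^ (1 / 3)).

(* [kap k1 k2 s l], for s = 0, 1, 2, 3, are the frequencies
   kappa_1, kappa_2, kappa_3 = kappa_1 + kappa_2, kappa_4 = kappa_2 - kappa_1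
   of the triple l. *)
Definition kap (T : Type) (k1 k2 : T -> int) (s : 'I_4) (l : T) : int :=
  nth 0 [:: k1 l; k2 l; k1 l + k2 l; k2 l - k1 l] s.

Definition phi1 (R : realType) (m : nat) (k i : 'I_m) : R := (k == i)%:R.

(* The argument [a] is the value a_j(x), on which phi depends through its
   sign. *)
Definition phi2 (R : realType) (m : nat) (kj : 'I_m * 'I_m -> int)
    (eps : R) (k : 'I_m) (j : 'I_m * 'I_m) (t a : R) : R :=
  let w := 2 * pi * (kj j)%:~R * t / eps in
  2 * Num.sqrt (pi * (kj j)%:~R) *
  ((k == j.1)%:R * Num.sg a * cos w + (k == j.2)%:R * sin w).

Definition phi3 (R : realType) (m : nat) (k1 k2 : 'I_m * 'I_m * 'I_m -> int)
    (eps : R) (k : 'I_m) (l : 'I_m * 'I_m * 'I_m) (t : R) : R :=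
  let K (s : 'I_4) : R := (kap k1 k2 s l)%:~R in
  let w1 := 2 * pi * K 0 * t / eps in
  let w2 := 2 * pi * K 1 * t / eps in
  2 * cbrt (2 * pi ^+ 2 * K 2 * K 3) *
  ((k == l.1.1)%:R * cos w1 + (k == l.1.2)%:R * sin w2
   + (k == l.2)%:R * (cos w1 * sin w2)).

Definition control (R : realType) (n m : nat)
    (f : 'I_m -> 'cV[R]_n -> 'cV[R]_n)
    (S1 : {set 'I_m}) (S2 : {set 'I_m * 'I_m}) (S3 : {set 'I_m * 'I_m * 'I_m})
    (hn : (#|S1| + #|S2| + #|S3|)%N = n)
    (kj : 'I_m * 'I_m -> int) (k1 k2 : 'I_m * 'I_m * 'I_m -> int)
    (gamma eps t : R) (x : 'cV[R]_n) : 'cV[R]_m :=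
  let a := coef f hn gamma x in
  let a1 := usubmx (usubmx a) in
  let a2 := dsubmx (usubmx a) in
  let a3 := dsubmx a in
  \col_(k < m)
    (\sum_(p < #|S1|) a1 p 0 * phi1 R k (enum_val p)
     + eps `^ (- (1 / 2)) *
       \sum_(p < #|S2|) Num.sqrt `|a2 p 0| *
         phi2 kj eps k (enum_val p) t (a2 p 0)
     + eps `^ (- (2 / 3)) *
       \sum_(p < #|S3|) cbrt (a3 p 0) * phi3 k1 k2 eps k (enum_val p) t).

(* [c] realizes a resonance of order [N] between the numbers [k i]; entries of
   [c] may vanish, so resonances between some of the numbers are included. *)
Definition resonance (I : finType) (N : nat) (k c : I -> int) : Prop :=
  [/\ injective k, \big[gcdn/0%N]_(i : I) `|c i|%N = 1%N,
      (\sum_(i : I) `|c i|)%N = N & \sum_(i : I) c i * k i = 0].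

(* The relations kappa_1 + kappa_2 - kappa_3 = 0 and
   kappa_2 - kappa_1 - kappa_4 = 0 of the triple [l], up to a global sign. *)
Definition imposed (T : eqType) (l : T) (c : 'I_4 * T -> int) : Prop :=
  let d (s : 'I_4) i : int := (i == (s, l))%:Z in
  exists e : bool,
    c =1 (fun i => (-1) ^+ e * (d 0 i + d 1 i - d 2 i)) \/
    c =1 (fun i => (-1) ^+ e * (d 1 i - d 0 i - d 3 i)).

Definition non_resonant (m : nat)
    (S2 : {set 'I_m * 'I_m}) (S3 : {set 'I_m * 'I_m * 'I_m})
    (kj : 'I_m * 'I_m -> int) (k1 k2 : 'I_m * 'I_m * 'I_m -> int) : Prop :=
  let freqs := [seq kj j | j <- enum S2] ++
               [seq kap k1 k2 s l | s <- enum 'I_4, l <- enum S3] in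
  [/\ forall z, z \in freqs -> 0 < z,
      uniq freqs
    & forall c : 'I_4 * {l | l \in S3} -> int,
        resonance 3 (fun i => kap k1 k2 i.1 (val i.2)) c ->
        exists l : {l | l \in S3}, imposed l c].

Definition abs_cont (R : realType) (n : nat) (a b : R) (x : R -> 'cV[R]_n) :
    Prop :=
  forall e : R, 0 < e -> exists2 d : R, 0 < d &
    forall (N : nat) (s t : 'I_N -> R),
      (forall i, [/\ a <= s i, s i <= t i & t i <= b]) ->
      (forall i j, i != j -> t i <= s j \/ t j <= s i) ->
      \sum_(i < N) (t i - s i) < d ->
      \sum_(i < N) enorm (x (t i) - x (s i)) < e.

Definition rhs (R : realType) (n m : nat) (g : R -> 'cV[R]_n -> 'cV[R]_n)
    (f : 'I_m -> 'cV[R]_n -> 'cV[R]_n) (t : R) (x : 'cV[R]_n) (u : 'cV[R]_m) :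
    'cV[R]_n :=
  g t x + \sum_(i < m) u i 0 *: f i x.

(* As usual for absolutely continuous solutions, the differential equation is
   required for almost every t. *)
Definition pi_solution (R : realType) (n m : nat) (D : set 'cV[R]_n)
    (g : R -> 'cV[R]_n -> 'cV[R]_n) (f : 'I_m -> 'cV[R]_n -> 'cV[R]_n)
    (h : R -> 'cV[R]_n -> 'cV[R]_m) (eps : R) (x0 : 'cV[R]_n)
    (x : R -> 'cV[R]_n) : Prop :=
  [/\ x 0 = x0,
      forall t, 0 <= t -> D (x t),
      forall T, 0 < T -> abs_cont 0 T x
    & forall j : nat, {ae (@lebesgue_measure R), forall t : R,
        eps * j%:R <= t < eps * j.+1%:R ->
        is_derive t 1 x (rhs g f t (x t) (h t (x (eps * j%:R))))}].

(* The Cauchy problem for the control system has a local solution from every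
   initial datum, for every continuous open-loop input.  Since [g] is otherwise
   only assumed to be bounded, this is what makes solutions meaningful; it holds
   under the Caratheodory conditions on [g].  Uniqueness is not required. *)
Definition locally_solvable (R : realType) (n m : nat) (D : set 'cV[R]_n)
    (g : R -> 'cV[R]_n -> 'cV[R]_n) (f : 'I_m -> 'cV[R]_n -> 'cV[R]_n) : Prop :=
  forall (t0 : R) (y : 'cV[R]_n) (u : R -> 'cV[R]_m),
    0 <= t0 -> D y -> continuous u ->
    exists (r : R) (x : R -> 'cV[R]_n),
      [/\ 0 < r, x t0 = y,
          forall t, t0 <= t <= t0 + r -> D (x t),
          abs_cont t0 (t0 + r) x
        & {ae (@lebesgue_measure R), forall t : R, t0 <= t <= t0 + r ->
            is_derive t 1 x (rhs g f t (x t) (u t))}].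

(* Main.v *)
Require Import Defs.
From mathcomp Require Import ring lra zify.

Local Open Scope classical_set_scope.
Local Open Scope ring_scope.

(* With eps = s^6 the controls are sums of waves of size s^-4 (third order) or
   s^-3 (second order) and period eps.  On a sampling interval, subtracting
   from x the periodic primitives of the waves, of the products of waves and of
   the triple products of waves, each multiplied by the matching iterated
   directional derivative of the fields, leaves only mean values and an error
   of order eps (M_g + C s).  The means of the double products produce the
   brackets [f_j1, f_j2]; by the absence of resonances the means of the triple
   products are those of kappa_1 + kappa_2 = kappa_3 and
   kappa_1 + kappa_4 = kappa_2, which produce [[f_l1, f_l2], f_l3].  Since
   F a = - gamma x, the increment is - eps gamma x up to eps (M_g + C s), so the
   norm contracts by 1 - gamma eps at each sampling time as long as it exceeds a
   multiple of (M_g + 1) / gamma: first gamma is taken large, then eps small.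
   A global solution is obtained by extending local ones greedily, the same
   estimates providing the a priori Lipschitz bound. *)

Set Implicit Arguments.
Unset Strict Implicit.
Unset Printing Implicit Defensive.

(** * Absolutely continuous functions *)

(** The exponents leave no slack. A third-order wave has size [s^-4] and each integration gains
    [s^6], so its primitive has size [s^2], while a primitive times another such wave has size
    [s^-2], too large to stay in the velocity. Its mean vanishes, so it can be integrated once more;
    the product of this second primitive, of size [s^4], with a third wave has size one, and the
    expansion stops there. Two differentiations on the way take the C^3 fields down to C^1, which
    still allows the last coefficients to be compared at two points. Since [g] is merely bounded and
    solutions are differentiable only almost everywhere, no integral is formed: a mean is defined by
    a periodic primitive, and increments are estimated from almost-everywhere bounds on derivatives.
    Solutions may also fail to be unique, so every estimate is made for an arbitrary solution up to
    a time [T]; the same bounds then serve existence and decay. The drift contributes [eps * Mg] per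
    step, of the same order in [eps] as the contraction, so only the gain can dominate it, and the
    constants of one step are allowed to depend on the gain. *)

Lemma open_segment_nbhs (R : realType) (U : set R) (c : R) :
  open U -> U c -> exists2 r : R, 0 < r & `[c - r, c + r]%classic `<=` U.
Proof.
move=> oU Uc; have /nbhs_ballP[r /= r0 rU] := open_nbhs_nbhs (conj oU Uc).
exists (r / 2); first by rewrite divr_gt0.
move=> y; rewrite /= in_itv/= => /andP[y1 y2]; apply: rU.
by rewrite /ball/= ltr_distlC; apply/andP; split; lra.
Qed.

(** A derivative at the single point [c] controls increments only across [c], hence the pair
    [s <= c <= t]. This is what a supremum argument needs in order to pass beyond [c]. *)
Lemma is_derive_slope_le (R : realType) (phi : R -> R) (c v M : R) :
  is_derive c 1 phi v -> v < M ->
  exists2 r : R, 0 < r & forall s t, c - r <= s <= c -> c <= t <= c + r ->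
    phi t - phi s <= M * (t - s).
Proof.
move=> [dphi vE] vM.
have {dphi vE} : h^-1 *: ((phi \o shift c) (h *: 1) - phi c) @[h --> 0^'] --> v.
  by rewrite -vE; exact: dphi.
move=> /cvgr_lt /(_ _ vM) /nbhs_ballP[r /= r0 rM].
have {}rM h : h != 0 -> `|h| < r -> h^-1 * (phi (h + c) - phi c) < M.
  move=> h0 hr; have := rM h; rewrite /ball/= sub0r normrN => /(_ hr h0).
  by rewrite /= /GRing.scale/= mulr1.
exists (r / 2); first by rewrite divr_gt0.
move=> s t /andP[s1 s2] /andP[t1 t2].
have ht : phi t - phi c <= M * (t - c).
  have [->|tc] := eqVneq t c; first by rewrite !subrr mulr0.
  have tc0 : 0 < t - c by rewrite subr_gt0 lt_neqAle eq_sym tc.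
  have := rM (t - c) (lt0r_neq0 tc0); rewrite subrK ger0_norm ?(ltW tc0)// => H.
  have := H _; rewrite mulrC ltr_pdivrMr// => /(_ _)/ltW; apply.
  by lra.
have hs : phi c - phi s <= M * (c - s).
  have [->|sc] := eqVneq s c; first by rewrite !subrr mulr0.
  have sc0 : 0 < c - s by rewrite subr_gt0 lt_neqAle sc.
  have sc0' : s - c != 0 by rewrite subr_eq0.
  have := rM (s - c) sc0'; rewrite subrK distrC ger0_norm ?(ltW sc0)// => H.
  have : (c - s)^-1 * (phi c - phi s) < M.
    suff <- : (s - c)^-1 * (phi s - phi c) = (c - s)^-1 * (phi c - phi s).
      by apply: H; lra.
    by rewrite -[c - s]opprB -[phi c - _]opprB invrN mulrNN.
  by rewrite mulrC ltr_pdivrMr// => /ltW.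
lra.
Qed.

(** [abs_cont] for one coordinate; the increment estimates are made coordinatewise. *)
Definition sac (R : realType) (a b : R) (phi : R -> R) : Prop :=
  forall e : R, 0 < e -> exists2 d : R, 0 < d &
    forall (N : nat) (s t : 'I_N -> R),
      (forall i, [/\ a <= s i, s i <= t i & t i <= b]) ->
      (forall i j, i != j -> t i <= s j \/ t j <= s i) ->
      \sum_(i < N) (t i - s i) < d ->
      \sum_(i < N) `|phi (t i) - phi (s i)| < e.

(* Real induction along [a, b]: away from a small open cover [U] of the exceptional null set, the derivative controls the increment, and on the intervals spent inside [U] absolute continuity does. *)
Lemma sac_increment_le (R : realType) (phi : R -> R) (a b M : R) :
  0 <= M -> a <= b -> sac a b phi ->
  {ae (@lebesgue_measure R), forall t, a < t < b ->
     exists2 v, is_derive t 1 phi v & v <= M} ->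
  phi b - phi a <= M * (b - a).
Proof.
move=> M0 ab acphi [A0 [mA0 muA0 subA0]].
pose mu : {measure set _ -> \bar R} := @lebesgue_measure R.
apply/ler_addgt0Pr => e' e'0.
(* The slack [e] in the slope costs [e * (b - a)] and the variation inside [U] costs [e]; together
   they make [e']. *)
pose e := e' / (b - a + 1).
have ba1 : 0 < b - a + 1 by lra.
have e0 : 0 < e by rewrite divr_gt0.
have -> : M * (b - a) + e' = (M + e) * (b - a) + e.
  rewrite mulrDl -addrA; congr +%R.
  by rewrite -{2}[e]mulr1 -mulrDr /e divfK// gt_eqF.
have [d d0 dP] := acphi _ e0.
(* The endpoints join the null set because the derivative is given only strictly between [a] and
   [b]. *)
have [U [oU AU muU]] : exists U : set R, [/\ open U,
    (A0 `|` [set a; b]) `<=` U & (mu U < d%:E)%E].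
  have [A [mA muA subA]] : mu.-negligible (A0 `|` [set a; b]).
    apply: negligibleU; first by exists A0; split.
    by apply: negligibleU; [exists [set a]|exists [set b]]; split => //;
      exact: lebesgue_measure_set1.
  have := @lebesgue_regularity_outer R A d mA.
  rewrite -/mu muA => /(_ (ltry 0) d0)[U [oU AU UA]].
  exists U; split => //; first exact: subset_trans AU.
  have mU : measurable U by exact: measurable_realfun.open_measurable.
  rewrite -(setDUK AU) setUC measureU0//; first exact: measurableD.
pose len (l : seq (R * R)) := \sum_(p <- l) (p.2 - p.1).
pose var (l : seq (R * R)) := \sum_(p <- l) `|phi p.2 - phi p.1|.
(* [l] lists the disjoint intervals crossed inside [U]. Comparing their length with the measure of
   [U] to the left of [t] keeps the total below [d], however many intervals there are. *)
pose good t l := [/\ all (fun p : R * R => [&& a <= p.1, p.1 <= p.2 & p.2 <= t]) l,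
  pairwise (fun x y : R * R => y.2 <= x.1) l,
  ((len l)%:E <= mu (U `&` `[a, t[))%E &
  phi t - phi a <= (M + e) * (t - a) + var l].
have mUt s t : measurable (U `&` `[s, t[).
  by apply: measurableI; [exact: measurable_realfun.open_measurable|exact: measurable_itv].
have step1 s t l : good s l -> a <= s -> s <= t ->
    phi t - phi s <= (M + e) * (t - s) -> good t l.
  move=> [g1 g2 g3 g4] as_ st h; split => //.
  - apply: sub_all g1 => p /and3P[-> -> ps]/=; exact: le_trans ps st.
  - apply: le_trans g3 _; apply: le_measure; [by rewrite inE; exact: mUt|by rewrite inE; exact: mUt|].
    by move=> x [Ux]; rewrite /= !in_itv/= => /andP[-> xs]; split => //; exact: lt_le_trans xs st.
  - have := lerD h g4; lra.
have step2 s t l : good s l -> a <= s -> s <= t ->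
    `[s, t]%classic `<=` U -> good t ((s, t) :: l).
  move=> [g1 g2 g3 g4] as_ st h; split => //.
  - rewrite /= as_ st lexx/=.
    apply: sub_all g1 => p /and3P[-> -> ps]/=; exact: le_trans ps st.
  - rewrite /= g2 andbT.
    by apply: sub_all g1 => p /and3P[].
  - rewrite /len big_cons -/(len l) /= EFinD addeC.
    have -> : U `&` `[a, t[ = (U `&` `[a, s[) `|` `[s, t[%classic.
      apply/seteqP; split => x /=; rewrite !in_itv/=.
        by move=> [Ux /andP[-> xt]]; case: (ltP x s) => xs; [left|right].
      move=> [[Ux /andP[-> xs]]|/andP[sx xt]].
        by split => //; rewrite (lt_le_trans xs st).
      split; last by rewrite xt (le_trans as_ sx).
      by apply: h; rewrite /= in_itv/= sx ltW.
    rewrite measureU//; last 1 first.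
    + apply/seteqP; split => x //=; rewrite !in_itv/= => -[[_ /andP[_ xs]] /andP[sx _]].
      by move: (lt_le_trans xs sx); rewrite ltxx.
    + apply: leeD => //.
      suff H : ((t - s)%:E <= @lebesgue_measure R `[s, t[)%E by exact: H.
      rewrite lebesgue_measure_itv/= lte_fin; case: ltP => // ts.
      by rewrite lee_fin subr_le0.
    + exact: mUt.
  - rewrite /var big_cons -/(var l) /=.
    have := ler_norm (phi t - phi s).
    have [lt_st|ge_st] := ltP s t; last first.
      have -> : t = s by apply/eqP; rewrite eq_le st ge_st.
      by move: g4; rewrite subrr normr0 add0r.
    have : 0 <= (M + e) * (t - s) by rewrite mulr_ge0 ?subr_ge0// addr_ge0// ltW.
    move: g4; lra.
pose S := [set t | a <= t <= b /\ exists l, good t l].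
have Sa : S a.
  split; first by rewrite lexx ab.
  exists [::]; split => //; last by rewrite /var big_nil !subrr; lra.
  by rewrite /len big_nil measure_ge0.
have supS : has_sup S.
  by split; [exists a | exists b => t []; case/andP].
pose c := sup S.
have ac : a <= c by exact: (sup_upper_bound supS).
have cb : c <= b by apply: ge_sup; [exists a | move=> t []; case/andP].
(* A good point close to the left of [c] is carried across [c] in one move: through a new interval
   of [l] if [c] lies in [U], through the derivative at [c] otherwise. *)
have [r r0 hr] : exists2 r, 0 < r & forall s t l, good s l -> a <= s ->
    c - r <= s <= c -> c <= t <= c + r -> exists l', good t l'.
  have [Uc|Uc] := pselect (U c).
    have [r r0 rU] := open_segment_nbhs oU Uc.
    exists r => // s t l gs as_ /andP[s1 s2] /andP[t1 t2].
    exists ((s, t) :: l); apply: step2 => //; first exact: le_trans t1.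
    move=> x; rewrite /= in_itv/= => /andP[x1 x2]; apply: rU.
    by rewrite /= in_itv/= (le_trans s1 x1) (le_trans x2 t2).
  have [v dv vM] : exists2 v, is_derive c 1 phi v & v <= M.
    have : ~ A0 c by move=> A0c; apply: Uc; apply: AU; left.
    apply: contra_notP => nv; apply: subA0 => /= h; apply: nv; apply: h.
    rewrite !lt_neqAle ac cb !andbT; apply/andP; split; apply/eqP => cE; apply: Uc; apply: AU; right.
      by left; rewrite /= cE.
    by right; rewrite /= cE.
  have vMe : v < M + e by rewrite (le_lt_trans vM)// ltrDl.
  have [r r0 rP] := is_derive_slope_le dv vMe.
  exists r => // s t l gs as_ s12 t12; exists l; apply: (step1 s) => //.
    by case/andP: s12 => _ s2; case/andP: t12 => t1 _; exact: le_trans t1.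
  exact: rP.
have [s Ss cs] : exists2 s, S s & c - r < s.
  by apply: sup_adherent => //.
have sc : s <= c by exact: (sup_upper_bound supS).
have [/andP[as_ sb] [l gl]] := Ss.
have gb t : c <= t <= c + r -> exists l', good t l'.
  by move=> tc; apply: (hr s t l) => //; rewrite (ltW cs) sc.
have cE : c = b.
  apply/eqP; rewrite eq_le cb leNgt; apply/negP => cltb.
  pose t := Num.min b (c + r).
  have ct : c < t by rewrite lt_min cltb ltrDl.
  have : S t.
    split; first by rewrite ge_min lexx (le_trans ac (ltW ct)).
    by apply: gb; rewrite (ltW ct) ge_min lexx orbT.
  by move=> /(sup_upper_bound supS); rewrite leNgt -/c ct.
have [l' [g1 g2 g3 g4]] : exists l', good b l'.
  by apply: gb; rewrite cE lexx lerDl ltW.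
rewrite (le_trans g4)// lerD2l.
have sizel : forall F : R * R -> R, \sum_(p <- l') F p = \sum_(i < size l') F (nth (0, 0) l' i).
  by move=> F; rewrite (big_nth (0, 0)) big_mkord.
rewrite /var sizel ltW//.
apply: (dP _ (fun i => (nth (0, 0) l' i).1) (fun i => (nth (0, 0) l' i).2)).
- move=> i; have /(all_nthP (0, 0))/(_ i (ltn_ord i))/and3P[] := g1.
  by split.
- move/(pairwiseP (0, 0)) : g2 => g2 i j ij.
  have [lij|lij|eij] := ltngtP i j; last by rewrite (val_inj eij) eqxx in ij.
    by right; apply: g2; rewrite ?inE.
  by left; apply: g2; rewrite ?inE.
- move: g3; rewrite /len sizel => g3.
  rewrite -lte_fin (le_lt_trans g3)// (le_lt_trans _ muU)//.
  apply: le_measure; [rewrite inE; exact: mUt | rewrite inE; exact: measurable_realfun.open_measurable | ].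
  by move=> x [].
Qed.

Lemma ae_impl (R : realType) (P Q : R -> Prop) : (forall t, P t -> Q t) ->
  {ae (@lebesgue_measure R), forall t, P t} -> {ae (@lebesgue_measure R), forall t, Q t}.
Proof.
by move=> PQ; apply: negligibleS => t /= nQ p; apply: nQ; exact: PQ.
Qed.

(** * Fields of class C^k *)

Local Notation pd i q := ('D_(delta_mx i 0) q).

(** [Ck_on] for scalar functions, where products make sense; fields are treated coordinatewise
    through [vC]. *)
Fixpoint sC (R : realType) (n k : nat) (D : set 'cV[R]_n) (q : 'cV[R]_n -> R)
    {struct k} : Prop :=
  (forall x, D x -> {for x, continuous q}) /\
  match k with
  | 0%N => True
  | k'.+1 => forall i : 'I_n,
      (forall x, D x -> derivable q x (delta_mx i 0)) /\ sC k' D (pd i q)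
  end.

Lemma sC_continuous (R : realType) n k (D : set 'cV[R]_n) q x :
  sC k D q -> D x -> {for x, continuous q}.
Proof. by case: k => [|k] [+ _]; apply. Qed.

Lemma sC_derivable (R : realType) n k (D : set 'cV[R]_n) q x i :
  sC k.+1 D q -> D x -> derivable q x (delta_mx i 0).
Proof. by move=> [_ /(_ i)[+ _]]; apply. Qed.

Lemma sC_pd (R : realType) n k (D : set 'cV[R]_n) q i :
  sC k.+1 D q -> sC k D (pd i q).
Proof. by move=> [_ /(_ i)[]]. Qed.

Lemma sCW (R : realType) n k (D : set 'cV[R]_n) q : sC k.+1 D q -> sC k D q.
Proof.
elim: k q => [|k IH] q; first by case.
move=> [cq dq]; split => // i; have [d1 d2] := dq i.
by split => //; exact: IH.
Qed.

Lemma sC_le (R : realType) n k l (D : set 'cV[R]_n) q :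
  (l <= k)%N -> sC k D q -> sC l D q.
Proof.
elim: k => [|k IH]; first by rewrite leqn0 => /eqP->.
rewrite leq_eqVlt => /orP[/eqP->//|lk /sCW]; exact: IH.
Qed.

Lemma near_eq_open (R : realType) n (D : set 'cV[R]_n) (T : Type) (p q : 'cV[R]_n -> T) x :
  open D -> (forall y, D y -> p y = q y) -> D x -> \near x, p x = q x.
Proof.
move=> oD pq Dx; have := open_nbhs_nbhs (conj oD Dx).
by apply: filterS => y; exact: pq.
Qed.

Lemma eq_continuous_open (R : realType) n (D : set 'cV[R]_n) (p q : 'cV[R]_n -> R) x :
  open D -> (forall y, D y -> p y = q y) -> D x ->
  {for x, continuous p} -> {for x, continuous q}.
Proof.
move=> oD pq Dx cp; rewrite /prop_for /continuous_at -(pq x Dx).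
apply: (cvg_trans _ cp); apply: near_eq_cvg.
  exact: nbhs_filter.
by apply: filterS (near_eq_open oD pq Dx) => y ->.
Qed.

(** Since [D] is open, an equality on [D] holds near each of its points and therefore survives
    differentiation. *)
Lemma eq_sC (R : realType) n k (D : set 'cV[R]_n) p q :
  open D -> (forall y, D y -> p y = q y) -> sC k D p -> sC k D q.
Proof.
move=> oD; elim: k p q => [|k IH] p q pq [cp dp].
  by split => // x Dx; exact: eq_continuous_open pq Dx (cp x Dx).
split; first by move=> x Dx; exact: eq_continuous_open pq Dx (cp x Dx).
move=> i; have [d1 d2] := dp i; split.
  by move=> x Dx; apply: near_eq_derivable (d1 x Dx); exact: near_eq_open oD pq Dx.
apply: IH d2 => y Dy; apply: near_eq_derive; exact: near_eq_open oD pq Dy.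
Qed.

Lemma sC_cst (R : realType) n k (D : set 'cV[R]_n) (c : R) : sC k D (fun=> c).
Proof.
have cc (d : R) : forall x, D x -> {for x, continuous (fun=> d)}.
  by move=> x _; exact: cst_continuous.
elim: k c => [|k IH] c; split; [exact: cc | by [] | exact: cc | ].
move=> i; split; first by move=> x _; exact: derivable_cst.
rewrite (_ : pd i _ = fun=> 0); last by apply/funext => x; rewrite (derive_cst c).
exact: IH.
Qed.

Lemma sC_add (R : realType) n k (D : set 'cV[R]_n) p q : open D ->
  sC k D p -> sC k D q -> sC k D (fun x => p x + q x).
Proof.
move=> oD; elim: k p q => [|k IH] p q [cp dp] [cq dq].
  by split => // x Dx; exact: cvgD (cp x Dx) (cq x Dx).
split; first by move=> x Dx; exact: cvgD (cp x Dx) (cq x Dx).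
move=> i; have [p1 p2] := dp i; have [q1 q2] := dq i; split.
  by move=> x Dx; apply: derivableD; [exact: p1|exact: q1].
apply: eq_sC (IH _ _ p2 q2) => // y Dy.
by rewrite -[RHS]/('D_(delta_mx i 0) (p + q) y) deriveD//; [exact: p1|exact: q1].
Qed.

Lemma sC_mul (R : realType) n k (D : set 'cV[R]_n) p q : open D ->
  sC k D p -> sC k D q -> sC k D (fun x => p x * q x).
Proof.
move=> oD; elim: k p q => [|k IH] p q sp sq.
  split => // x Dx; exact: cvgM (sC_continuous sp Dx) (sC_continuous sq Dx).
have [cp dp] := sp; have [cq dq] := sq.
split; first by move=> x Dx; exact: cvgM (cp x Dx) (cq x Dx).
move=> i; have [p1 p2] := dp i; have [q1 q2] := dq i; split.
  by move=> x Dx; apply: derivableM; [exact: p1|exact: q1].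
have H := sC_add oD (IH _ _ (sCW sp) q2) (IH _ _ (sCW sq) p2).
apply: eq_sC H => // y Dy.
by rewrite -[RHS]/('D_(delta_mx i 0) (p * q) y) deriveM//; [exact: p1|exact: q1].
Qed.

Lemma sC_sum (R : realType) n k (D : set 'cV[R]_n) (I : Type) (r : seq I)
    (q : I -> 'cV[R]_n -> R) : open D ->
  (forall i, sC k D (q i)) -> sC k D (fun x => \sum_(i <- r) q i x).
Proof.
move=> oD sq; elim: r => [|i r IH].
  by apply: eq_sC (sC_cst k D 0) => // y _; rewrite big_nil.
by apply: eq_sC (sC_add oD (sq i) IH) => // y _; rewrite big_cons.
Qed.

Definition vC (R : realType) (n k : nat) (D : set 'cV[R]_n) (v : 'cV[R]_n -> 'cV[R]_n) :=
  forall c, sC k D (fun x => v x c 0).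

Lemma Ck_on_vC (R : realType) n k (D : set 'cV[R]_n) f :
  open D -> Ck_on k D f -> vC k D f.
Proof.
move=> oD; have cc (g : 'cV[R]_n -> 'cV[R]_n) c : (forall x, D x -> {for x, continuous g}) ->
    forall x, D x -> {for x, continuous (fun x => g x c 0)}.
  move=> cg x Dx; apply: (@continuous_comp _ _ _ g (fun M : 'cV[R]_n => M c 0)) (cg x Dx) _.
  exact: coord_continuous.
elim: k f => [|k IH] f [cf df] c; first by split => //; exact: cc.
split; first exact: cc.
move=> i; have [d1 d2] := df i; split.
  by move=> x Dx; have /derivable_mxP := d1 x Dx; exact.
apply: eq_sC (IH _ d2 c) => // y Dy.
by rewrite derive_mx ?mxE//; exact: d1.
Qed.

(** The two difference quotients are the same function of the increment, so directional derivatives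
    reduce to calculus in one variable. *)
Lemma is_derive_lineP (R : realType) n (q : 'cV[R]_n -> R) y v s d :
  is_derive (y + s *: v) v q d <-> is_derive s 1 (fun r : R => q (y + r *: v)) d.
Proof.
have E : (fun h : R => h^-1 *: (((fun r => q (y + r *: v)) \o shift s) (h *: 1) - q (y + s *: v)))
   = (fun h : R => h^-1 *: ((q \o shift (y + s *: v)) (h *: v) - q (y + s *: v))).
  apply/funext => h /=; congr (_ *: (q _ - _)).
  by rewrite [h%:A]mulr1 scalerDl addrCA.
by split => -[dq <-]; move: dq; rewrite /derivable => dq; apply: DeriveDef;
  rewrite /derivable /derive ?E// -E.
Qed.

(** * Mean values, first-order expansion and the chain rule *)

Lemma mean_value_signed (R : realType) (phi dphi : R -> R) (a : R) :
  (forall r : R, `|r| <= `|a| -> is_derive r 1 phi (dphi r)) ->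
  exists2 c, `|c| <= `|a| & phi a - phi 0 = dphi c * a.
Proof.
move=> dP.
have cP (u v : R) : (forall r, u <= r <= v -> `|r| <= `|a|) -> {within `[u, v], continuous phi}.
  move=> h; apply: derivable_within_continuous => r; rewrite in_itv/= => /h hr.
  by have [] := dP _ hr.
case: (leP 0 a) => a0.
  have h r : 0 <= r <= a -> `|r| <= `|a|.
    by move=> /andP[r0 ra]; rewrite !ger0_norm.
  have d x : x \in `]0, a[ -> is_derive x 1 phi (dphi x).
    by rewrite in_itv/= => /andP[x0 xa]; apply: dP; rewrite h// !ltW.
  have [c ca cE] := MVT_segment a0 d (cP _ _ h).
  exists c; last by rewrite cE subr0.
  by apply: h; rewrite in_itv/= in ca.
have h r : a <= r <= 0 -> `|r| <= `|a|.
  by move=> /andP[r0 ra]; rewrite !ler0_norm ?lerN2// ltW.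
have d x : x \in `]a, 0[ -> is_derive x 1 phi (dphi x).
  by rewrite in_itv/= => /andP[x0 xa]; apply: dP; rewrite h// !ltW.
have [c ca cE] := MVT_segment (ltW a0) d (cP _ _ h).
exists c; first by apply: h; rewrite in_itv/= in ca.
by rewrite -opprB cE sub0r mulrN opprK.
Qed.

Lemma coord_le_norm (R : realType) n (x : 'cV[R]_n) i : `|x i 0| <= `|x|.
Proof.
rewrite [leRHS]/Num.Def.normr/= mx_normrE.
by apply/bigmax_geP; right; exists (i, 0).
Qed.

Lemma norm_le_coord (R : realType) n (x : 'cV[R]_n) (M : R) :
  0 <= M -> (forall i, `|x i 0| <= M) -> `|x| <= M.
Proof.
move=> M0 h; rewrite [leLHS]/Num.Def.normr/= mx_normrE.
by apply: bigmax_le => // -[i j] _ /=; rewrite (ord1 j).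
Qed.

Lemma mean_value_pd (R : realType) n (D : set 'cV[R]_n) q y i (a : R) :
  sC 1 D q -> (forall r : R, `|r| <= `|a| -> D (y + r *: delta_mx i 0)) ->
  exists2 c : R, `|c| <= `|a| &
    q (y + a *: delta_mx i 0) - q y = pd i q (y + c *: delta_mx i 0) * a.
Proof.
move=> sq Dy.
have h (r : R) : `|r| <= `|a| -> is_derive r 1 (fun r => q (y + r *: delta_mx i 0))
    (pd i q (y + r *: delta_mx i 0)).
  by move=> ra; apply/is_derive_lineP; apply: derivableP; exact: sC_derivable sq (Dy _ ra).
have [c ca] := mean_value_signed h.
by rewrite scale0r addr0 => cE; exists c.
Qed.

Lemma open_nbhs_norm (R : realType) n (D : set 'cV[R]_n) x :
  open D -> D x -> exists2 r : R, 0 < r & forall y, `|y - x| < r -> D y.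
Proof.
move=> oD Dx; have /nbhs_ballP[r /= r0 rD] := open_nbhs_nbhs (conj oD Dx).
by exists r => // y yx; apply: rD; rewrite -ball_normE /= distrC.
Qed.

Lemma continuous_norm (R : realType) n (q : 'cV[R]_n -> R) x (e : R) :
  {for x, continuous q} -> 0 < e ->
  exists2 r : R, 0 < r & forall y, `|y - x| < r -> `|q y - q x| < e.
Proof.
move=> cq e0; have /cvgrPdist_lt /(_ e e0) /nbhs_ballP[r /= r0 rD] := cq.
by exists r => // y yx; rewrite distrC; apply: rD; rewrite -ball_normE /= distrC.
Qed.

(* The increment is split along the hybrid points whose first [k] coordinates are moved. *)
Lemma sC1_expand (R : realType) n (D : set 'cV[R]_n) q x (e : R) :
  open D -> sC 1 D q -> D x -> 0 < e ->
  exists2 r : R, 0 < r & forall h : 'cV[R]_n, `|h| < r ->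
    `|q (x + h) - q x - \sum_(i < n) h i 0 * pd i q x| <= e * `|h|.
Proof.
move=> oD sq Dx e0.
have [r1 r10 r1D] := open_nbhs_norm oD Dx.
pose e1 := e / n.+1%:R.
have e10 : 0 < e1 by rewrite divr_gt0.
have [r2 r20 r2P] : exists2 r : R, 0 < r & forall (i : 'I_n) y, `|y - x| < r ->
    `|pd i q y - pd i q x| <= e1.
  have rP (i : 'I_n) : exists r : R, 0 < r /\ forall y, `|y - x| < r ->
      `|pd i q y - pd i q x| <= e1.
    have [r r0 rP] := continuous_norm (sC_continuous (sC_pd i sq) Dx) e10.
    by exists r; split => // y /rP/ltW.
  have [r rP'] := choice rP.
  exists (\big[Num.min/1]_(i < n) r i).
    by apply/bigmin_gtP; split => // i _; have [] := rP' i.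
  move=> i y yx; have [_] := rP' i; apply.
  by apply: lt_le_trans yx _; exact: bigmin_le.
exists (Num.min r1 r2); first by rewrite lt_min r10.
move=> h; rewrite lt_min => /andP[hr1 hr2].
pose P k : 'cV[R]_n := \col_i (if (i < k)%N then h i 0 else 0).
have P0 : P 0%N = 0 by apply/matrixP => i j; rewrite !mxE.
have Pn : P n = h by apply/matrixP => i j; rewrite !mxE ltn_ord (ord1 j).
have PS (i : 'I_n) : P i.+1 = P i + h i 0 *: delta_mx i 0.
  apply/matrixP => j k; rewrite (ord1 k) !mxE eqxx andbT ltnS.
  have [ij|ji|/val_inj ->] := ltngtP j i.
  - by rewrite (_ : j == i = false) ?mulr0 ?addr0//; apply/eqP => ji; rewrite ji ltnn in ij.
  - by rewrite (_ : j == i = false) ?mulr0 ?addr0//; apply/eqP => ij; rewrite ij ltnn in ji.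
  - by rewrite eqxx mulr1 add0r.
have Pc (i : 'I_n) (c : R) : `|c| <= `|h i 0| -> `|P i + c *: delta_mx i 0| <= `|h|.
  move=> ch; apply: norm_le_coord => // j; rewrite !mxE eqxx andbT.
  have [->|ji] := eqVneq j i.
    by rewrite ltnn add0r mulr1 (le_trans ch)// coord_le_norm.
  by rewrite mulr0 addr0; case: ifP => _; rewrite ?normr0 ?coord_le_norm.
have stepE (i : 'I_n) :
   `|q (x + P i.+1) - q (x + P i) - h i 0 * pd i q x| <= e1 * `|h|.
  have [c ca] : exists2 c : R, `|c| <= `|h i 0| &
      q (x + P i + h i 0 *: delta_mx i 0) - q (x + P i) =
      pd i q (x + P i + c *: delta_mx i 0) * h i 0.
    apply: mean_value_pd sq _ => r ra; apply: r1D.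
    by rewrite -(addrA x) (addrAC x) subrr add0r (le_lt_trans _ hr1)// Pc.
  rewrite PS addrA => ->.
  rewrite mulrC -mulrBr normrM mulrC ler_pM ?coord_le_norm//.
  by apply: r2P; rewrite -(addrA x) (addrAC x) subrr add0r (le_lt_trans _ hr2)// Pc.
have -> : q (x + h) - q x = \sum_(i < n) (q (x + P i.+1) - q (x + P i)).
  by rewrite -(big_mkord xpredT (fun i => q (x + P i.+1) - q (x + P i)))
    (telescope_sumr (fun i => q (x + P i)))// P0 Pn addr0.
rewrite -sumrB (le_trans (ler_norm_sum _ _ _))//.
apply: (@le_trans _ _ (\sum_(i < n) e1 * `|h|)); first by apply: ler_sum => i _.
rewrite sumr_const card_ord -mulr_natr mulrAC ler_wpM2r//.
rewrite /e1 -mulrA ler_piMr ?(ltW e0)// mulrC.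
by rewrite ler_pdivrMr// mul1r ler_nat.
Qed.

(** [sC1_expand] takes the place of a total derivative: applied to the increment of [x], it replaces
    the quotient of [q] by the continuous linear form [L] of the quotient of [x]. *)
Lemma sC1_chain (R : realType) n (D : set 'cV[R]_n) q (x : R -> 'cV[R]_n) t v :
  open D -> sC 1 D q -> D (x t) -> is_derive t 1 x v ->
  is_derive t 1 (q \o x) (\sum_(i < n) v i 0 * pd i q (x t)).
Proof.
move=> oD sq Dx [dx vE].
have {dx vE} dx : h^-1 *: ((x \o shift t) (h *: 1) - x t) @[h --> 0^'] --> v.
  by rewrite -vE; exact: dx.
pose L (w : 'cV[R]_n) := \sum_(i < n) w i 0 * pd i q (x t).
have cL : continuous L.
  apply: continuous_big => [|i _]; first exact: add_continuous.
  move=> w; apply: cvgMr_tmp; [exact: nbhs_filter|exact: coord_continuous].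
suff H : h^-1 *: (((q \o x) \o shift t) (h *: 1) - (q \o x) t) @[h --> 0^'] --> L v.
  apply: DeriveDef; last exact/cvg_lim.
  by apply: cvgP H.
have cLd : L (h^-1 *: ((x \o shift t) (h *: 1) - x t)) @[h --> 0^'] --> L v.
  exact: (cvg_comp _ _ dx (cL v)).
have LZ a w : L (a *: w) = a * L w.
  by rewrite /L mulr_sumr; apply: eq_bigr => i _; rewrite mxE mulrA.
apply/cvgrPdist_le => e e0.
(* Near [t] the quotient of [x] is within one of [v], so its norm is at most [|v| + 1] and the
   remainder contributes at most [e / 2]. *)
pose e1 := e / 2 / (`|v| + 1).
have v10 : 0 < `|v| + 1 by rewrite ltr_wpDl.
have e10 : 0 < e1 by rewrite !divr_gt0.
have [r r0 rP] := sC1_expand oD sq Dx e10.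
have e20 : 0 < e / 2 by rewrite divr_gt0.
have A1 := (cvgrPdist_le _ _).1 cLd _ e20.
have A2 := (cvgrPdist_le _ _).1 dx _ ltr01.
have xc : (x \o shift t) (h *: 1) @[h --> 0^'] --> x t.
  have : h *: (h^-1 *: ((x \o shift t) (h *: 1) - x t)) + x t @[h --> 0^'] --> 0 *: v + x t.
    by apply: cvgD (cvgZ _ dx) (cvg_cst _); apply: cvg_within_filter; exact: cvg_id.
  rewrite scale0r add0r; apply: cvg_trans; apply: near_eq_cvg.
  near=> h; rewrite scalerA mulfV ?scale1r ?subrK//.
  by near: h; exact: nbhs_dnbhs_neq.
have A3 := (cvgrPdist_lt _ _).1 xc _ r0.
have FF : Filter (nbhs (0:R)^') by exact: dnbhs_filter.
apply: (@filterS _ _ FF _ _ _ (filterI (A3 FF) (filterI (A2 FF) (A1 FF)))) => h /= [h1 [h2 h3]].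
set y := x (h *: 1 + t) in h1 h2 h3 *.
have yE : x t + (y - x t) = y by rewrite addrC subrK.
have E : h^-1 *: (q y - q (x t)) = L (h^-1 *: (y - x t)) +
    h^-1 * (q (x t + (y - x t)) - q (x t) - L (y - x t)).
  by rewrite LZ yE -mulrDr [L _ + _]addrC subrK.
rewrite E opprD addrA (le_trans (ler_normB _ _))// [e]splitr lerD//.
rewrite normrM.
have -> : e / 2 = e1 * (`|v| + 1) by rewrite /e1 divfK// gt_eqF.
apply: (@le_trans _ _ (`|h^-1| * (e1 * `|y - x t|))).
  by rewrite ler_wpM2l// rP// distrC.
rewrite mulrCA ler_wpM2l ?(ltW e10)// -normrZ.
have := ler_distD v (h^-1 *: (y - x t)) 0; rewrite !subr0.
by move=> /le_trans; apply; rewrite addrC lerD2l distrC.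
Unshelve. all: by end_near. Qed.

Lemma is_derive_affine (R : realType) n (x v : 'cV[R]_n) (s : R) :
  is_derive s 1 (fun r : R => x + r *: v) v.
Proof.
rewrite -[v in X in is_derive _ _ _ X]add0r; apply: is_deriveD.
have d : differentiable (fun r : R => r *: v) s by exact: ex_diff.
apply: DeriveDef; first exact: diff_derivable.
by rewrite deriveE// diff_val scale1r.
Qed.

Lemma sC1_is_derive (R : realType) n (D : set 'cV[R]_n) q x v :
  open D -> sC 1 D q -> D x ->
  is_derive x v q (\sum_(i < n) v i 0 * pd i q x).
Proof.
move=> oD sq Dx.
have x0 : x + (0 : R) *: v = x by rewrite scale0r addr0.
rewrite -[x in is_derive x]x0; apply/is_derive_lineP.
have := @sC1_chain R n D q (fun r : R => x + r *: v) 0 v oD sq.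
by rewrite x0; apply => //; exact: is_derive_affine.
Qed.

(* The derivative of [q] along the field [v], written with partial derivatives so that it makes sense (and is smooth) without differentiability proofs. *)
Definition along (R : realType) n (v : 'cV[R]_n -> 'cV[R]_n) (q : 'cV[R]_n -> R)
    (x : 'cV[R]_n) : R := \sum_(i < n) v x i 0 * pd i q x.

(** On the domain this is [Lie_der v f], by [vC1_derive], in a form that can be iterated with
    [sC_along]. *)
Definition valong (R : realType) n (v f : 'cV[R]_n -> 'cV[R]_n)
    (x : 'cV[R]_n) : 'cV[R]_n := \col_c along v (fun y => f y c 0) x.

Lemma sC_along (R : realType) n k (D : set 'cV[R]_n) v q :
  open D -> vC k D v -> sC k.+1 D q -> sC k D (along v q).
Proof.
move=> oD sv sq; apply: sC_sum => // i.
by apply: sC_mul => //; exact: sC_pd.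
Qed.

Lemma vC_valong (R : realType) n k (D : set 'cV[R]_n) v f :
  open D -> vC k D v -> vC k.+1 D f -> vC k D (valong v f).
Proof.
move=> oD sv sf c; apply: eq_sC (sC_along oD sv (sf c)) => // y _.
by rewrite mxE.
Qed.

Lemma vC_le (R : realType) n k l (D : set 'cV[R]_n) f :
  (l <= k)%N -> vC k D f -> vC l D f.
Proof. by move=> lk sf c; exact: sC_le lk (sf c). Qed.

(** The second difference [Q k l] over a square of side [r] is symmetric in [k] and [l]. Two
    applications of the mean value theorem turn it into [r^2] times a mixed derivative at a nearby
    point, in either order, and continuity at [x] concludes. *)
Lemma schwarz (R : realType) n (D : set 'cV[R]_n) q x i j :
  open D -> sC 2 D q -> D x -> pd i (pd j q) x = pd j (pd i q) x.
Proof.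
move=> oD sq Dx; apply/eqP; rewrite -subr_eq0 -normr_le0; apply/ler_addgt0Pr => e e0.
rewrite add0r.
have [r1 r10 r1D] := open_nbhs_norm oD Dx.
have e20 : 0 < e / 2 by rewrite divr_gt0.
have [r2 r20 r2P] := continuous_norm (sC_continuous (sC_pd i (sC_pd j sq)) Dx) e20.
have [r3 r30 r3P] := continuous_norm (sC_continuous (sC_pd j (sC_pd i sq)) Dx) e20.
(* The factor 1/3 keeps two displacements of length [r] strictly within all three radii. *)
pose r := Num.min r1 (Num.min r2 r3) / 3.
have r0 : 0 < r by rewrite divr_gt0// !lt_min r10 r20.
have rm : r + r < Num.min r1 (Num.min r2 r3).
  have : 0 < Num.min r1 (Num.min r2 r3) by rewrite !lt_min r10 r20.
  by rewrite /r; set m := Num.min _ _; lra.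
have r1' : r + r < r1 by rewrite (lt_le_trans rm)// ge_min lexx.
have r2' : r + r < r2 by rewrite (lt_le_trans rm)// !ge_min lexx orbT.
have r3' : r + r < r3 by rewrite (lt_le_trans rm)// !ge_min lexx !orbT.
have dn (k l : 'I_n) (a b : R) : `|a| <= `|r| -> `|b| <= `|r| ->
    `|x + a *: delta_mx k 0 + b *: delta_mx l 0 - x| <= r + r.
  rewrite (ger0_norm (ltW r0)) => ar br.
  rewrite -(addrA x) (addrAC x) subrr add0r (le_trans (ler_normD _ _))// lerD//.
    rewrite normrZ -[leRHS]mulr1 ler_pM//; apply: norm_le_coord => // s; rewrite mxE.
    by case: (_ && _); rewrite ?normr1 ?normr0.
  rewrite normrZ -[leRHS]mulr1 ler_pM//; apply: norm_le_coord => // s; rewrite mxE.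
  by case: (_ && _); rewrite ?normr1 ?normr0.
have dD (k l : 'I_n) (a b : R) : `|a| <= `|r| -> `|b| <= `|r| ->
    D (x + a *: delta_mx k 0 + b *: delta_mx l 0).
  by move=> ar br; apply: r1D; rewrite (le_lt_trans (dn _ _ _ _ ar br)).
pose Q k l := q (x + r *: delta_mx k 0 + r *: delta_mx l 0) - q (x + r *: delta_mx k 0)
  - q (x + r *: delta_mx l 0) + q x.
have QE k l : exists c c', [/\ `|c| <= `|r|, `|c'| <= `|r| &
    Q k l = pd l (pd k q) (x + c *: delta_mx k 0 + c' *: delta_mx l 0) * r * r].
  pose F (s : R) := q (x + r *: delta_mx l 0 + s *: delta_mx k 0) - q (x + s *: delta_mx k 0).
  have FD (s : R) : `|s| <= `|r| -> is_derive s 1 F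
      (pd k q (x + r *: delta_mx l 0 + s *: delta_mx k 0) - pd k q (x + s *: delta_mx k 0)).
    move=> sr; apply: is_deriveB; apply/is_derive_lineP; apply: derivableP;
      apply: sC_derivable sq _.
      exact: dD.
    by have := @dD l k 0 s; rewrite scale0r addr0 normr0; apply.
  have [c cr] := mean_value_signed FD.
  rewrite /F !scale0r !addr0 => FE.
  have [c' c'r c'E] := @mean_value_pd R n D (pd k q) (x + c *: delta_mx k 0) l r (sC_pd k sq)
    (fun s sr => dD _ _ _ _ cr sr).
  exists c, c'; split => //.
  rewrite -c'E (addrAC x) -FE /Q (addrAC x (r *: delta_mx l 0)); lra.
have Qs : Q i j = Q j i by rewrite /Q (addrAC x (r *: delta_mx i 0)); lra.
clearbody Q.
have [c [c' [cr c'r cE]]] := QE i j.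
have [d [d' [dr d'r dE]]] := QE j i.
have E : pd j (pd i q) (x + c *: delta_mx i 0 + c' *: delta_mx j 0) =
         pd i (pd j q) (x + d *: delta_mx j 0 + d' *: delta_mx i 0).
  have rn : r != 0 by rewrite gt_eqF.
  by rewrite Qs dE in cE; move/(mulIf rn)/(mulIf rn) : cE => ->.
pose p0 := pd i (pd j q) (x + d *: delta_mx j 0 + d' *: delta_mx i 0).
have h2 : `|p0 - pd i (pd j q) x| < e / 2.
  exact: r2P _ (le_lt_trans (dn _ _ _ _ dr d'r) r2').
have h3 : `|p0 - pd j (pd i q) x| < e / 2.
  by rewrite /p0 -E; exact: r3P _ (le_lt_trans (dn _ _ _ _ cr c'r) r3').
move: h2 h3; move: p0 (pd i (pd j q) x) (pd j (pd i q) x) => p0 p1 p2 h2 h3.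
clear -h2 h3; apply: le_trans (ler_distD p0 p1 p2) _.
by rewrite [`|p1 - p0|]distrC [e]splitr ltW// ltrD.
Qed.

(** * Lie brackets as combinations of iterated derivatives *)

Lemma vC1_derive (R : realType) n (D : set 'cV[R]_n) (f v : 'cV[R]_n -> 'cV[R]_n) x :
  open D -> vC 1 D f -> D x ->
  derivable f x (v x) /\ 'D_(v x) f x = valong v f x.
Proof.
move=> oD sf Dx.
have df : derivable f x (v x).
  apply/derivable_mxP => i j; rewrite (ord1 j).
  by have [] := sC1_is_derive (v x) oD (sf i) Dx.
split => //; rewrite derive_mx//; apply/matrixP => i j; rewrite (ord1 j) !mxE.
by have [_ ->] := sC1_is_derive (v x) oD (sf i) Dx.
Qed.

Lemma bracketE (R : realType) n (D : set 'cV[R]_n) (f g : 'cV[R]_n -> 'cV[R]_n) x :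
  open D -> vC 1 D f -> vC 1 D g -> D x ->
  bracket f g x = valong f g x - valong g f x.
Proof.
move=> oD sf sg Dx; rewrite /bracket /Lie_der.
by rewrite (vC1_derive f oD sg Dx).2 (vC1_derive g oD sf Dx).2.
Qed.

(** The double sum is the Hessian of [q] paired with [v] and [w]; being symmetric by [schwarz], it
    drops out of commutators. *)
Lemma along_along (R : realType) n (D : set 'cV[R]_n) (v w : 'cV[R]_n -> 'cV[R]_n) q x :
  open D -> vC 1 D w -> sC 2 D q -> D x ->
  along v (along w q) x = along (valong v w) q x +
    \sum_(i < n) \sum_(j < n) w x i 0 * v x j 0 * pd j (pd i q) x.
Proof.
move=> oD sw sq Dx.
have dq i j : derivable (pd i q) x (delta_mx j 0) by exact: sC_derivable (sC_pd i sq) Dx.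
have dw i j : derivable (fun y => w y i 0) x (delta_mx j 0) by exact: sC_derivable (sw i) Dx.
have E j : pd j (along w q) x =
    \sum_(i < n) (w x i 0 * pd j (pd i q) x + pd i q x * pd j (fun y => w y i 0) x).
  rewrite (_ : along w q = \sum_(i < n) (fun y => w y i 0) * (pd i q)); last first.
    by apply/funext => y; rewrite fct_sumE.
  rewrite derive_sum; last by move=> i; exact: derivableM.
  by apply: eq_bigr => i _; rewrite deriveM.
rewrite /along; under eq_bigr => j _ do rewrite E mulr_sumr.
rewrite exchange_big /= -big_split/=; apply: eq_bigr => i _.
rewrite mxE /along mulr_suml -big_split/=; apply: eq_bigr => j _; ring.
Qed.

(** On coordinate functions the bracket acts as the commutator of derivations, the Hessian terms
    cancelling. The four terms are the iterated derivatives [field3] that averaging produces. *)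
Lemma bracket3E (R : realType) n (D : set 'cV[R]_n) (A B C : 'cV[R]_n -> 'cV[R]_n) x :
  open D -> vC 2 D A -> vC 2 D B -> vC 2 D C -> D x ->
  bracket (bracket A B) C x =
    valong A (valong B C) x - valong B (valong A C) x
    - valong C (valong A B) x + valong C (valong B A) x.
Proof.
move=> oD sA sB sC Dx.
have [sA1 sB1 sC1] : [/\ vC 1 D A, vC 1 D B & vC 1 D C].
  by split; exact: (@vC_le _ _ 2).
have AB y : D y -> valong A B y - valong B A y = bracket A B y.
  by move=> Dy; rewrite (bracketE oD sA1 sB1).
have sAB : vC 1 D (bracket A B).
  move=> c; have sAB := vC_valong oD sA1 sB c; have sBA := vC_valong oD sB1 sA c.
  apply: eq_sC (sC_add oD sAB (sC_mul oD (sC_cst 1 D (-1)) sBA)) => // y Dy.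
  by rewrite -AB// mulN1r [RHS]mxE; congr (_ + _); rewrite [RHS]mxE.
rewrite (bracketE oD sAB sC1 Dx); apply/matrixP => c j; rewrite (ord1 j) {j}.
have valongE v f : valong v f x c 0 = along v (fun y => f y c 0) x by rewrite mxE.
have K v w f : valong v (valong w f) x c 0 = along v (along w (fun y => f y c 0)) x.
  rewrite valongE; congr (along v _ x).
  by apply/funext => y; rewrite mxE.
have E1 : along C (fun y => bracket A B y c 0) x =
    along C (along A (fun y => B y c 0)) x - along C (along B (fun y => A y c 0)) x.
  rewrite /along -sumrB; apply: eq_bigr => i _; rewrite -mulrBr; congr (_ * _).
  rewrite -[X in X - _]/(pd i (along A (fun y => B y c 0)) x).
  rewrite -[X in _ - X]/(pd i (along B (fun y => A y c 0)) x).
  rewrite -deriveB; last 2 first.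
  - by apply: sC_derivable (sC_along oD sA1 (sB c)) Dx.
  - by apply: sC_derivable (sC_along oD sB1 (sA c)) Dx.
  apply: near_eq_derive; apply: near_eq_open oD _ Dx => y Dy.
  by rewrite -AB// !mxE.
have E2 : along (bracket A B) (fun y => C y c 0) x =
    along A (along B (fun y => C y c 0)) x - along B (along A (fun y => C y c 0)) x.
  rewrite !(along_along _ oD _ (sC c) Dx)//.
  rewrite [X in _ - (_ + X)]exchange_big /= opprD addrACA -[LHS]addr0; congr (_ + _).
    rewrite /along -sumrB; apply: eq_bigr => i _; rewrite -mulrBl -AB//; congr (_ * _).
    by rewrite !mxE.
  apply/esym/eqP; rewrite subr_eq0; apply/eqP.
  apply: eq_bigr => i _; apply: eq_bigr => j _.
  by rewrite (schwarz _ _ oD (sC c) Dx) [B x i 0 * _]mulrC.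
have sumE (P1 P2 Q1 Q2 Q3 Q4 : 'cV[R]_n) (a1 a2 a3 a4 : R) :
    P1 c 0 = a1 - a2 -> P2 c 0 = a3 - a4 ->
    Q1 c 0 = a1 -> Q2 c 0 = a2 -> Q3 c 0 = a3 -> Q4 c 0 = a4 ->
    (P1 - P2) c 0 = (Q1 - Q2 - Q3 + Q4) c 0.
  by move=> p1 p2 q1 q2 q3 q4; rewrite !mxE p1 p2 q1 q2 q3 q4 opprB addrA addrAC.
apply: sumE (etrans (valongE _ _) E2) (etrans (valongE _ _) E1) _ _ _ _; exact: K.
Qed.

(** * Bounds on compact convex sets *)

Definition segment_closed (R : realType) n (K : set 'cV[R]_n) :=
  forall x y (s : R), K x -> K y -> 0 <= s <= 1 -> K (x + s *: (y - x)).

Lemma sC_bounded (R : realType) n k (D K : set 'cV[R]_n) q :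
  sC k D q -> compact K -> K `<=` D ->
  exists2 B : R, 0 <= B & forall x, K x -> `|q x| <= B.
Proof.
move=> sq cK KD.
have [->|/set0P[x0 Kx0]] := eqVneq K set0; first by exists 0.
have cq : {within K, continuous (fun x => `|q x|)}.
  apply: continuous_in_subspaceT => x /[!inE] /KD Dx.
  have := sC_continuous sq Dx.
  by move=> cqx; apply: (@continuous_comp _ _ _ q (fun y : R => `|y|)) cqx _; exact: norm_continuous.
have [c Kc cP] := compact_EVT_max (ex_intro _ x0 Kx0) cK cq.
by exists `|q c| => // x Kx; apply: cP; rewrite inE.
Qed.

Lemma sC1_lipschitz (R : realType) n (D K : set 'cV[R]_n) q :
  open D -> sC 1 D q -> compact K -> K `<=` D -> segment_closed K ->
  exists2 L : R, 0 <= L & forall x y, K x -> K y -> `|q x - q y| <= L * `|x - y|.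
Proof.
move=> oD sq cK KD segK.
have bP i : exists B : R, 0 <= B /\ forall x, K x -> `|pd i q x| <= B.
  by have [B B0 BP] := sC_bounded (sC_pd i sq) cK KD; exists B.
have [B BP] := choice bP.
exists (\sum_(i < n) B i); first by apply: sumr_ge0 => i _; have [] := BP i.
move=> y x Ky Kx.
have dP (s : R) : 0 <= s <= 1 -> is_derive s 1 (fun s => q (x + s *: (y - x)))
    (\sum_(i < n) (y - x) i 0 * pd i q (x + s *: (y - x))).
  move=> s01; apply/is_derive_lineP; apply: sC1_is_derive oD sq _.
  by apply: KD; exact: segK.
have d (x1 : R) : x1 \in `]0, 1[%R -> is_derive x1 1 (fun s : R => q (x + s *: (y - x)))
    (\sum_(i < n) (y - x) i 0 * pd i q (x + x1 *: (y - x))).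
  by rewrite in_itv/= => /andP[s0 s1]; apply: dP; rewrite !ltW.
have cc : {within `[(0:R), 1], continuous (fun s : R => q (x + s *: (y - x)))}.
  apply: derivable_within_continuous => s; rewrite in_itv/= => s01.
  by have [] := dP s s01.
have [c c01] := MVT_segment ler01 d cc.
rewrite scale1r addrCA subrr addr0 scale0r addr0 subr0 mulr1 => ->.
rewrite mulr_suml (le_trans (ler_norm_sum _ _ _))//; apply: ler_sum => i _.
rewrite normrM mulrC ler_pM ?coord_le_norm//.
by have [_] := BP i; apply; apply: segK => //; rewrite in_itv/= in c01.
Qed.

(** * Averaging *)

Definition lip (R : realType) (a b : R) (p : R -> R) := exists2 C : R, 0 <= C &
  forall s t, a <= s <= b -> a <= t <= b -> `|p t - p s| <= C * `|t - s|.

Lemma lip_sac (R : realType) (a b : R) p : lip a b p -> sac a b p.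
Proof.
move=> [C C0 CP] e e0; exists (e / (C + 1)); first by rewrite divr_gt0// ltr_wpDl.
move=> N s t st _; rewrite ltr_pdivlMr ?ltr_wpDl// => h.
apply: le_lt_trans h; rewrite mulrC mulr_sumr; apply: ler_sum => i _.
have [h1 h2 h3] := st i.
rewrite (le_trans (CP _ _ _ _)) ?h1 ?h3 ?(le_trans h1 h2) ?(le_trans h2 h3)//.
by rewrite ger0_norm ?subr_ge0// ler_wpM2r ?subr_ge0// lerDl.
Qed.

Lemma lip_cst (R : realType) (a b c : R) : lip a b (fun=> c).
Proof. by exists 0 => // s t _ _; rewrite subrr normr0 mul0r. Qed.

Lemma lip_id (R : realType) (a b : R) : lip a b id.
Proof. by exists 1 => // s t _ _; rewrite mul1r. Qed.

Lemma lip_add (R : realType) (a b : R) p q :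
  lip a b p -> lip a b q -> lip a b (fun t => p t + q t).
Proof.
move=> [C C0 CP] [C' C'0 CP']; exists (C + C'); first by rewrite addr_ge0.
move=> s t hs ht; rewrite opprD addrACA (le_trans (ler_normD _ _))// mulrDl.
by rewrite lerD ?CP ?CP'.
Qed.

Lemma lip_mul (R : realType) (a b : R) p q :
  lip a b p -> lip a b q -> lip a b (fun t => p t * q t).
Proof.
move=> [C C0 CP] [C' C'0 CP'].
have bnd (f : R -> R) c s : 0 <= c -> (forall s t, a <= s <= b -> a <= t <= b -> `|f t - f s| <= c * `|t - s|) ->
    a <= s <= b -> `|f s| <= `|f a| + c * (b - a).
  move=> c0 fP /andP[as_ sb]; have ab := le_trans as_ sb.
  rewrite -[f s](subrK (f a)) addrC (le_trans (ler_normD _ _))// lerD2l.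
  rewrite (le_trans (fP _ _ _ _)) ?lexx ?ab ?as_ ?sb//.
  by rewrite ger0_norm ?subr_ge0// ler_wpM2l// lerD2r.
exists (C * (`|q a| + C' * `|b - a|) + (`|p a| + C * `|b - a|) * C').
  by rewrite addr_ge0 ?mulr_ge0 ?addr_ge0 ?mulr_ge0.
move=> s t hs ht.
have -> : p t * q t - p s * q s = (p t - p s) * q t + p s * (q t - q s) by ring.
have ab : b - a <= `|b - a| by exact: ler_norm.
rewrite (le_trans (ler_normD _ _))// [leRHS]mulrDl !normrM lerD//.
  rewrite mulrAC ler_pM ?CP// (le_trans (bnd _ _ _ C'0 CP' ht))//.
  by rewrite lerD2l ler_wpM2l.
rewrite -mulrA ler_pM ?CP'// (le_trans (bnd _ _ _ C0 CP hs))//.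
by rewrite lerD2l ler_wpM2l.
Qed.

Lemma lip_sum (R : realType) (a b : R) (I : Type) (r : seq I) (p : I -> R -> R) :
  (forall i, lip a b (p i)) -> lip a b (fun t => \sum_(i <- r) p i t).
Proof.
move=> h; elim: r => [|i r IH].
  by rewrite (_ : (fun _ => _) = fun=> 0); [exact: lip_cst|apply/funext => t; rewrite big_nil].
rewrite (_ : (fun _ => _) = fun t => p i t + \sum_(i <- r) p i t); first exact: lip_add.
by apply/funext => t; rewrite big_cons.
Qed.

Lemma lip_opp (R : realType) (a b : R) p : lip a b p -> lip a b (fun t => - p t).
Proof.
move=> [C C0 CP]; exists C => // s t hs ht.
by rewrite -opprD normrN CP.
Qed.

Lemma is_derive_lip (R : realType) (a b C : R) (p dp : R -> R) : 0 <= C ->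
  (forall t : R, is_derive t 1 p (dp t)) -> (forall t, `|dp t| <= C) -> lip a b p.
Proof.
move=> C0 pd dC; exists C => // s t _ _.
wlog st : s t / s <= t.
  move=> H; case: (leP s t) => [|/ltW] st; first exact: H.
  by rewrite distrC [`|t - s|]distrC H.
have d x : x \in `]s, t[%R -> is_derive x 1 p (dp x) by move=> _; exact: pd.
have cc : {within `[s, t], continuous p}.
  by apply: derivable_within_continuous => x _; have [] := pd x.
have [c _ ->] := MVT_segment st d cc.
by rewrite normrM ler_wpM2r.
Qed.

Lemma is_derive_big (R : realType) (I : Type) (r : seq I) (p : I -> R -> R) (dp : I -> R) (t : R) :
  (forall i, is_derive t 1 (p i) (dp i)) ->
  is_derive t 1 (fun t => \sum_(i <- r) p i t) (\sum_(i <- r) dp i).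
Proof.
move=> h; elim: r => [|i r IH].
  rewrite big_nil (_ : (fun _ => _) = fun=> 0); first exact: is_derive_cst.
  by apply/funext => s; rewrite big_nil.
rewrite big_cons (_ : (fun _ => _) = p i + (fun t => \sum_(i <- r) p i t)).
  exact: is_deriveD.
by apply/funext => s; rewrite big_cons.
Qed.

Lemma is_derive_add (R : realType) (p q : R -> R) (t dp dq : R) :
  is_derive t 1 p dp -> is_derive t 1 q dq ->
  is_derive t 1 (fun s => p s + q s) (dp + dq).
Proof. exact: is_deriveD. Qed.

Lemma is_derive_sub (R : realType) (p q : R -> R) (t dp dq : R) :
  is_derive t 1 p dp -> is_derive t 1 q dq ->
  is_derive t 1 (fun s => p s - q s) (dp - dq).
Proof. exact: is_deriveB. Qed.

Lemma is_derive_mul (R : realType) (p q : R -> R) (t dp dq : R) :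
  is_derive t 1 p dp -> is_derive t 1 q dq ->
  is_derive t 1 (fun s => p s * q s) (dp * q t + p t * dq).
Proof.
move=> hp hq; apply: is_derive_eq (is_deriveM hp hq) _.
by rewrite /GRing.scale/= addrC mulrC; ring.
Qed.

Lemma ler_norm_sum_const (R : realType) (J : finType) (F : J -> R) (C : R) :
  (forall j, `|F j| <= C) -> `|\sum_j F j| <= #|J|%:R * C.
Proof.
move=> h; rewrite (le_trans (ler_norm_sum _ _ _))//.
by rewrite (le_trans (ler_sum _ (fun j _ => h j)))// sumr_const mulr_natl.
Qed.

Section Averaging.
Context (R : realType) (n : nat) (J : finType) (D K : set 'cV[R]_n)
  (X : J -> 'cV[R]_n -> 'cV[R]_n) (B L : R).

(** The indices follow the order of integration: the wave of the first index is integrated first,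
    and each later index adds an outer differentiation along its own field. *)
Definition field2 nu mu := valong (X mu) (X nu).
Definition field3 nu mu la := valong (X la) (field2 nu mu).

(** [B] bounds the gradients that the non-oscillating part of the velocity meets; [L] compares two
    points of the trajectory. No gradient of [field3] is listed, because its value is frozen at the
    initial point. *)
Record field_bounds : Prop := FieldBounds {
  fb_B0 : 0 <= B;
  fb_L0 : 0 <= L;
  fb_pd1 : forall nu c y, K y -> \sum_(i < n) `|pd i (fun y => X nu y c 0) y| <= B;
  fb_pd2 : forall nu mu c y, K y ->
    \sum_(i < n) `|pd i (fun y => field2 nu mu y c 0) y| <= B;
  fb_lip1 : forall nu c y z, K y -> K z ->
    `|X nu y c 0 - X nu z c 0| <= L * `|y - z|;
  fb_lip2 : forall nu mu c y z, K y -> K z ->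
    `|field2 nu mu y c 0 - field2 nu mu z c 0| <= L * `|y - z|;
  fb_lip3 : forall nu mu la c y z, K y -> K z ->
    `|field3 nu mu la y c 0 - field3 nu mu la z c 0| <= L * `|y - z| }.

(* The increment of the near-identity change of variables
   [x - sum U X(x) + sum V X2(x) - sum W X3(x a)] is computed: the primitives
   [U], [V], [W] cancel every oscillating term up to third order. *)
Lemma averaging (a b : R) (x : R -> 'cV[R]_n) (u U : J -> R -> R)
    (V : J -> J -> R -> R) (W : J -> J -> J -> R -> R)
    (m2 : J -> J -> R) (m3 : J -> J -> J -> R) (G0 : 'cV[R]_n)
    (M M' U0 V0 P0 m0 r Lx : R) :
  open D -> K `<=` D -> (forall nu, vC 3 D (X nu)) -> field_bounds ->
  a <= b -> (forall t, a <= t <= b -> K (x t)) ->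
  0 <= Lx -> (forall s t, a <= s <= b -> a <= t <= b -> `|x t - x s| <= Lx * `|t - s|) ->
  (forall t, a <= t <= b -> `|x t - x a| <= r) ->
  0 <= M -> 0 <= M' ->
  {ae (@lebesgue_measure R), forall t : R, a < t < b -> exists G,
    [/\ is_derive t 1 x (G + \sum_nu u nu t *: X nu (x t)),
        `|G - G0| <= M & `|G| <= M']} ->
  (forall nu (t : R), is_derive t 1 (U nu) (u nu t)) ->
  (forall nu mu (t : R), is_derive t 1 (V nu mu) (U nu t * u mu t - m2 nu mu)) ->
  (forall nu mu la (t : R), is_derive t 1 (W nu mu la) (V nu mu t * u la t - m3 nu mu la)) ->
  (forall nu, lip a b (U nu)) -> (forall nu mu, lip a b (V nu mu)) ->
  (forall nu mu la, lip a b (W nu mu la)) ->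
  (forall nu, U nu b = U nu a) -> (forall nu mu, V nu mu b = V nu mu a) ->
  (forall nu mu la, W nu mu la b = W nu mu la a) ->
  (forall nu t, `|U nu t| <= U0) -> (forall nu mu t, `|V nu mu t| <= V0) ->
  (forall nu mu la t, `|V nu mu t * u la t| <= P0) -> (forall nu mu, `|m2 nu mu| <= m0) ->
  forall (c : 'I_n) (N : R), N = #|J|%:R ->
  `|x b c 0 - x a c 0 - (b - a) * (G0 c 0 - \sum_nu \sum_mu m2 nu mu * field2 nu mu (x a) c 0
      + \sum_nu \sum_mu \sum_la m3 nu mu la * field3 nu mu la (x a) c 0)|
  <= (b - a) * (M + N * (U0 * (B * M')) + N * (N * (V0 * (B * M'))) + N * (N * (m0 * (L * r)))
       + N * (N * (N * (P0 * (L * r))))) + (N * U0 + N * (N * V0)) * (L * `|x b - x a|).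
Proof.
move=> oD KD sX fb ab xK Lx0 xL xr M0 M'0 xd dU dV dW lU lV lW eU eV eW bU bV bP bm c N NE.
have [B0 L0 B1 B2 L1 L2 L3] := fb.
have aab : a <= a <= b by rewrite lexx ab.
have bab : a <= b <= b by rewrite lexx ab.
pose F1 nu t := X nu (x t) c 0.
pose F2 nu mu t := field2 nu mu (x t) c 0.
pose f3 nu mu la := field3 nu mu la (x a) c 0.
pose main := G0 c 0 - \sum_nu \sum_mu m2 nu mu * field2 nu mu (x a) c 0
      + \sum_nu \sum_mu \sum_la m3 nu mu la * f3 nu mu la.
(* [f3] is a constant, so differentiating the triple sum brings in no derivative of [field3].
   Subtracting [t * main] leaves a function whose derivative [err] is small. *)
pose z t := x t c 0 - \sum_nu U nu t * F1 nu t + \sum_nu \sum_mu V nu mu t * F2 nu mu t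
  - \sum_nu \sum_mu \sum_la W nu mu la t * f3 nu mu la - t * main.
pose E := M + N * (U0 * (B * M')) + N * (N * (V0 * (B * M'))) + N * (N * (m0 * (L * r)))
       + N * (N * (N * (P0 * (L * r)))).
have lx : lip a b (fun t => x t c 0).
  exists Lx => // s t hs ht; rewrite (le_trans _ (xL _ _ hs ht))//.
  by rewrite (le_trans _ (coord_le_norm _ c))// !mxE.
have lK (p : 'cV[R]_n -> R) : (forall y z, K y -> K z -> `|p y - p z| <= L * `|y - z|) ->
    lip a b (p \o x).
  move=> pL; exists (L * Lx); first by rewrite mulr_ge0.
  move=> s t hs ht; rewrite (le_trans (pL _ _ (xK _ ht) (xK _ hs)))//.
  by rewrite -mulrA ler_wpM2l// xL.
have lF1 nu : lip a b (F1 nu) by apply: (lK (fun y => X nu y c 0)); exact: L1.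
have lF2 nu mu : lip a b (F2 nu mu).
  by apply: (lK (fun y => field2 nu mu y c 0)); exact: L2.
have lz : lip a b z.
  apply: lip_add; last by apply: lip_opp; apply: lip_mul; [exact: lip_id|exact: lip_cst].
  apply: lip_add; last first.
    apply: lip_opp; apply: lip_sum => nu; apply: lip_sum => mu; apply: lip_sum => la.
    by apply: lip_mul; [exact: lW|exact: lip_cst].
  apply: lip_add; last first.
    by apply: lip_sum => nu; apply: lip_sum => mu; apply: lip_mul.
  by apply: lip_add => //; apply: lip_opp; apply: lip_sum => nu; apply: lip_mul.
pose F3 nu mu la t := field3 nu mu la (x t) c 0.
have chain (p : 'cV[R]_n -> R) t G : sC 1 D p -> D (x t) ->
    is_derive t 1 x (G + \sum_nu u nu t *: X nu (x t)) ->
    is_derive t 1 (p \o x) (\sum_(i < n) G i 0 * pd i p (x t) +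
      \sum_mu u mu t * along (X mu) p (x t)).
  move=> sp Dxt dx; apply: is_derive_eq (sC1_chain oD sp Dxt dx) _.
  under eq_bigr => i _ do rewrite mxE mulrDl.
  rewrite big_split /=; congr (_ + _).
  under [RHS]eq_bigr => mu _ do rewrite /along mulr_sumr.
  rewrite exchange_big /=; apply: eq_bigr => i _.
  by rewrite summxE mulr_suml; apply: eq_bigr => mu _; rewrite mxE mulrA.
pose g1 (G : 'cV[R]_n) (t : R) nu := \sum_(i < n) G i 0 * pd i (fun y => X nu y c 0) (x t) : R.
pose g2 (G : 'cV[R]_n) (t : R) nu mu := \sum_(i < n) G i 0 * pd i (fun y => field2 nu mu y c 0) (x t) : R.
(* What survives the cancellations: the deviation of the drift, the drift acting on the two
   corrected fields, and the change of [field2] and [field3] since time [a]. *)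
pose err (G : 'cV[R]_n) (t : R) := (G c 0 - G0 c 0) - \sum_nu U nu t * g1 G t nu
  + \sum_nu \sum_mu V nu mu t * g2 G t nu mu
  - \sum_nu \sum_mu m2 nu mu * (F2 nu mu t - F2 nu mu a)
  + \sum_nu \sum_mu \sum_la V nu mu t * u la t * (F3 nu mu la t - f3 nu mu la).
have sX1 nu : sC 1 D (fun y => X nu y c 0) by exact: sC_le (sX nu c).
have sX2 nu mu : sC 1 D (fun y => field2 nu mu y c 0).
  by apply: sC_le (vC_valong oD _ (sX nu) c) => // e; exact: sC_le (sX mu e).
have alg (g g0 s1 s2 s3 s4 s5 s6 s7 s8 s9 t : R) :
    g + s1 - (s1 + (s2 + s3)) + (s3 - s4 + (s5 + s6)) - (s7 - s8) -
      (1 * (g0 - s9 + s8) + t * 0) = g - g0 - s2 + s5 - (s4 - s9) + (s6 - s7).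
  by ring.
have dz (t : R) G : D (x t) ->
    is_derive t 1 x (G + \sum_nu u nu t *: X nu (x t)) -> is_derive t 1 z (err G t).
  move=> Dxt dx.
  have dF1 nu : is_derive t 1 (F1 nu) (g1 G t nu + \sum_mu u mu t * F2 nu mu t).
    apply: is_derive_eq (chain _ _ _ (sX1 nu) Dxt dx) _; congr (_ + _).
    by apply: eq_bigr => mu _; rewrite /F2 /field2 mxE.
  have dF2 nu mu : is_derive t 1 (F2 nu mu) (g2 G t nu mu + \sum_la u la t * F3 nu mu la t).
    apply: is_derive_eq (chain _ _ _ (sX2 nu mu) Dxt dx) _; congr (_ + _).
    by apply: eq_bigr => la _; rewrite /F3 /field3 mxE.
  have dx0 : is_derive t 1 (fun t => x t c 0) (G c 0 + \sum_nu u nu t * F1 nu t).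
    have [dxt xtE] := dx.
    apply: DeriveDef; first by have /derivable_mxP := dxt; exact.
    have := congr1 (fun A : 'cV[R]_n => A c 0) xtE.
    rewrite derive_mx// !mxE => ->; rewrite summxE; congr (_ + _).
    by apply: eq_bigr => nu _; rewrite mxE.
  have H1 := is_derive_big (index_enum J) (fun nu => is_derive_mul (dU nu t) (dF1 nu)).
  have H2 := is_derive_big (index_enum J) (fun nu => is_derive_big (index_enum J)
    (fun mu => is_derive_mul (dV nu mu t) (dF2 nu mu))).
  have H3 := is_derive_big (index_enum J) (fun nu => is_derive_big (index_enum J)
    (fun mu => is_derive_big (index_enum J) (fun la =>
    is_derive_mul (dW nu mu la t) (is_derive_cst (f3 nu mu la) t 1)))).
  have H4 := is_derive_mul (is_derive_id t 1) (is_derive_cst main t 1).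
  have H5 := is_derive_sub (is_derive_sub (is_derive_add (is_derive_sub dx0 H1) H2) H3) H4.
  apply: is_derive_eq H5 _.
  have -> : \sum_nu (u nu t * F1 nu t + U nu t * (g1 G t nu + \sum_mu u mu t * F2 nu mu t)) =
    \sum_nu u nu t * F1 nu t + (\sum_nu U nu t * g1 G t nu +
      \sum_nu \sum_mu U nu t * u mu t * F2 nu mu t).
    rewrite -!big_split/=; apply: eq_bigr => nu _.
    rewrite mulrDr; congr (_ + (_ + _)).
    by rewrite mulr_sumr; apply: eq_bigr => mu _; rewrite mulrA.
  have -> : \sum_nu \sum_mu ((U nu t * u mu t - m2 nu mu) * F2 nu mu t +
      V nu mu t * (g2 G t nu mu + \sum_la u la t * F3 nu mu la t)) =
    \sum_nu \sum_mu U nu t * u mu t * F2 nu mu t - \sum_nu \sum_mu m2 nu mu * F2 nu mu t +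
     (\sum_nu \sum_mu V nu mu t * g2 G t nu mu +
      \sum_nu \sum_mu \sum_la V nu mu t * u la t * F3 nu mu la t).
    rewrite -sumrB -!big_split/=; apply: eq_bigr => nu _.
    rewrite -sumrB -!big_split/=; apply: eq_bigr => mu _.
    rewrite mulrBl mulrDr; congr (_ + (_ + _)).
    by rewrite mulr_sumr; apply: eq_bigr => la _; rewrite mulrA.
  have -> : \sum_nu \sum_mu \sum_la ((V nu mu t * u la t - m3 nu mu la) * f3 nu mu la
      + W nu mu la t * 0) =
    \sum_nu \sum_mu \sum_la V nu mu t * u la t * f3 nu mu la -
    \sum_nu \sum_mu \sum_la m3 nu mu la * f3 nu mu la.
    rewrite -sumrB; apply: eq_bigr => nu _; rewrite -sumrB; apply: eq_bigr => mu _.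
    by rewrite -sumrB; apply: eq_bigr => la _; rewrite mulr0 addr0 mulrBl.
  have E4 : \sum_nu \sum_mu m2 nu mu * (F2 nu mu t - F2 nu mu a) =
    \sum_nu \sum_mu m2 nu mu * F2 nu mu t -
      \sum_nu \sum_mu m2 nu mu * field2 nu mu (x a) c 0.
    rewrite -sumrB; apply: eq_bigr => nu _; rewrite -sumrB; apply: eq_bigr => mu _.
    by rewrite mulrBr.
  have E5 : \sum_nu \sum_mu \sum_la V nu mu t * u la t * (F3 nu mu la t - f3 nu mu la) =
    \sum_nu \sum_mu \sum_la V nu mu t * u la t * F3 nu mu la t -
    \sum_nu \sum_mu \sum_la V nu mu t * u la t * f3 nu mu la.
    rewrite -sumrB; apply: eq_bigr => nu _; rewrite -sumrB; apply: eq_bigr => mu _.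
    by rewrite -sumrB; apply: eq_bigr => la _; rewrite mulrBr.
  by rewrite /err E4 E5 /main; exact: alg.
have bz (t : R) (G : 'cV[R]_n) : a <= t <= b -> `|G - G0| <= M -> `|G| <= M' -> `|err G t| <= E.
  move=> tab GM GM'.
  have Kt := xK _ tab; have Ka := xK _ aab.
  have gB (p : 'cV[R]_n -> R) : \sum_(i < n) `|pd i p (x t)| <= B ->
      `|\sum_(i < n) G i 0 * pd i p (x t)| <= B * M'.
    move=> pB; rewrite (le_trans (ler_norm_sum _ _ _))//.
    rewrite (le_trans _ (ler_wpM2r M'0 pB))// mulr_suml; apply: ler_sum => i _.
    by rewrite normrM mulrC ler_wpM2l// (le_trans (coord_le_norm _ _)).
  have e1 : `|G c 0 - G0 c 0| <= M.
    by rewrite (le_trans _ GM)// (le_trans _ (coord_le_norm _ c))// !mxE.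
  have mulB (p q C C' : R) : `|p| <= C -> `|q| <= C' -> `|p * q| <= C * C'.
    by move=> h1 h2; rewrite normrM ler_pM.
  have e2 : `|\sum_nu U nu t * g1 G t nu| <= N * (U0 * (B * M')).
    rewrite NE; apply: ler_norm_sum_const => nu; apply: mulB => //; apply: gB; exact: B1.
  have e3 : `|\sum_nu \sum_mu V nu mu t * g2 G t nu mu| <= N * (N * (V0 * (B * M'))).
    rewrite NE; apply: ler_norm_sum_const => nu; apply: ler_norm_sum_const => mu.
    apply: mulB => //; apply: gB; exact: B2.
  have Lr (y : R) : y <= L * `|x t - x a| -> y <= L * r.
    by move=> /le_trans; apply; rewrite ler_wpM2l// xr.
  have e4 : `|\sum_nu \sum_mu m2 nu mu * (F2 nu mu t - F2 nu mu a)| <= N * (N * (m0 * (L * r))).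
    rewrite NE; apply: ler_norm_sum_const => nu; apply: ler_norm_sum_const => mu.
    apply: mulB => //; apply: Lr; exact: L2.
  have e5 : `|\sum_nu \sum_mu \sum_la V nu mu t * u la t * (F3 nu mu la t - f3 nu mu la)|
      <= N * (N * (N * (P0 * (L * r)))).
    rewrite NE; apply: ler_norm_sum_const => nu; apply: ler_norm_sum_const => mu.
    apply: ler_norm_sum_const => la.
    apply: mulB => //; apply: Lr; exact: L3.
  rewrite /err /E (le_trans (ler_normD _ _))// lerD// (le_trans (ler_normB _ _))// lerD//.
  by rewrite (le_trans (ler_normD _ _))// lerD// (le_trans (ler_normB _ _))// lerD.
have E0 : 0 <= E.
  have r0 : 0 <= r by rewrite (le_trans _ (xr _ aab)).
  (* The nonnegativity of [U0], [V0], [m0] and [P0] can be read off only from an element of [J]; for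
     empty [J] the factor [N] is zero. *)
  have NJ (y : R) : (J -> 0 <= y) -> 0 <= N * y.
    move=> h; rewrite NE; case: (pickP (@predT J)) => [j _|h0]; first by rewrite mulr_ge0// h.
    by rewrite eq_card0 ?mul0r// => j; rewrite h0.
  have U00 (nu : J) : 0 <= U0 := le_trans (normr_ge0 _) (bU nu a).
  have V00 (nu : J) : 0 <= V0 := le_trans (normr_ge0 _) (bV nu nu a).
  have m00 (nu : J) : 0 <= m0 := le_trans (normr_ge0 _) (bm nu nu).
  have P00 (nu : J) : 0 <= P0 := le_trans (normr_ge0 _) (bP nu nu nu a).
  rewrite /E !addr_ge0//.
  - by apply: NJ => nu; rewrite !mulr_ge0// U00.
  - by do 2!apply: (NJ _) => ?; rewrite !mulr_ge0//; exact: V00.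
  - by do 2!apply: (NJ _) => ?; rewrite !mulr_ge0//; exact: m00.
  - by do 3!apply: (NJ _) => ?; rewrite !mulr_ge0//; exact: P00.
have ze : `|z b - z a| <= E * (b - a).
  have zd (t : R) : (exists G, [/\ is_derive t 1 x (G + \sum_nu u nu t *: X nu (x t)),
        `|G - G0| <= M & `|G| <= M']) -> a < t < b ->
      exists2 v, is_derive t 1 z v & `|v| <= E.
    move=> [G [h1 h2 h3]] /andP[t1 t2].
    have tab : a <= t <= b by rewrite !ltW.
    by exists (err G t); [apply: dz => //; apply: KD; exact: xK|exact: bz].
  rewrite ler_norml; apply/andP; split; last first.
    apply: sac_increment_le => //; first exact: lip_sac.
    apply: ae_impl xd => t h tab; have [v dv vE] := zd t (h tab) tab.
    by exists v => //; exact: le_trans (ler_norm _) vE.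
  rewrite lerNl opprB.
  have := @sac_increment_le R (fun t => - z t) a b E E0 ab (lip_sac (lip_opp lz)).
  rewrite opprK [- _ + _]addrC; apply.
  apply: ae_impl xd => t h tab; have [v dv vE] := zd t (h tab) tab.
  exists (- v); first exact: is_deriveN.
  by rewrite (le_trans (ler_norm _))// normrN.
have algz (xb xa s1 s2 s3 s4 s5 k : R) :
    xb - xa - (b - a) * k = xb - s1 + s2 - s3 - b * k - (xa - s4 + s5 - s3 - a * k)
      + (s1 - s4) - (s2 - s5).
  by ring.
(* By periodicity the boundary terms become [U nu a] and [V nu mu a] times increments of the fields,
   and the [W] terms cancel because [f3] is constant. Hence the factor [|x b - x a|] in the
   bound. *)
have zE : x b c 0 - x a c 0 - (b - a) * main = (z b - z a)
    + \sum_nu U nu a * (F1 nu b - F1 nu a)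
    - \sum_nu \sum_mu V nu mu a * (F2 nu mu b - F2 nu mu a).
  have EU : \sum_nu U nu b * F1 nu b = \sum_nu U nu a * F1 nu b.
    by apply: eq_bigr => nu _; rewrite eU.
  have EV : \sum_nu \sum_mu V nu mu b * F2 nu mu b = \sum_nu \sum_mu V nu mu a * F2 nu mu b.
    by apply: eq_bigr => nu _; apply: eq_bigr => mu _; rewrite eV.
  have EW : \sum_nu \sum_mu \sum_la W nu mu la b * f3 nu mu la =
      \sum_nu \sum_mu \sum_la W nu mu la a * f3 nu mu la.
    by apply: eq_bigr => nu _; apply: eq_bigr => mu _; apply: eq_bigr => la _; rewrite eW.
  rewrite /z EU EV EW.
  have -> : \sum_nu U nu a * (F1 nu b - F1 nu a) =
      \sum_nu U nu a * F1 nu b - \sum_nu U nu a * F1 nu a.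
    by rewrite -sumrB; apply: eq_bigr => nu _; rewrite mulrBr.
  have -> : \sum_nu \sum_mu V nu mu a * (F2 nu mu b - F2 nu mu a) =
      \sum_nu \sum_mu V nu mu a * F2 nu mu b - \sum_nu \sum_mu V nu mu a * F2 nu mu a.
    rewrite -sumrB; apply: eq_bigr => nu _; rewrite -sumrB; apply: eq_bigr => mu _.
    by rewrite mulrBr.
  exact: algz.
rewrite -/main -/E zE [X in _ <= _ + X]mulrDl addrA (le_trans (ler_normB _ _))// lerD//.
  rewrite (le_trans (ler_normD _ _))// lerD//; first by rewrite mulrC.
  rewrite NE -mulrA; apply: ler_norm_sum_const => nu.
  by rewrite normrM ler_pM//; apply: L1; exact: xK.
rewrite NE -!mulrA; apply: ler_norm_sum_const => nu; apply: ler_norm_sum_const => mu.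
by rewrite normrM ler_pM//; apply: L2; exact: xK.
Qed.
End Averaging.

(** * Means of products of waves *)

Section Waves.
Context (R : realType) (eps : R).
Hypothesis eps0 : 0 < eps.

(* Sines are waves of phase [- pi / 2]. *)
Definition wave (k : int) (phi t : R) : R := cos (2 * pi * k%:~R * t / eps + phi).

(* The inverse angular frequency; it is [0] for [k = 0]. *)
Definition iom (k : int) : R := (2 * pi * k%:~R)^-1.

(** The primitive of zero mean: another constant of integration would enter the second- and
    third-order means. It is again a wave, delayed by a quarter period, so the construction can be
    iterated. For [k = 0] it is zero, as is the wave minus its mean. *)
Definition wprim (k : int) (phi t : R) : R := eps * iom k * wave k (phi - pi / 2) t.

(* The mean of a wave over a period. *)
Definition wmean (k : int) (phi : R) : R := (k == 0)%:R * cos phi.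

Lemma iom0 : iom 0 = 0.
Proof. by rewrite /iom mulr0 invr0. Qed.

Lemma norm_iom (k : int) : `|iom k| <= 1.
Proof.
have [->|k0] := eqVneq k 0; first by rewrite iom0 normr0.
have k1 : 1 <= `|k%:~R : R|.
  by rewrite -intr_norm -[1]/(1%:~R) ler_int -gtz0_ge1 normr_gt0.
have p1 : 1 <= 2 * pi :> R by have := @pi_ge2 R; lra.
rewrite /iom normfV invf_le1; last first.
  by rewrite normr_gt0 mulf_neq0 ?intr_eq0// gt_eqF// (lt_le_trans ltr01).
by rewrite normrM (ger0_norm (le_trans ler01 p1)) mulr_ege1.
Qed.

Lemma norm_wave k phi t : `|wave k phi t| <= 1.
Proof. exact: cos_max. Qed.

Lemma norm_wprim k phi t : `|wprim k phi t| <= eps.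
Proof.
rewrite /wprim normrM -[leRHS]mulr1 ler_pM ?norm_wave//.
by rewrite normrM (ger0_norm (ltW eps0)) ler_piMr ?norm_iom// ltW.
Qed.

Lemma norm_wmean k phi : `|wmean k phi| <= 1.
Proof.
rewrite /wmean normrM mulr_ile1 ?cos_max//.
by case: (k == 0); rewrite ?normr1 ?normr0.
Qed.

Lemma waveM k l phi psi t : wave k phi t * wave l psi t =
  2^-1 * (wave (k + l) (phi + psi) t + wave (k - l) (phi - psi) t).
Proof.
rewrite /wave !intrD mulrNz.
set a := 2 * pi * k%:~R * t / eps; set b := 2 * pi * l%:~R * t / eps.
have -> : 2 * pi * (k%:~R + l%:~R) * t / eps + (phi + psi) = (a + phi) + (b + psi).
  by rewrite /a /b; ring.
have -> : 2 * pi * (k%:~R - l%:~R) * t / eps + (phi - psi) = (a + phi) - (b + psi).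
  by rewrite /a /b; ring.
rewrite (cosD (a + phi)) (cosB (a + phi)); lra.
Qed.

Lemma is_derive_wprim k phi (t : R) :
  is_derive t 1 (wprim k phi) (wave k phi t - wmean k phi).
Proof.
have [->|k0] := eqVneq k 0.
  rewrite /wave /wmean eqxx mul1r mulr0 !mul0r add0r subrr.
  rewrite (_ : wprim 0 phi = fun=> 0); first exact: is_derive_cst.
  by apply/funext => s; rewrite /wprim iom0 mulr0 mul0r.
rewrite /wmean (negPf k0) mul0r subr0.
pose w := 2 * pi * k%:~R / eps.
have dl : is_derive t 1 (fun t => 2 * pi * k%:~R * t / eps + (phi - pi / 2)) w.
  have := is_derive_add (is_derive_mul (is_derive_cst w t 1) (is_derive_id t 1))
    (is_derive_cst (phi - pi / 2) t 1).
  rewrite mul0r add0r mulr1 addr0.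
  by rewrite (_ : (fun s : R => _) = fun t => 2 * pi * k%:~R * t / eps + (phi - pi / 2))//;
    apply/funext => s /=; rewrite /w; ring.
have dc := is_derive1_comp (is_derive_cos _) dl.
have := is_derive_mul (is_derive_cst (eps * iom k) t 1) dc.
rewrite mul0r add0r => H; apply: is_derive_eq H _.
rewrite addrA sinBpihalf opprK /w /iom /wave.
have kR : (k%:~R : R) != 0 by rewrite intr_eq0.
have pn : (pi : R) != 0 by rewrite gt_eqF ?pi_gt0.
have en : eps != 0 by rewrite gt_eqF.
clear dl dc; move: pn; move: (pi : R) => P pn /=; field.
by rewrite kR pn en.
Qed.

Lemma cos_period (x : R) (k : int) : cos (x + 2 * pi * k%:~R) = cos x.
Proof.
have cn (n : nat) (y : R) : cos (y + 2 * pi * n%:R) = cos y.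
  rewrite -(periodicn (@cosD2pi R) n y); congr (cos (_ + _)).
  by rewrite -mulr_natr -mulr_natr; ring.
case: (intP k) => [|n|n]; first by rewrite mulr0 addr0.
  exact: cn.
by rewrite -(cn n.+1) mulrNz mulrN subrK.
Qed.

Lemma wave_period k phi t : wave k phi (t + eps) = wave k phi t.
Proof.
rewrite /wave -[RHS](cos_period _ k); congr cos.
by field; rewrite gt_eqF.
Qed.

Lemma wprim_period k phi t : wprim k phi (t + eps) = wprim k phi t.
Proof. by rewrite /wprim wave_period. Qed.

(** A mean value without an integral: [p - c] has a periodic primitive. The bound makes this
    primitive Lipschitz. *)
Definition mean_of (p : R -> R) (c : R) := exists W : R -> R,
  [/\ forall t : R, is_derive t 1 W (p t - c), forall t, W (t + eps) = W t &
      exists2 C : R, 0 <= C & forall t, `|p t - c| <= C].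

Lemma mean_of_wave k phi : mean_of (wave k phi) (wmean k phi).
Proof.
exists (wprim k phi); split; [exact: is_derive_wprim|exact: wprim_period|].
exists 2 => // t; rewrite (le_trans (ler_normB _ _))//.
by rewrite -[2]/(1 + 1) lerD ?norm_wave ?norm_wmean.
Qed.

Lemma mean_of_scale a p c : mean_of p c -> mean_of (fun t => a * p t) (a * c).
Proof.
move=> [W [dW pW [C C0 bW]]]; exists (fun t => a * W t); split.
- move=> t; have := is_derive_mul (is_derive_cst a t 1) (dW t).
  by rewrite mul0r add0r mulrBr.
- by move=> t; rewrite pW.
- by exists (`|a| * C) => [|t]; rewrite ?mulr_ge0// -mulrBr normrM ler_wpM2l.
Qed.

Lemma mean_of_add p q c d : mean_of p c -> mean_of q d ->
  mean_of (fun t => p t + q t) (c + d).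
Proof.
move=> [W [dW pW [C C0 bW]]] [Z [dZ pZ [E E0 bZ]]].
exists (fun t => W t + Z t); split.
- by move=> t; rewrite opprD addrACA; exact: is_derive_add.
- by move=> t; rewrite pW pZ.
- exists (C + E) => [|t]; first by rewrite addr_ge0.
  by rewrite opprD addrACA (le_trans (ler_normD _ _))// lerD.
Qed.

Variables (J : finType) (k : J -> int) (phi : J -> R).

(* Up to powers of [eps], the means of U_nu u_mu and V_nu_mu u_la, where U_nu is the
   primitive of the wave u_nu and V_nu_mu = [prim2 nu mu] the one of U_nu u_mu. *)
Definition coef2 nu mu : R := iom (k nu) / 2 *
  (wmean (k nu + k mu) (phi nu - pi / 2 + phi mu) +
   wmean (k nu - k mu) (phi nu - pi / 2 - phi mu)).

Definition coef3 nu mu la : R := iom (k nu) / 4 *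
  (iom (k nu + k mu) * (wmean (k nu + k mu + k la) (phi nu - pi / 2 + phi mu - pi / 2 + phi la)
     + wmean (k nu + k mu - k la) (phi nu - pi / 2 + phi mu - pi / 2 - phi la)) +
   iom (k nu - k mu) * (wmean (k nu - k mu + k la) (phi nu - pi / 2 - phi mu - pi / 2 + phi la)
     + wmean (k nu - k mu - k la) (phi nu - pi / 2 - phi mu - pi / 2 - phi la))).

Definition prim2 nu mu (t : R) : R := eps * iom (k nu) / 2 *
  (wprim (k nu + k mu) (phi nu - pi / 2 + phi mu) t +
   wprim (k nu - k mu) (phi nu - pi / 2 - phi mu) t).

Lemma norm_coef2 nu mu : `|coef2 nu mu| <= 1.
Proof.
rewrite /coef2 -mulrA normrM mulr_ile1 ?norm_iom// normrM ger0_norm ?invr_ge0//.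
rewrite ler_pdivrMl// mulr1 (le_trans (ler_normD _ _))//.
by rewrite -[2]/(1 + 1) lerD ?norm_wmean.
Qed.

Lemma norm_coef3 nu mu la : `|coef3 nu mu la| <= 1.
Proof.
rewrite /coef3 -mulrA normrM mulr_ile1 ?norm_iom// normrM ger0_norm ?invr_ge0//.
have h i a b c d : `|iom i * (wmean a c + wmean b d)| <= 2.
  rewrite normrM -[leRHS]mul1r ler_pM ?norm_iom// (le_trans (ler_normD _ _))//.
  by rewrite -[2]/(1 + 1) lerD ?norm_wmean.
rewrite ler_pdivrMl// mulr1 (le_trans (ler_normD _ _))//.
have -> : (4 : R) = 2 + 2 by lra.
by rewrite lerD ?h.
Qed.

Lemma norm_prim2 nu mu t : `|prim2 nu mu t| <= eps * eps.
Proof.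
have e0 := ltW eps0.
have h2 : `|2^-1 : R| = 2^-1 by rewrite ger0_norm ?invr_ge0.
rewrite /prim2 normrM !normrM (ger0_norm e0) h2 -!mulrA.
rewrite ler_wpM2l// -[leRHS]mul1r ler_pM ?norm_iom ?mulr_ge0 ?invr_ge0//.
rewrite ler_pdivrMl// (le_trans (ler_normD _ _))//.
by rewrite mulr_natl mulr2n lerD ?norm_wprim.
Qed.

Lemma is_derive_prim2 nu mu (t : R) :
  is_derive t 1 (prim2 nu mu)
    (wprim (k nu) (phi nu) t * wave (k mu) (phi mu) t - eps * coef2 nu mu).
Proof.
have := is_derive_mul (is_derive_cst (eps * iom (k nu) / 2) t 1)
  (is_derive_add (is_derive_wprim (k nu + k mu) (phi nu - pi / 2 + phi mu) t)
                 (is_derive_wprim (k nu - k mu) (phi nu - pi / 2 - phi mu) t)).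
move=> H; apply: is_derive_eq H _.
by rewrite /wprim -(mulrA (eps * _)) waveM /coef2 /cst mul0r add0r; ring.
Qed.

Lemma prim2_period nu mu t : prim2 nu mu (t + eps) = prim2 nu mu t.
Proof. by rewrite /prim2 !wprim_period. Qed.

Lemma mean_of_prim2 nu mu la :
  mean_of (fun t => prim2 nu mu t * wave (k la) (phi la) t) (eps ^+ 2 * coef3 nu mu la).
Proof.
have wp i a : mean_of (fun t => wprim i a t * wave (k la) (phi la) t)
   (eps * iom i / 2 * (wmean (i + k la) (a - pi / 2 + phi la) +
                       wmean (i - k la) (a - pi / 2 - phi la))).
  rewrite (_ : (fun t => _) = fun t => eps * iom i / 2 * (wave (i + k la) (a - pi / 2 + phi la) t
    + wave (i - k la) (a - pi / 2 - phi la) t)).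
    by apply: mean_of_scale; apply: mean_of_add; exact: mean_of_wave.
  by apply/funext => t; rewrite /wprim -(mulrA (eps * _)) waveM; ring.
have := mean_of_scale (eps * iom (k nu) / 2) (mean_of_add
  (wp (k nu + k mu) (phi nu - pi / 2 + phi mu)) (wp (k nu - k mu) (phi nu - pi / 2 - phi mu))).
rewrite (_ : (fun t : R => _) = (fun t => prim2 nu mu t * wave (k la) (phi la) t)); last first.
  by apply/funext => t; rewrite /prim2; ring.
rewrite (_ : _ * (_ + _) = eps ^+ 2 * coef3 nu mu la) //.
have h4 : (4 : R)^-1 = 2^-1 * 2^-1 by rewrite -invfM -natrM.
rewrite /coef3 h4; ring.
Qed.

End Waves.

(** * Resonances *)

Lemma sum_delta (R : pzRingType) (I : finType) (x : I) (F : I -> R) :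
  \sum_i (i == x)%:R * F i = F x.
Proof.
rewrite (bigD1 x)//= eqxx mul1r big1 ?addr0// => i ix.
by rewrite (negPf ix) mul0r.
Qed.

Lemma sum_delta3 (R : comPzRingType) (I : finType) (x y z : I) (F : I -> I -> I -> R) :
  \sum_i \sum_j \sum_k ((i == x)%:R * (j == y)%:R * (k == z)%:R) * F i j k = F x y z.
Proof.
rewrite -(sum_delta x (fun i => F i y z)); apply: eq_bigr => i _.
rewrite -(sum_delta y (fun j => F i j z)) mulr_sumr; apply: eq_bigr => j _.
rewrite -(sum_delta z (fun k => F i j k)) !mulr_sumr; apply: eq_bigr => k _.
by rewrite !mulrA.
Qed.

(** Components are counted from zero, so [(0, p)] carries kappa_1 and [(3, p)] carries kappa_4.
    There are two relations, each with both orders of the summands. *)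
Definition resonant_triple (P : eqType) (a b c : 'I_4 * P) (p : P) : bool :=
  [|| (a, b, c) == ((0, p), (1, p), (2, p)), (a, b, c) == ((1, p), (0, p), (2, p)),
      (a, b, c) == ((0, p), (3, p), (1, p)) | (a, b, c) == ((3, p), (0, p), (1, p))].

(** The four patterns exclude each other and a resonant triple determines [p], so the indicator is a
    sum of products of Kronecker deltas, each of which collapses the triple sum. *)
Lemma resonant_sum (R : comPzRingType) (P : finType) (kappa : 'I_4 * P -> int)
    (Q : 'I_4 * P -> 'I_4 * P -> 'I_4 * P -> R) :
  (forall a b c, (kappa a + kappa b == kappa c) = [exists p, resonant_triple a b c p]) ->
  \sum_a \sum_b \sum_c (kappa a + kappa b == kappa c)%:R * Q a b c =
  \sum_p (Q (0, p) (1, p) (2, p) + Q (1, p) (0, p) (2, p)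
    + Q (0, p) (3, p) (1, p) + Q (3, p) (0, p) (1, p)).
Proof.
move=> res.
have indE a b c : (kappa a + kappa b == kappa c)%:R =
   \sum_p ((a == (0, p))%:R * (b == (1, p))%:R * (c == (2, p))%:R +
     (a == (1, p))%:R * (b == (0, p))%:R * (c == (2, p))%:R +
     (a == (0, p))%:R * (b == (3, p))%:R * (c == (1, p))%:R +
     (a == (3, p))%:R * (b == (0, p))%:R * (c == (1, p))%:R) :> R.
  have E p : ((a == (0, p))%:R * (b == (1, p))%:R * (c == (2, p))%:R +
     (a == (1, p))%:R * (b == (0, p))%:R * (c == (2, p))%:R +
     (a == (0, p))%:R * (b == (3, p))%:R * (c == (1, p))%:R +
     (a == (3, p))%:R * (b == (0, p))%:R * (c == (1, p))%:R) = (resonant_triple a b c p)%:R :> R.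
    rewrite /resonant_triple; case: a b c => [sa pa] [sb pb] [sc pc].
    rewrite !xpair_eqE; case: (pa == p); case: (pb == p); case: (pc == p);
      rewrite ?andbF ?andbT ?andFb ?(mulr0, mul0r, addr0)//.
    by move: sa sb sc => [[|[|[|[|?]]]] ?] [[|[|[|[|?]]]] ?] [[|[|[|[|?]]]] ?];
      rewrite //= ?(mulr0, mul0r, mulr1, addr0, add0r).
  under [RHS]eq_bigr => p _ do rewrite E.
  rewrite res; case: existsP => [[p hp]|np].
    rewrite (bigD1 p)//= hp big1 ?addr0// => q qp.
    suff -> : resonant_triple a b c q = false by [].
    apply/negbTE/negP => hq; move/eqP: qp; apply; move: hp hq.
    by rewrite /resonant_triple => /or4P[] /eqP[-> _ _] /or4P[] /eqP[] // [].
  rewrite big1// => p _; suff -> : resonant_triple a b c p = false by [].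
  by apply/negbTE/negP => hp; apply: np; exists p.
under eq_bigr => a _ do under eq_bigr => b _ do under eq_bigr => c _ do rewrite indE mulr_suml.
under eq_bigr => a _ do under eq_bigr => b _ do rewrite exchange_big.
under eq_bigr => a _ do rewrite exchange_big.
rewrite exchange_big; apply: eq_bigr => p _.
rewrite -(sum_delta3 (0, p) (1, p) (2, p) Q) -(sum_delta3 (1, p) (0, p) (2, p) Q).
rewrite -(sum_delta3 (0, p) (3, p) (1, p) Q) -(sum_delta3 (3, p) (0, p) (1, p) Q).
rewrite -!big_split/=; apply: eq_bigr => a _.
rewrite -!big_split/=; apply: eq_bigr => b _.
rewrite -!big_split/=; apply: eq_bigr => c _.
by rewrite !mulrDl.
Qed.

Lemma uniq_map_inj_in (T T' : eqType) (f : T -> T') (r : seq T) :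
  uniq (map f r) -> {in r &, injective f}.
Proof.
elim: r => [|x r IH] //= /andP[xr ur] y z; rewrite !inE.
move=> /orP[/eqP->|yr] /orP[/eqP->|zr] // fyz.
- by move: xr; rewrite fyz map_f.
- by move: xr; rewrite -fyz map_f.
- exact: IH.
Qed.

Definition kappa3 (m : nat) (S3 : {set 'I_m * 'I_m * 'I_m}) (k1 k2 : 'I_m * 'I_m * 'I_m -> int)
  (i : 'I_4 * 'I_#|S3|) : int := kap k1 k2 i.1 (enum_val i.2).

Lemma kap_inj (m : nat) (S2 : {set 'I_m * 'I_m}) (S3 : {set 'I_m * 'I_m * 'I_m})
    (kj : 'I_m * 'I_m -> int) (k1 k2 : 'I_m * 'I_m * 'I_m -> int) s s' l l' :
  non_resonant S2 S3 kj k1 k2 -> l \in S3 -> l' \in S3 ->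
  kap k1 k2 s l = kap k1 k2 s' l' -> s = s' /\ l = l'.
Proof.
move=> [_ + _] lS l'S e; rewrite cat_uniq => /and3P[_ _].
pose g (i : 'I_4 * ('I_m * 'I_m * 'I_m)) := kap k1 k2 i.1 i.2.
rewrite (_ : [seq kap k1 k2 s l | s <- enum 'I_4, l <- enum S3] =
  [seq g i | i <- [seq (s, l) | s <- enum 'I_4, l <- enum S3]]); last by rewrite map_allpairs.
move=> /uniq_map_inj_in ginj.
have memE s0 l0 : l0 \in S3 -> (s0, l0) \in [seq (s, l) | s <- enum 'I_4, l <- enum S3].
  by move=> l0S; apply/allpairsP; exists (s0, l0); rewrite !mem_enum.
by have [-> ->] := ginj _ _ (memE _ _ lS) (memE _ _ l'S) e.
Qed.

Lemma kap_gt0 (m : nat) (S2 : {set 'I_m * 'I_m}) (S3 : {set 'I_m * 'I_m * 'I_m})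
    (kj : 'I_m * 'I_m -> int) (k1 k2 : 'I_m * 'I_m * 'I_m -> int) s l :
  non_resonant S2 S3 kj k1 k2 -> l \in S3 -> 0 < kap k1 k2 s l.
Proof.
move=> [kpos _ _] lS; apply: kpos; rewrite mem_cat; apply/orP; right.
by apply/allpairsP; exists (s, l); rewrite !mem_enum.
Qed.

(** A relation [a + b = c] is the third-order resonance with coefficients +1 at [A] and [B] and -1
    at [C]. It must therefore be an imposed one, and comparing signs tells which. *)
Lemma kappa3_relations (m : nat) (S2 : {set 'I_m * 'I_m}) (S3 : {set 'I_m * 'I_m * 'I_m})
    (kj : 'I_m * 'I_m -> int) (k1 k2 : 'I_m * 'I_m * 'I_m -> int) :
  non_resonant S2 S3 kj k1 k2 -> forall a b c : 'I_4 * 'I_#|S3|,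
  (kappa3 k1 k2 a + kappa3 k1 k2 b == kappa3 k1 k2 c) = [exists p, resonant_triple a b c p].
Proof.
move=> nres; have [_ _ kres] := nres; move=> a b c; apply/eqP/existsP; last first.
  by move=> [p] /or4P[] /eqP[-> -> ->]; rewrite /kappa3 /kap /=; ring.
move=> abc.
pose T := {l | l \in S3}.
pose K (i : 'I_4 * T) := kap k1 k2 i.1 (val i.2).
have Kpos i : 0 < K i by apply: kap_gt0 nres (valP i.2).
have Kinj : injective K.
  by move=> [s l] [s' l'] /(kap_inj nres (valP l) (valP l'))[/= -> /val_inj ->].
pose tT (i : 'I_4 * 'I_#|S3|) : 'I_4 * T := (i.1, exist _ (enum_val i.2) (enum_valP i.2)).
have tTinj : injective tT.
  by move=> [s p] [s' p'] [-> /enum_val_inj ->].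
pose A := tT a; pose B := tT b; pose C := tT c.
have KABC : K A + K B = K C by [].
(* Positivity keeps [C] apart from [A] and [B], so nothing cancels in [cc]. The case [A = B] is not
   excluded here: the nonzero entries are then 2 and -1, still coprime and of order three. *)
have CA : C != A.
  by apply/eqP => CA; have := Kpos B; move: KABC; rewrite CA; lia.
have CB : C != B.
  by apply/eqP => CB; have := Kpos A; move: KABC; rewrite CB; lia.
pose cc (i : 'I_4 * T) : int := (i == A)%:Z + (i == B)%:Z - (i == C)%:Z.
have ccneg i : cc i < 0 -> i = C.
  by rewrite /cc; case: (i =P C) => // _; lia.
have ccpos i : 0 < cc i -> i = A \/ i = B.
  rewrite /cc; case: (i =P A) => [->|_]; first by left.
  by case: (i =P B) => [->|_]; [right|lia].
have absE i : (`|cc i|%N = (i == A) + (i == B) + (i == C))%N.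
  rewrite /cc; case: (i =P C) => [->|_]; first by rewrite (negPf CA) (negPf CB).
  by case: (i == A); case: (i == B).
have sumd (x : 'I_4 * T) : (\sum_i (i == x) = 1)%N.
  by rewrite (bigD1 x)//= eqxx big1 ?addn0// => i /negPf ->.
have res : resonance 3 K cc.
  split => //.
  - rewrite (bigD1 C)//= absE (negPf CA) (negPf CB) eqxx.
    by rewrite gcd1n.
  - under eq_bigr => i _ do rewrite absE.
    by rewrite !big_split /= !sumd.
  - rewrite /cc; under eq_bigr => i _ do rewrite mulrBl mulrDl.
    rewrite sumrB big_split /=.
    have sd x : \sum_(i : 'I_4 * T) (i == x)%:Z * K i = K x by rewrite -(sum_delta x K); apply: eq_bigr => i _; rewrite natz.
    by rewrite !sd KABC subrr.
have [l [e imp]] := kres cc res.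
have val_ (x : 'I_4 * 'I_#|S3|) s : tT x = (s, l) -> x.1 = s by move=> [].
have fin s1 s2 s3 : (A = (s1, l) /\ B = (s2, l) \/ A = (s2, l) /\ B = (s1, l)) -> C = (s3, l) ->
    (a, b, c) = ((s1, a.2), (s2, a.2), (s3, a.2)) \/ (a, b, c) = ((s2, a.2), (s1, a.2), (s3, a.2)).
  have aux (x y : 'I_4 * 'I_#|S3|) s s' : tT x = (s, l) -> tT y = (s', l) -> y = (s', x.2).
    case: x y => [sx px] [sy py] [_ h1] [-> h2]; congr pair; apply: enum_val_inj => /=.
    by have := congr1 val (etrans h2 (esym h1)).
  have aux1 (x : 'I_4 * 'I_#|S3|) s : tT x = (s, l) -> x = (s, x.2).
    by case: x => ? ? [-> _].
  move=> [[hA hB]|[hA hB]] hC; [left|right];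
    by rewrite {1}(aux1 _ _ hA) (aux _ _ _ _ hA hB) (aux _ _ _ _ hA hC).
have two (x y : 'I_4 * T) : 0 < cc x -> 0 < cc y -> x != y -> A = x /\ B = y \/ A = y /\ B = x.
  move=> /ccpos[->|->] /ccpos[->|->]; rewrite ?eqxx// => _; [by left|by right].
have dE s s' : ((s, l) == (s', l) :> 'I_4 * T) = (s == s') by rewrite xpair_eqE eqxx andbT.
(* [cc] has a single negative entry. Two of the four signed relations have two and are absurd; in
   the others the negative entry locates [C] and the positive ones locate [A] and [B]. *)
case: e imp => -[] imp.
- exfalso; have h0 : (0, l) = C by apply: ccneg; rewrite imp !dE.
  have : (1, l) = C by apply: ccneg; rewrite imp !dE.
  by rewrite -h0.
- have hC : C = (1, l) by apply/esym; apply: ccneg; rewrite imp !dE.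
  have hAB : A = (0, l) /\ B = (3, l) \/ A = (3, l) /\ B = (0, l).
    by apply: two; rewrite ?imp !dE.
  exists a.2; rewrite /resonant_triple.
  by have [->|->] := fin _ _ _ hAB hC; rewrite eqxx ?orbT.
- have hC : C = (2, l) by apply/esym; apply: ccneg; rewrite imp !dE.
  have hAB : A = (0, l) /\ B = (1, l) \/ A = (1, l) /\ B = (0, l).
    by apply: two; rewrite ?imp !dE.
  exists a.2; rewrite /resonant_triple.
  by have [->|->] := fin _ _ _ hAB hC; rewrite eqxx ?orbT.
- exfalso; have h0 : (0, l) = C by apply: ccneg; rewrite imp !dE.
  have : (3, l) = C by apply: ccneg; rewrite imp !dE.
  by rewrite -h0.
Qed.

(** Only kappa_1 enters as a cosine: [sin w2] and the two halves of [cos w1 * sin w2] are sines. *)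
Definition phase3 (R : realType) (P : Type) (i : 'I_4 * P) : R :=
  if i.1 == 0 then 0 else - (pi / 2).

(** * Means of triple products *)

Section ThirdOrder.
Context (R : realType) (P : finType) (kappa : 'I_4 * P -> int).
Hypotheses (kappa_gt0 : forall i, 0 < kappa i)
  (kappa2 : forall p, kappa (2, p) = kappa (0, p) + kappa (1, p))
  (kappa3E : forall p, kappa (3, p) = kappa (1, p) - kappa (0, p))
  (res : forall a b c, (kappa a + kappa b == kappa c) = [exists p, resonant_triple a b c p]).

Local Notation phase := (@phase3 R P).

Let Q1 a b c : R := iom R (kappa a) / 4 * iom R (kappa a + kappa b) *
  cos (phase a - pi / 2 + phase b - pi / 2 - phase c).
Let Q2 a b c : R := iom R (kappa a) / 4 * iom R (kappa a - kappa b) *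
  cos (phase a - pi / 2 - phase b - pi / 2 + phase c).
Let Q3 a b c : R := iom R (kappa a) / 4 * iom R (kappa a - kappa b) *
  cos (phase a - pi / 2 - phase b - pi / 2 - phase c).

(** Positive frequencies never sum to zero. The three remaining sign patterns say that [c], [b] or
    [a], respectively, carries the sum of the other two frequencies. *)
Lemma coef3_split a b c : coef3 kappa phase a b c =
  (kappa a + kappa b == kappa c)%:R * Q1 a b c +
  (kappa a + kappa c == kappa b)%:R * Q2 a b c +
  (kappa b + kappa c == kappa a)%:R * Q3 a b c.
Proof.
rewrite /coef3 /wmean.
have -> : (kappa a + kappa b + kappa c == 0) = false.
  by have := kappa_gt0 a; have := kappa_gt0 b; have := kappa_gt0 c; lia.
have -> : (kappa a + kappa b - kappa c == 0) = (kappa a + kappa b == kappa c) by rewrite subr_eq0.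
have -> : (kappa a - kappa b + kappa c == 0) = (kappa a + kappa c == kappa b) by lia.
have -> : (kappa a - kappa b - kappa c == 0) = (kappa b + kappa c == kappa a) by lia.
rewrite mul0r add0r /Q1 /Q2 /Q3; ring.
Qed.

(** Four resonant patterns times three positions of the largest frequency give twelve terms. In each
    the phases add up to a multiple of [pi], so the cosine is a sign and the term is a signed
    inverse of [16 pi^2] times two frequencies. *)
Lemma coef3_sum (Y : 'I_4 * P -> 'I_4 * P -> 'I_4 * P -> R) :
  \sum_a \sum_b \sum_c coef3 kappa phase a b c * Y a b c =
  \sum_p let x : R := (kappa (0, p))%:~R in let y : R := (kappa (1, p))%:~R in
    let Z r s t := Y (r, p) (s, p) (t, p) in
    (16 * pi ^+ 2)^-1 * (
      (x * (y - x))^-1 * (Z 0 1 3 + Z 3 1 0) - (x * (x + y))^-1 * (Z 0 1 2 + Z 2 1 0)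
      - (y * (x + y))^-1 * (Z 1 0 2 + Z 2 0 1) - (y * (y - x))^-1 * (Z 1 0 3 + Z 3 0 1)
      + (x * y)^-1 * (Z 0 2 1 + Z 1 2 0 - Z 0 3 1 - Z 1 3 0)).
Proof.
(* Renaming the indices gives the three families the same indicator, so that [resonant_sum] applies
   to each. *)
have -> : \sum_a \sum_b \sum_c coef3 kappa phase a b c * Y a b c =
  \sum_a \sum_b \sum_c (kappa a + kappa b == kappa c)%:R * (Q1 a b c * Y a b c) +
  \sum_a \sum_b \sum_c (kappa a + kappa b == kappa c)%:R * (Q2 a c b * Y a c b) +
  \sum_a \sum_b \sum_c (kappa a + kappa b == kappa c)%:R * (Q3 c a b * Y c a b).
  have -> : \sum_a \sum_b \sum_c (kappa a + kappa b == kappa c)%:R * (Q2 a c b * Y a c b) =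
    \sum_a \sum_b \sum_c (kappa a + kappa c == kappa b)%:R * (Q2 a b c * Y a b c).
    by apply: eq_bigr => a _; rewrite exchange_big.
  have -> : \sum_a \sum_b \sum_c (kappa a + kappa b == kappa c)%:R * (Q3 c a b * Y c a b) =
    \sum_a \sum_b \sum_c (kappa b + kappa c == kappa a)%:R * (Q3 a b c * Y a b c).
    under eq_bigr => a _ do rewrite exchange_big.
    by rewrite exchange_big.
  rewrite -!big_split/=; apply: eq_bigr => a _.
  rewrite -!big_split/=; apply: eq_bigr => b _.
  rewrite -!big_split/=; apply: eq_bigr => c _.
  by rewrite coef3_split; ring.
rewrite (resonant_sum (fun a b c => Q1 a b c * Y a b c) res).
rewrite (resonant_sum (fun a b c => Q2 a c b * Y a c b) res).
rewrite (resonant_sum (fun a b c => Q3 c a b * Y c a b) res).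
rewrite -!big_split/=; apply: eq_bigr => p _.
set x : R := (kappa (0, p))%:~R; set y : R := (kappa (1, p))%:~R.
have x0 : x != 0 by rewrite intr_eq0 gt_eqF.
have y0 : y != 0 by rewrite intr_eq0 gt_eqF.
have xy0 : x + y != 0 by rewrite -intrD -kappa2 intr_eq0 gt_eqF.
have yx0 : y - x != 0 by rewrite -intrB -kappa3E intr_eq0 gt_eqF.
have pn : (pi : R) != 0 by rewrite gt_eqF ?pi_gt0.
have iE (k : int) (r : R) : k%:~R = r -> iom R k = (2 * pi * r)^-1 by rewrite /iom => ->.
have i0 : iom R (kappa (0, p)) = (2 * pi * x)^-1 by [].
have i1 : iom R (kappa (1, p)) = (2 * pi * y)^-1 by [].
have i2 : iom R (kappa (2, p)) = (2 * pi * (x + y))^-1 by apply: iE; rewrite kappa2 intrD.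
have i3 : iom R (kappa (3, p)) = (2 * pi * (y - x))^-1 by apply: iE; rewrite kappa3E intrB.
have cosE := (@addr0 R, @add0r R, @subr0 R, @opprK R, @cosBpihalf R, @cosDpihalf R,
  @sinBpihalf R, @sinDpihalf R, @cosN R, @sinN R, @cos0 R, @sin0 R, @cos_pihalf R, @sin_pihalf R).
have [phase0 phase1 phase2 phase_3] : [/\ phase (0, p) = 0, phase (1, p) = - (pi / 2),
  phase (2, p) = - (pi / 2) & phase (3, p) = - (pi / 2)] by [].
pose C := (16 * pi ^+ 2 : R)^-1.
have Q1_012 : Q1 (0, p) (1, p) (2, p) = - (C * (x * (x + y))^-1).
  have j : iom R (kappa (0, p) + kappa (1, p)) = (2 * pi * (x + y))^-1.
    by apply: iE; rewrite ?kappa2 ?kappa3E !(intrD, mulrNz); rewrite /x /y; ring.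
  rewrite /Q1 j phase0 phase1 phase2 !cosE i0 /C.
  move: pn; move: (pi : R) => P' pn; field; rewrite ?pn ?x0 ?y0 ?xy0 ?yx0 ?oppr_eq0 ?yx0//.
have Q1_102 : Q1 (1, p) (0, p) (2, p) = - (C * (y * (x + y))^-1).
  have j : iom R (kappa (1, p) + kappa (0, p)) = (2 * pi * (x + y))^-1.
    by apply: iE; rewrite ?kappa2 ?kappa3E !(intrD, mulrNz); rewrite /x /y; ring.
  rewrite /Q1 j phase1 phase0 phase2 !cosE i1 /C.
  move: pn; move: (pi : R) => P' pn; field; rewrite ?pn ?x0 ?y0 ?xy0 ?yx0 ?oppr_eq0 ?yx0//.
have Q1_031 : Q1 (0, p) (3, p) (1, p) = - (C * (x * y)^-1).
  have j : iom R (kappa (0, p) + kappa (3, p)) = (2 * pi * (y))^-1.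
    by apply: iE; rewrite ?kappa2 ?kappa3E !(intrD, mulrNz); rewrite /x /y; ring.
  rewrite /Q1 j phase0 phase_3 phase1 !cosE i0 /C.
  move: pn; move: (pi : R) => P' pn; field; rewrite ?pn ?x0 ?y0 ?xy0 ?yx0 ?oppr_eq0 ?yx0//.
have Q1_301 : Q1 (3, p) (0, p) (1, p) = - (C * (y * (y - x))^-1).
  have j : iom R (kappa (3, p) + kappa (0, p)) = (2 * pi * (y))^-1.
    by apply: iE; rewrite ?kappa2 ?kappa3E !(intrD, mulrNz); rewrite /x /y; ring.
  rewrite /Q1 j phase_3 phase0 phase1 !cosE i3 /C.
  move: pn; move: (pi : R) => P' pn; field; rewrite ?pn ?x0 ?y0 ?xy0 ?yx0 ?oppr_eq0 ?yx0//.
have Q2_021 : Q2 (0, p) (2, p) (1, p) = (C * (x * y)^-1).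
  have j : iom R (kappa (0, p) - kappa (2, p)) = (2 * pi * (- y))^-1.
    by apply: iE; rewrite ?kappa2 ?kappa3E !(intrD, mulrNz); rewrite /x /y; ring.
  rewrite /Q2 j phase0 phase2 phase1 !cosE i0 /C.
  move: pn; move: (pi : R) => P' pn; field; rewrite ?pn ?x0 ?y0 ?xy0 ?yx0 ?oppr_eq0 ?yx0//.
have Q2_120 : Q2 (1, p) (2, p) (0, p) = (C * (x * y)^-1).
  have j : iom R (kappa (1, p) - kappa (2, p)) = (2 * pi * (- x))^-1.
    by apply: iE; rewrite ?kappa2 ?kappa3E !(intrD, mulrNz); rewrite /x /y; ring.
  rewrite /Q2 j phase1 phase2 phase0 !cosE i1 /C.
  move: pn; move: (pi : R) => P' pn; field; rewrite ?pn ?x0 ?y0 ?xy0 ?yx0 ?oppr_eq0 ?yx0//.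
have Q2_013 : Q2 (0, p) (1, p) (3, p) = (C * (x * (y - x))^-1).
  have j : iom R (kappa (0, p) - kappa (1, p)) = (2 * pi * (- (y - x)))^-1.
    by apply: iE; rewrite ?kappa2 ?kappa3E !(intrD, mulrNz); rewrite /x /y; ring.
  rewrite /Q2 j phase0 phase1 phase_3 !cosE i0 /C.
  move: pn; move: (pi : R) => P' pn; field; rewrite ?pn ?x0 ?y0 ?xy0 ?yx0 ?oppr_eq0 ?yx0//.
have Q2_310 : Q2 (3, p) (1, p) (0, p) = (C * (x * (y - x))^-1).
  have j : iom R (kappa (3, p) - kappa (1, p)) = (2 * pi * (- x))^-1.
    by apply: iE; rewrite ?kappa2 ?kappa3E !(intrD, mulrNz); rewrite /x /y; ring.
  rewrite /Q2 j phase_3 phase1 phase0 !cosE i3 /C.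
  move: pn; move: (pi : R) => P' pn; field; rewrite ?pn ?x0 ?y0 ?xy0 ?yx0 ?oppr_eq0 ?yx0//.
have Q3_201 : Q3 (2, p) (0, p) (1, p) = - (C * (y * (x + y))^-1).
  have j : iom R (kappa (2, p) - kappa (0, p)) = (2 * pi * (y))^-1.
    by apply: iE; rewrite ?kappa2 ?kappa3E !(intrD, mulrNz); rewrite /x /y; ring.
  rewrite /Q3 j phase2 phase0 phase1 !cosE i2 /C.
  move: pn; move: (pi : R) => P' pn; field; rewrite ?pn ?x0 ?y0 ?xy0 ?yx0 ?oppr_eq0 ?yx0//.
have Q3_210 : Q3 (2, p) (1, p) (0, p) = - (C * (x * (x + y))^-1).
  have j : iom R (kappa (2, p) - kappa (1, p)) = (2 * pi * (x))^-1.
    by apply: iE; rewrite ?kappa2 ?kappa3E !(intrD, mulrNz); rewrite /x /y; ring.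
  rewrite /Q3 j phase2 phase1 phase0 !cosE i2 /C.
  move: pn; move: (pi : R) => P' pn; field; rewrite ?pn ?x0 ?y0 ?xy0 ?yx0 ?oppr_eq0 ?yx0//.
have Q3_103 : Q3 (1, p) (0, p) (3, p) = - (C * (y * (y - x))^-1).
  have j : iom R (kappa (1, p) - kappa (0, p)) = (2 * pi * (y - x))^-1.
    by apply: iE; rewrite ?kappa2 ?kappa3E !(intrD, mulrNz); rewrite /x /y; ring.
  rewrite /Q3 j phase1 phase0 phase_3 !cosE i1 /C.
  move: pn; move: (pi : R) => P' pn; field; rewrite ?pn ?x0 ?y0 ?xy0 ?yx0 ?oppr_eq0 ?yx0//.
have Q3_130 : Q3 (1, p) (3, p) (0, p) = - (C * (x * y)^-1).
  have j : iom R (kappa (1, p) - kappa (3, p)) = (2 * pi * (x))^-1.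
    by apply: iE; rewrite ?kappa2 ?kappa3E !(intrD, mulrNz); rewrite /x /y; ring.
  rewrite /Q3 j phase1 phase_3 phase0 !cosE i1 /C.
  move: pn; move: (pi : R) => P' pn; field; rewrite ?pn ?x0 ?y0 ?xy0 ?yx0 ?oppr_eq0 ?yx0//.
rewrite -/C Q1_012 Q1_102 Q1_031 Q1_301 Q2_021 Q2_120 Q2_013 Q2_310 Q3_201 Q3_210 Q3_103 Q3_130.
move: (C) => c0; ring.
Qed.
End ThirdOrder.

(** * Euclidean norm and balls *)

Lemma enorm_ge0 (R : realType) n (x : 'cV[R]_n) : 0 <= enorm x.
Proof. exact: sqrtr_ge0. Qed.

Lemma sqr_enorm (R : realType) n (x : 'cV[R]_n) : enorm x ^+ 2 = \sum_(i < n) x i 0 ^+ 2.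
Proof. by rewrite sqr_sqrtr// sumr_ge0// => i _; exact: sqr_ge0. Qed.

Lemma coord_le_enorm (R : realType) n (x : 'cV[R]_n) i : `|x i 0| <= enorm x.
Proof.
rewrite -sqrtr_sqr ler_wsqrtr// (bigD1 i)//= lerDl sumr_ge0// => j _; exact: sqr_ge0.
Qed.

Lemma norm_le_enorm (R : realType) n (x : 'cV[R]_n) : `|x| <= enorm x.
Proof. by apply: norm_le_coord => [|i]; [exact: enorm_ge0|exact: coord_le_enorm]. Qed.

Lemma enorm_le_coord (R : realType) n (x : 'cV[R]_n) (M : R) :
  0 <= M -> (forall i, `|x i 0| <= M) -> enorm x <= n%:R * M.
Proof.
move=> M0 h; rewrite -[leRHS]ger0_norm ?mulr_ge0// -sqrtr_sqr ler_wsqrtr//.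
apply: (@le_trans _ _ (\sum_(i < n) M ^+ 2)).
  by apply: ler_sum => i _; rewrite -[x i 0 ^+ 2]ger0_norm ?sqr_ge0// normrX lerXn2r ?nnegrE.
rewrite sumr_const card_ord -[leLHS]mulr_natl exprMn ler_wpM2r ?sqr_ge0//.
by rewrite -natrX ler_nat; case: (n) => // k; rewrite expnS leq_pmulr ?expn_gt0.
Qed.

Lemma enorm_le_norm (R : realType) n (x : 'cV[R]_n) : enorm x <= n%:R * `|x|.
Proof. by apply: enorm_le_coord => // i; exact: coord_le_norm. Qed.

Lemma enormZ (R : realType) n (a : R) (x : 'cV[R]_n) : enorm (a *: x) = `|a| * enorm x.
Proof.
rewrite /enorm; under eq_bigr => i _ do rewrite mxE exprMn.
by rewrite -mulr_sumr sqrtrM ?sqr_ge0// sqrtr_sqr.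
Qed.

Lemma enorm0 (R : realType) n : enorm (0 : 'cV[R]_n) = 0.
Proof. by rewrite -(scale0r 0) enormZ normr0 mul0r. Qed.

(** Cauchy-Schwarz: after multiplication by [|x| |y|], the gap is half the sum of the squares of
    [|y| x_i - |x| y_i]. *)
Lemma dot_le_enorm (R : realType) n (x y : 'cV[R]_n) :
  \sum_(i < n) x i 0 * y i 0 <= enorm x * enorm y.
Proof.
have [x0|x0] := eqVneq (enorm x) 0.
  rewrite x0 mul0r big1// => i _; have := coord_le_enorm x i.
  by rewrite x0 normr_le0 => /eqP ->; rewrite mul0r.
have [y0|y0] := eqVneq (enorm y) 0.
  rewrite y0 mulr0 big1// => i _; have := coord_le_enorm y i.
  by rewrite y0 normr_le0 => /eqP ->; rewrite mulr0.
have {}x0 : 0 < enorm x by rewrite lt_neqAle eq_sym x0 enorm_ge0.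
have {}y0 : 0 < enorm y by rewrite lt_neqAle eq_sym y0 enorm_ge0.
have xy : 0 < enorm x * enorm y by rewrite mulr_gt0.
rewrite -(ler_pM2l xy) -subr_ge0.
suff -> : enorm x * enorm y * (enorm x * enorm y) - enorm x * enorm y * \sum_(i < n) x i 0 * y i 0
  = 2^-1 * \sum_(i < n) (enorm y * x i 0 - enorm x * y i 0) ^+ 2.
  by rewrite mulr_ge0// sumr_ge0// => i _; exact: sqr_ge0.
have -> : \sum_(i < n) (enorm y * x i 0 - enorm x * y i 0) ^+ 2 =
   enorm y ^+ 2 * \sum_(i < n) x i 0 ^+ 2 - 2 * (enorm x * enorm y) * (\sum_(i < n) x i 0 * y i 0)
   + enorm x ^+ 2 * \sum_(i < n) y i 0 ^+ 2.
  rewrite !mulr_sumr -sumrB -big_split/=; apply: eq_bigr => i _; ring.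
rewrite -!sqr_enorm; move: (\sum_(i < n) _) (enorm x) (enorm y) => s a b.
by lra.
Qed.

Lemma enormD (R : realType) n (x y : 'cV[R]_n) : enorm (x + y) <= enorm x + enorm y.
Proof.
rewrite -[leRHS]ger0_norm ?addr_ge0 ?enorm_ge0// -sqrtr_sqr ler_wsqrtr//.
rewrite sqrrD !sqr_enorm; under eq_bigr => i _ do rewrite mxE sqrrD.
rewrite !big_split/= lerD2r lerD2l.
by rewrite mulr2n lerD ?dot_le_enorm.
Qed.

Lemma eball_segment_closed (R : realType) n (r : R) : segment_closed (@eball R n r).
Proof.
move=> x y s xr yr /andP[s0 s1]; rewrite /eball/=.
have -> : x + s *: (y - x) = (1 - s) *: x + s *: y.
  by rewrite scalerBr scalerBl scale1r [s *: y - _]addrC addrA.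
rewrite (le_trans (enormD _ _))// !enormZ !ger0_norm ?subr_ge0//.
have -> : r = (1 - s) * r + s * r by rewrite mulrBl mul1r subrK.
by rewrite lerD// ler_wpM2l// subr_ge0.
Qed.

Lemma trmx_continuous (R : realType) n : continuous (fun v : 'rV[R]_n => v^T).
Proof.
move=> v A /nbhs_ballP[e /= e0 eA]; apply/nbhs_ballP; exists e => //= w.
rewrite -ball_normE/= => vw; apply: eA; rewrite -ball_normE/=.
apply: le_lt_trans vw; apply: norm_le_coord => // i; rewrite !mxE.
rewrite [leRHS]/Num.Def.normr/= mx_normrE.
by apply/bigmax_geP; right; exists (0, i) => //=; rewrite !mxE.
Qed.

Lemma eball_compact (R : realType) n (r : R) : compact (@eball R n r).
Proof.
pose A : set 'rV[R]_n := [set v | enorm v^T <= r].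
have -> : @eball R n r = trmx @` A.
  apply/seteqP; split => [x xr|_ [v Av <-]//].
  by exists x^T; rewrite ?trmxK// /A/= trmxK.
apply: continuous_compact.
  by apply: continuous_subspaceT => v; exact: trmx_continuous.
apply: bounded_closed_compact.
  exists r; split; first exact: num_real.
  move=> M rM v Av /=; rewrite (le_trans _ (ltW rM))//.
  rewrite [leLHS]/Num.Def.normr/= mx_normrE.
  have r0 : 0 <= r by rewrite (le_trans (enorm_ge0 _) Av).
  apply: bigmax_le => // -[i j] _ /=; rewrite (ord1 i) (le_trans _ Av)//.
  by have := coord_le_enorm v^T j; rewrite mxE.
have cA : continuous (fun v : 'rV[R]_n => enorm v^T).
  move=> v; apply: (@continuous_comp _ _ _ (fun v : 'rV[R]_n => \sum_(i < n) v^T i 0 ^+ 2)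
    (@Num.sqrt R)); last exact: sqrt_continuous.
  apply: continuous_big => [|i _]; first exact: add_continuous.
  move=> w; apply: (@continuous_comp _ _ _ (fun v : 'rV[R]_n => v^T i 0) (fun y : R => y ^+ 2)).
    rewrite (_ : (fun v => _) = fun v : 'rV[R]_n => v 0 i); first exact: coord_continuous.
    by apply/funext => u; rewrite mxE.
  exact: exprn_continuous.
exact: (preimage_closed (fun v _ => cA v) (@closed_le R r)).
Qed.

(* A slightly larger ball still fits in the open domain: dilate the ball. *)
Lemma eball_thicken (R : realType) n (D : set 'cV[R]_n) (delta : R) :
  open D -> 0 < delta -> @eball R n delta `<=` D ->
  exists2 d' : R, delta < d' & @eball R n d' `<=` D.
Proof.
move=> oD d0 dD.
have : \forall a \near (1 : R), forall x, @eball R n delta x -> D (a *: x).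
  have nc := (iffLR (compact_near_coveringP _)) (@eball_compact R n delta).
  apply: (nc R (nbhs (1 : R)) (fun a x => D (a *: x)) (nbhs_filter (1 : R))) => x xd.
  have : D ((1 : R) *: x) by rewrite scale1r; exact: dD.
  move=> Dx; have := open_nbhs_nbhs (conj oD Dx) => nD.
  have cs : {for ((1 : R), x), continuous (fun p : R * 'cV[R]_n => p.1 *: p.2)}.
    exact: scale_continuous.
  have := cs _ nD; case=> -[A B] /= [nA nB] AB.
  exists (B, A) => //= -[y a] [/= By Aa].
  exact: (AB (a, y)).
move=> /nbhs_ballP[e /= e0 eP].
have h : ball (1 : R) e (1 + e / 2).
  rewrite /ball/= opprD addNKr normrN ger0_norm ?divr_ge0 ?ltW//.
  by rewrite ltr_pdivrMr// ltr_pMr// ltr1n.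
have a0 : 0 < 1 + e / 2 by rewrite addr_gt0// divr_gt0.
exists ((1 + e / 2) * delta).
  by rewrite mulrDl mul1r ltrDl mulr_gt0// divr_gt0.
move=> x xd; have -> : x = (1 + e / 2) *: ((1 + e / 2)^-1 *: x).
  by rewrite scalerA divff ?scale1r// gt_eqF.
apply: (eP _ h); rewrite /eball/= enormZ ger0_norm ?invr_ge0 ?(ltW a0)//.
by rewrite ler_pdivrMl.
Qed.

(** * The matrix F *)

Lemma enorm_mulmx_le (R : realType) n (A : 'M[R]_n) (x : 'cV[R]_n) :
  enorm (A *m x) <= opnorm A * enorm x.
Proof.
have [x0|x0] := eqVneq (enorm x) 0.
  have -> : x = 0.
    apply/matrixP => i j; rewrite (ord1 j) mxE; apply/eqP; rewrite -normr_le0.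
    by rewrite (le_trans (coord_le_enorm _ _))// x0.
  by rewrite mulmx0 enorm0 mulr0.
have {}x0 : 0 < enorm x by rewrite lt_neqAle eq_sym x0 enorm_ge0.
rewrite -ler_pdivrMr//.
have -> : enorm (A *m x) / enorm x = enorm (A *m ((enorm x)^-1 *: x)).
  by rewrite -scalemxAr enormZ ger0_norm ?invr_ge0 ?enorm_ge0// mulrC.
rewrite /opnorm; set E := (X in sup X).
have hE : E (enorm (A *m ((enorm x)^-1 *: x))).
  exists ((enorm x)^-1 *: x) => //=.
  by rewrite enormZ ger0_norm ?invr_ge0 ?enorm_ge0// mulVf// gt_eqF.
(* The supremum is an upper bound only for a bounded set; a crude bound by the entries of [A]
   suffices. *)
have sE : has_sup E.
  split; first by exists (enorm (A *m ((enorm x)^-1 *: x))).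
  exists (n%:R * \sum_(i < n) \sum_(j < n) `|A i j|) => _ [y /= y1 <-].
  apply: enorm_le_coord => [|i].
    by apply: sumr_ge0 => i _; apply: sumr_ge0.
  rewrite mxE (le_trans (ler_norm_sum _ _ _))// [leRHS](bigD1 i)//= ler_wpDr//.
    by apply: sumr_ge0 => k _; apply: sumr_ge0.
  apply: ler_sum => k _; rewrite normrM ler_piMr//.
  by rewrite (le_trans (coord_le_enorm _ _))// y1.
exact: (sup_upper_bound sE).
Qed.

Lemma Fmx_kernel (R : realType) (n m : nat) (f : 'I_m -> 'cV[R]_n -> 'cV[R]_n)
    (S1 : {set 'I_m}) (S2 : {set 'I_m * 'I_m}) (S3 : {set 'I_m * 'I_m * 'I_m})
    (hn : (#|S1| + #|S2| + #|S3|)%N = n) (x : 'cV[R]_n) (v : 'rV[R]_n) :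
  v *m Fmx f hn x = 0 -> forall w, w \in spanning_fields f S1 S2 S3 x -> v *m w = 0.
Proof.
subst n; rewrite /Fmx castmx_id !mul_mx_row => vF w.
have col q (F : 'I_q -> 'cV[R]_(#|S1| + #|S2| + #|S3|)) :
    v *m (\matrix_(r < #|S1| + #|S2| + #|S3|, p < q) F p r 0) = 0 -> forall p, v *m F p = 0.
  move=> vF0 p; apply/matrixP => i j; rewrite (ord1 i) (ord1 j).
  have := congr1 (fun M : 'M[R]__ => M 0 p) vF0; rewrite !mxE => e.
  by rewrite -[RHS]e; apply: eq_bigr => k _; rewrite mxE.
have [h12 h3] := eq_row_mx (etrans vF (esym (row_mx0 _ _ _ _))).
have [h1 h2] := eq_row_mx (etrans h12 (esym (row_mx0 _ _ _ _))).
rewrite /spanning_fields !mem_cat => /or3P[] /mapP[i]; rewrite mem_enum => iS ->.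
- by rewrite -(enum_rankK_in iS iS); exact: (col _ (fun p => f (enum_val p) x)).
- by rewrite -(enum_rankK_in iS iS); exact: (col _ (fun p => bracket2 f (enum_val p) x)).
- by rewrite -(enum_rankK_in iS iS); exact: (col _ (fun p => bracket3 f (enum_val p) x)).
Qed.

(** A row vector that annihilates the columns annihilates their span, hence every basis vector, and
    is zero. *)
Lemma Fmx_unit (R : realType) (n m : nat) (f : 'I_m -> 'cV[R]_n -> 'cV[R]_n)
    (S1 : {set 'I_m}) (S2 : {set 'I_m * 'I_m}) (S3 : {set 'I_m * 'I_m * 'I_m})
    (hn : (#|S1| + #|S2| + #|S3|)%N = n) (x : 'cV[R]_n) :
  (<<spanning_fields f S1 S2 S3 x>> = fullv :> {vspace 'cV[R]_n})%VS ->
  Fmx f hn x \in unitmx.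
Proof.
move=> span; rewrite -row_free_unit -kermx_eq0; apply/rowV0P => v /sub_kermxP vF.
have vcol := Fmx_kernel vF.
have sub : (<<spanning_fields f S1 S2 S3 x>> <= lker (linfun (mulmx v : 'cV[R]_n -> 'M[R]_1)))%VS.
  by apply/span_subvP => w /vcol vw; rewrite memv_ker lfunE /= vw.
apply/rowP => j; rewrite mxE.
have : (delta_mx j 0 : 'cV[R]_n) \in lker (linfun (mulmx v : 'cV[R]_n -> 'M[R]_1)).
  by apply: (subvP sub); rewrite span memvf.
rewrite memv_ker lfunE /= => /eqP/matrixP/(_ 0 0); rewrite !mxE => <-.
rewrite (bigD1 j)//= big1 ?addr0 => [|k kj]; rewrite !mxE ?eqxx ?mulr1//.
by rewrite (negPf kj) mulr0.
Qed.

Lemma coef_sum (R : realType) (n m : nat) (f : 'I_m -> 'cV[R]_n -> 'cV[R]_n)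
    (S1 : {set 'I_m}) (S2 : {set 'I_m * 'I_m}) (S3 : {set 'I_m * 'I_m * 'I_m})
    (hn : (#|S1| + #|S2| + #|S3|)%N = n) (gamma : R) (x : 'cV[R]_n) :
  Fmx f hn x \in unitmx -> let a := coef f hn gamma x in
  \sum_(p < #|S1|) usubmx (usubmx a) p 0 *: f (enum_val p) x +
  \sum_(p < #|S2|) dsubmx (usubmx a) p 0 *: bracket2 f (enum_val p) x +
  \sum_(p < #|S3|) dsubmx a p 0 *: bracket3 f (enum_val p) x = - gamma *: x.
Proof.
subst n => Fu a.
have : Fmx f (erefl _) x *m a = - gamma *: x.
  by rewrite /a /coef castmx_id -scalemxAr mulmxA mulmxV// mul1mx.
have aE : a = col_mx (col_mx (usubmx (usubmx a)) (dsubmx (usubmx a))) (dsubmx a).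
  by rewrite !vsubmxK.
rewrite /Fmx castmx_id [in X in X -> _]aE !mul_row_col => <-.
have E q (F : 'I_q -> 'cV[R]_(#|S1| + #|S2| + #|S3|)) (b : 'cV[R]_q) :
    (\matrix_(r < #|S1| + #|S2| + #|S3|, p < q) F p r 0) *m b = \sum_(p < q) b p 0 *: F p.
  apply/matrixP => i j; rewrite (ord1 j) !mxE summxE.
  by apply: eq_bigr => p _; rewrite !mxE mulrC.
by rewrite -!E.
Qed.

Lemma norm_coef_le (R : realType) (n m : nat) (f : 'I_m -> 'cV[R]_n -> 'cV[R]_n)
    (S1 : {set 'I_m}) (S2 : {set 'I_m * 'I_m}) (S3 : {set 'I_m * 'I_m * 'I_m})
    (hn : (#|S1| + #|S2| + #|S3|)%N = n) (gamma : R) (x : 'cV[R]_n) p :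
  0 <= gamma ->
  `|coef f hn gamma x p 0| <= gamma * (opnorm (invmx (Fmx f hn x)) * enorm x).
Proof.
subst n => g0; rewrite /coef castmx_id (le_trans (coord_le_enorm _ _))//.
by rewrite enormZ normrN (ger0_norm g0) ler_wpM2l// enorm_mulmx_le.
Qed.

(** * The control as a sum of waves *)

Section Oscillators.
Context (R : realType) (m : nat) (S2 : {set 'I_m * 'I_m}) (S3 : {set 'I_m * 'I_m * 'I_m})
  (kj : 'I_m * 'I_m -> int) (k1 k2 : 'I_m * 'I_m * 'I_m -> int).

(* One index per trigonometric monomial of the control: [cos w1 * sin w2] counts as two, of frequencies kappa_3 and kappa_4; the boolean tells sine from cosine. *)
Definition osc : finType := (('I_4 * 'I_#|S3|) + ('I_#|S2| * bool))%type.

Definition okey (j : osc) : int :=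
  match j with inl i => kappa3 k1 k2 i | inr (q, _) => kj (enum_val q) end.

Definition ophase (j : osc) : R :=
  match j with inl i => phase3 R i | inr (_, b) => if b then - (pi / 2) else 0 end.

(** The waves of frequencies kappa_3 and kappa_4 both come from [cos w1 * sin w2], so both drive the
    field [l.2]. *)
Definition ogen (j : osc) : 'I_m :=
  match j with
  | inl (s, p) => let l := enum_val p in nth l.2 [:: l.1.1; l.1.2; l.2; l.2] s
  | inr (q, b) => if b then (enum_val q).2 else (enum_val q).1
  end.

(** The amplitude without its power of [s]. The factor [2^-1] comes from writing [cos w1 * sin w2]
    as a half-sum of two sines. *)
Definition oamp (a2 : 'cV[R]_#|S2|) (a3 : 'cV[R]_#|S3|) (j : osc) : R :=
  match j with
  | inl (s, p) => cbrt (a3 p 0) *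
      (2 * cbrt (2 * pi ^+ 2 * (kappa3 k1 k2 (2, p))%:~R * (kappa3 k1 k2 (3, p))%:~R)) *
      (if (s < 2)%N then 1 else 2^-1)
  | inr (q, b) => Num.sqrt `|a2 q 0| * (2 * Num.sqrt (pi * (kj (enum_val q))%:~R)) *
      (if b then 1 else Num.sg (a2 q 0))
  end.

(** The relative size of a wave once [s^-4] is factored out. At [s = 0] it erases the second-order
    waves, which isolates the leading part of the triple sums. *)
Definition osmall (s : R) (j : osc) : R := if j is inl _ then 1 else s.

Lemma sum_osc (V : nmodType) (F : osc -> V) : \sum_j F j =
  \sum_(p < #|S3|) (F (inl (0, p)) + F (inl (1, p)) + F (inl (2, p)) + F (inl (3, p))) +
  \sum_(q < #|S2|) (F (inr (q, false)) + F (inr (q, true))).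
Proof.
rewrite big_sumType /=; congr (_ + _).
  rewrite (_ : \sum_i F (inl i) = \sum_s \sum_p F (inl (s, p))); last first.
    by rewrite pair_bigA; apply: eq_bigr => -[].
  rewrite exchange_big; apply: eq_bigr => p _.
  rewrite !big_ord_recl big_ord0 /= addr0 !addrA.
  by congr (F (inl (_, p)) + F (inl (_, p)) + F (inl (_, p)) + F (inl (_, p))); apply: val_inj.
rewrite (_ : \sum_i F (inr i) = \sum_q \sum_b F (inr (q, b))); last first.
  by rewrite pair_bigA; apply: eq_bigr => -[].
apply: eq_bigr => q _.
by rewrite big_bool addrC.
Qed.

Lemma powR_sixth (s : R) : 0 < s ->
  (s ^+ 6) `^ (- (1 / 2)) = (s ^+ 3)^-1 /\ (s ^+ 6) `^ (- (2 / 3)) = (s ^+ 4)^-1.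
Proof.
move=> s0; have s0' := ltW s0.
rewrite -(powR_mulrn 6 s0') -!powRrM -(powR_mulrn 3 s0') -(powR_mulrn 4 s0') -!powRN.
by split; congr (_ `^ _); lra.
Qed.

Lemma wave_cos (eps t : R) (k : int) : wave eps k 0 t = cos (2 * pi * k%:~R * t / eps).
Proof. by rewrite /wave addr0. Qed.

Lemma wave_sin (eps t : R) (k : int) : wave eps k (- (pi / 2)) t = sin (2 * pi * k%:~R * t / eps).
Proof. by rewrite /wave cosBpihalf. Qed.

(* Writing [eps = s ^+ 6] turns the fractional powers of [eps] into integer powers of [s]. *)
Lemma control_coord (n : nat) (f : 'I_m -> 'cV[R]_n -> 'cV[R]_n) (S1 : {set 'I_m})
    (hn : (#|S1| + #|S2| + #|S3|)%N = n) (gamma s t : R) (x : 'cV[R]_n) (k : 'I_m) :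
  0 < s -> let a := coef f hn gamma x in
  control f hn kj k1 k2 gamma (s ^+ 6) t x k 0 =
  \sum_(p < #|S1|) (k == enum_val p)%:R * usubmx (usubmx a) p 0 +
  \sum_(j : osc) (k == ogen j)%:R *
    ((s ^+ 4)^-1 * osmall s j * oamp (dsubmx (usubmx a)) (dsubmx a) j *
     wave (s ^+ 6) (okey j) (ophase j) t).
Proof.
move=> s0 a; have [pw1 pw2] := powR_sixth s0.
have sn : s != 0 by rewrite gt_eqF.
rewrite sum_osc mxE -/a pw1 pw2 -!addrA; congr (_ + _).
  by apply: eq_bigr => p _; rewrite mulrC.
rewrite addrC !mulr_sumr; congr (_ + _); apply: eq_bigr => p _.
  rewrite /phi3 /=.
  have -> : wave (s ^+ 6) (kappa3 k1 k2 (0, p)) (phase3 R (0 : 'I_4, p)) t =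
     cos (2 * pi * (kap k1 k2 0 (enum_val p))%:~R * t / s ^+ 6) by rewrite -wave_cos.
  have -> : wave (s ^+ 6) (kappa3 k1 k2 (1, p)) (phase3 R (1 : 'I_4, p)) t =
     sin (2 * pi * (kap k1 k2 1 (enum_val p))%:~R * t / s ^+ 6) by rewrite -wave_sin.
  have -> : cos (2 * pi * (kap k1 k2 0 (enum_val p))%:~R * t / s ^+ 6) *
     sin (2 * pi * (kap k1 k2 1 (enum_val p))%:~R * t / s ^+ 6) =
     2^-1 * (wave (s ^+ 6) (kappa3 k1 k2 (2, p)) (phase3 R (2 : 'I_4, p)) t +
             wave (s ^+ 6) (kappa3 k1 k2 (3, p)) (phase3 R (3 : 'I_4, p)) t).
    rewrite -wave_cos -wave_sin mulrC waveM addr0 subr0.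
    by congr (_ * (wave _ _ _ _ + _)); rewrite /kappa3 /kap /= addrC.
  rewrite /kappa3 /=; move: (wave _ _ _ _) (wave _ _ _ _) => w2 w3; ring.
rewrite /phi2 /=.
have -> : (s ^+ 3)^-1 = (s ^+ 4)^-1 * s by field.
by rewrite wave_cos wave_sin; ring.
Qed.
End Oscillators.

Lemma cbrtK (R : realType) (a : R) : cbrt a ^+ 3 = a.
Proof.
rewrite /cbrt exprMn -(powR_mulrn 3 (powR_ge0 _ _)) -powRrM.
rewrite (_ : 1 / 3 * 3%:R = 1); last by rewrite mul1r mulVf.
rewrite powRr1// -[RHS]mulr_sg_norm; congr (_ * _).
by case: sgrP => _; rewrite ?expr0n ?expr1n// exprS sqrrN expr1n mulr1.
Qed.

Lemma norm_cbrt_le (R : realType) (a : R) : `|cbrt a| <= 1 + `|a|.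
Proof.
rewrite leNgt; apply/negP => h.
have a0 : 0 <= `|a| by [].
have h1 : 1 < `|cbrt a| by lra.
have : `|cbrt a| ^+ 3 = `|a| by rewrite -normrX cbrtK.
suff : `|cbrt a| <= `|cbrt a| ^+ 3 by lra.
by rewrite ler_eXnr// ltW.
Qed.

Lemma sqrt_le_add1 (R : realType) (a : R) : 0 <= a -> Num.sqrt a <= 1 + a.
Proof.
move=> a0; rewrite -[leRHS]ger0_norm ?addr_ge0// -sqrtr_sqr ler_wsqrtr//.
by rewrite sqrrD expr1n mul1r; have := sqr_ge0 a; lra.
Qed.

(** * Brackets as means of double and triple products *)

Section MainTerms.
Context (R : realType) (m : nat) (S2 : {set 'I_m * 'I_m}) (S3 : {set 'I_m * 'I_m * 'I_m})
  (kj : 'I_m * 'I_m -> int) (k1 k2 : 'I_m * 'I_m * 'I_m -> int).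
Hypothesis nres : non_resonant S2 S3 kj k1 k2.

Local Notation osc := (osc S2 S3).
Local Notation okey := (@okey m S2 S3 kj k1 k2).
Local Notation ophase := (@ophase R m S2 S3).
Local Notation kap3 := (@kappa3 m S3 k1 k2).

Lemma kj_gt0 (q : 'I_#|S2|) : 0 < kj (enum_val q).
Proof.
have [kpos _ _] := nres; apply: kpos; rewrite mem_cat; apply/orP; left.
by apply: map_f; rewrite mem_enum enum_valP.
Qed.

Lemma kappa3_gt0 i : 0 < kap3 i.
Proof. exact: kap_gt0 nres (enum_valP i.2). Qed.

Lemma okey_gt0 (j : osc) : 0 < okey j.
Proof. by case: j => [i|[q b]] /=; [exact: kappa3_gt0|exact: kj_gt0]. Qed.

(** With pairwise distinct parameters, the only coincidence left is between the cosine and the sine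
    of one pair of [S2]; hence only these double products can have a mean. *)
Lemma okey_inj (nu mu : osc) : okey nu = okey mu ->
  nu = mu \/ exists q b b', nu = inr (q, b) /\ mu = inr (q, b').
Proof.
have disj (i : 'I_4 * 'I_#|S3|) (q : 'I_#|S2|) : kap3 i <> kj (enum_val q).
  have [_ + _] := nres; rewrite cat_uniq => /and3P[_ /hasPn h _] e.
  have /h : kap3 i \in [seq kap k1 k2 s l | s <- enum 'I_4, l <- enum S3].
    by apply/allpairsP; exists (i.1, enum_val i.2); rewrite !mem_enum enum_valP.
  by rewrite /= e map_f// mem_enum enum_valP.
case: nu mu => [i|[q b]] [i'|[q' b']] /=.
- move=> /(kap_inj nres (enum_valP i.2) (enum_valP i'.2)).
  by case: i i' => s p [s' p'] [/= -> /enum_val_inj ->]; left.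
- by move=> /disj.
- by move=> /esym/disj.
have [_ + _] := nres; rewrite cat_uniq => /and3P[/uniq_map_inj_in h _ _] e.
right; exists q, b, b'; split => //; congr (inr (_, _)); apply: enum_val_inj.
by apply/esym; apply: h; rewrite ?mem_enum ?enum_valP.
Qed.

Lemma coef2E (nu mu : osc) : coef2 okey ophase nu mu =
  iom R (okey nu) / 2 * ((okey nu == okey mu)%:R * cos (ophase nu - pi / 2 - ophase mu)).
Proof.
rewrite /coef2 /wmean; congr (_ * _).
have -> : (okey nu + okey mu == 0) = false.
  by have := okey_gt0 nu; have := okey_gt0 mu; lia.
by rewrite mul0r add0r subr_eq0.
Qed.

(** A periodic function times its own derivative is half the derivative of its square, so its mean
    vanishes. *)
Lemma coef2_diag (nu : osc) : coef2 okey ophase nu nu = 0.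
Proof. by rewrite coef2E addrAC subrr add0r cosN cos_pihalf !mulr0. Qed.

Lemma coef2_off (nu mu : osc) :
  (forall q b b', ~ (nu = inr (q, b) /\ mu = inr (q, b'))) -> coef2 okey ophase nu mu = 0.
Proof.
move=> h; have [->|nm] := eqVneq nu mu; first exact: coef2_diag.
rewrite coef2E; case: eqP => [/okey_inj[e|[q [b [b' e]]]]|_].
- by rewrite e eqxx in nm.
- by case: (h q b b').
- by rewrite mul0r mulr0.
Qed.

Lemma coef2_cos_sin (q : 'I_#|S2|) :
  coef2 okey ophase (inr (q, false)) (inr (q, true)) = iom R (kj (enum_val q)) / 2.
Proof. by rewrite coef2E eqxx mul1r /= add0r opprK addNr cos0 mulr1. Qed.

Lemma coef2_sin_cos (q : 'I_#|S2|) :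
  coef2 okey ophase (inr (q, true)) (inr (q, false)) = - (iom R (kj (enum_val q)) / 2).
Proof.
rewrite coef2E eqxx mul1r /= subr0 -opprD cosN -splitr.
by rewrite cospi mulrN1.
Qed.

(** The cosine-sine and sine-cosine coefficients are opposite; this antisymmetry is what produces a
    bracket. *)
Lemma coef2_sum (Y : osc -> osc -> R) :
  \sum_nu \sum_mu coef2 okey ophase nu mu * Y nu mu =
  \sum_q iom R (kj (enum_val q)) / 2 *
    (Y (inr (q, false)) (inr (q, true)) - Y (inr (q, true)) (inr (q, false))).
Proof.
have Ei i : \sum_mu coef2 okey ophase (inl i) mu * Y (inl i) mu = 0.
  by rewrite big1// => mu _; rewrite coef2_off ?mul0r// => q b b' [].
have Eq q b : \sum_mu coef2 okey ophase (inr (q, b)) mu * Y (inr (q, b)) mu =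
    coef2 okey ophase (inr (q, b)) (inr (q, ~~ b)) * Y (inr (q, b)) (inr (q, ~~ b)).
  rewrite (bigD1 (inr (q, ~~ b)))//= big1 ?addr0// => mu mub.
  have [->|mub'] := eqVneq mu (inr (q, b)); first by rewrite coef2_diag mul0r.
  rewrite coef2_off ?mul0r// => q0 b0 b1 [[<- _] e]; move: mub mub'; rewrite e.
  by case: b b1 {e} => -[]; rewrite eqxx.
rewrite sum_osc [X in X + _]big1 => [|p _]; last by rewrite !Ei !addr0.
rewrite add0r; apply: eq_bigr => q _.
by rewrite !Eq /= coef2_cos_sin coef2_sin_cos; ring.
Qed.

Variables (a2 : 'cV[R]_#|S2|) (a3 : 'cV[R]_#|S3|) (s : R).
Hypotheses (s0 : 0 < s) (s1 : s <= 1).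

Local Notation oamp := (oamp kj k1 k2 a2 a3).
Local Notation ogen := (@ogen m S2 S3).
Local Notation osmall := (@osmall R m S2 S3).

Definition obeta (j : osc) : R := (s ^+ 4)^-1 * osmall s j * oamp j.

(** The means of [U_nu u_mu] and [V_nu_mu u_la], one factor [s^6] per integration. The powers cancel
    for two second-order waves, [s^-6 s^6], and for three third-order waves, [s^-12 s^12]. *)
Definition mean2 (nu mu : osc) : R :=
  obeta nu * obeta mu * (s ^+ 6 * coef2 okey ophase nu mu).

Definition mean3 (nu mu la : osc) : R :=
  obeta nu * obeta mu * obeta la * ((s ^+ 6) ^+ 2 * coef3 okey ophase nu mu la).

(** The normalisation [2 sqrt(pi kappa)] is chosen for this: its square times [iom / 2] equals one,
    and [sqrt |a|] squared times the sign of [a] gives back [a]. *)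
Lemma second_order_sum (Y : 'I_m -> 'I_m -> R) :
  \sum_nu \sum_mu mean2 nu mu * Y (ogen nu) (ogen mu) =
  \sum_q a2 q 0 * (Y (enum_val q).1 (enum_val q).2 - Y (enum_val q).2 (enum_val q).1).
Proof.
transitivity (\sum_nu \sum_mu coef2 okey ophase nu mu *
    (obeta nu * obeta mu * s ^+ 6 * Y (ogen nu) (ogen mu))).
  by apply: eq_bigr => nu _; apply: eq_bigr => mu _; rewrite /mean2; ring.
rewrite (coef2_sum (fun nu mu => obeta nu * obeta mu * s ^+ 6 * Y (ogen nu) (ogen mu))).
apply: eq_bigr => q _; rewrite /obeta /=.
have sn : s != 0 by rewrite gt_eqF.
have kq : 0 < pi * (kj (enum_val q))%:~R :> R.
  by rewrite mulr_gt0 ?pi_gt0// ltr0z kj_gt0.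
set K := pi * _ in kq *.
have iK : iom R (kj (enum_val q)) = (2 * K)^-1 by rewrite /iom /K mulrA.
have K2 : Num.sqrt K * Num.sqrt K = K by rewrite -expr2 sqr_sqrtr// ltW.
have A2 : Num.sqrt `|a2 q 0| * Num.sqrt `|a2 q 0| * Num.sg (a2 q 0) = a2 q 0.
  by rewrite -expr2 sqr_sqrtr// mulrC mulr_sg_norm.
have S0 : (s ^+ 4)^-1 * (s ^+ 4)^-1 * (s * s) * s ^+ 6 = 1 by field.
have Kn : K != 0 by rewrite gt_eqF.
rewrite iK -[in RHS]A2.
move: (Num.sqrt `|a2 q 0|) (Num.sg (a2 q 0)) (Y _ _) (Y _ _) => ra sa y1 y2.
transitivity ((2 * K)^-1 / 2 * ((s ^+ 4)^-1 * (s ^+ 4)^-1 * (s * s) * s ^+ 6) *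
  (ra * ra * sa * 4 * (Num.sqrt K * Num.sqrt K)) * (y2 - y1)); first by ring.
by rewrite S0 K2; field.
Qed.

(** Two third-order waves would give [s^-2], and a mixed pair [s^-1], but their coefficients vanish;
    for second-order waves the powers of [s] cancel. *)
Lemma norm_mean2 (nu mu : osc) (C : R) : 0 <= C -> (forall j, `|oamp j| <= C) ->
  `|mean2 nu mu| <= C ^+ 2.
Proof.
move=> C0 aC.
have sn : s != 0 by rewrite gt_eqF.
have c2 := norm_coef2 okey ophase nu mu.
have off : (forall q b b', ~ (nu = inr (q, b) /\ mu = inr (q, b'))) -> `|mean2 nu mu| <= C ^+ 2.
  by move=> h; rewrite /mean2 coef2_off// !mulr0 normr0 sqr_ge0.
case: nu mu off c2 => [i|[q b]] [j|[q' b']] off c2; try by apply: off => ? ? ? [].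
rewrite /mean2 /obeta /=.
set A := oamp (inr (q, b)); set A' := oamp (inr (q', b')); set c := coef2 _ _ _ _.
have -> : (s ^+ 4)^-1 * s * A * ((s ^+ 4)^-1 * s * A') * (s ^+ 6 * c) = A * A' * c by field.
have h1 : `|A * A'| <= C ^+ 2 by rewrite normrM expr2 ler_pM ?aC.
by rewrite normrM -[leRHS]mulr1 ler_pM.
Qed.

(** A triple containing a second-order wave carries a factor [s] and is counted as error. The rest
    is the same sum with [osmall 0], to which [coef3_sum] applies. *)
Lemma third_order_sum (Y : 'I_m -> 'I_m -> 'I_m -> R) (C B : R) :
  0 <= C -> (forall j, `|oamp j| <= C) -> (forall i j k, `|Y i j k| <= B) ->
  `|\sum_nu \sum_mu \sum_la mean3 nu mu la * Y (ogen nu) (ogen mu) (ogen la) -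
    \sum_p (let l := enum_val p in let a := l.1.1 in let b := l.1.2 in let c := l.2 in
      a3 p 0 * (Y c b a - Y c a b - Y b a c + Y a b c))|
  <= #|osc|%:R * (#|osc|%:R * (#|osc|%:R * (s * (C ^+ 3 * B)))).
Proof.
move=> C0 aC YB.
have sn : s != 0 by rewrite gt_eqF.
pose tau nu mu la := oamp nu * oamp mu * oamp la * coef3 okey ophase nu mu la *
  Y (ogen nu) (ogen mu) (ogen la).
have tauB nu mu la : `|tau nu mu la| <= C ^+ 3 * B.
  rewrite /tau normrM ler_pM// normrM -[leRHS]mulr1 ler_pM ?norm_coef3//.
  have h2 : `|oamp nu * oamp mu| <= C ^+ 2 by rewrite normrM expr2 ler_pM ?aC.
  by rewrite normrM exprSr ler_pM ?aC.
have mE nu mu la : mean3 nu mu la * Y (ogen nu) (ogen mu) (ogen la) =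
    osmall s nu * osmall s mu * osmall s la * tau nu mu la.
  by rewrite /mean3 /obeta /tau; field.
have -> : \sum_p (let l := enum_val p in let a := l.1.1 in let b := l.1.2 in let c := l.2 in
      a3 p 0 * (Y c b a - Y c a b - Y b a c + Y a b c)) =
    \sum_nu \sum_mu \sum_la osmall 0 nu * osmall 0 mu * osmall 0 la * tau nu mu la.
  have il (F : osc -> R) : \sum_j osmall 0 j * F j = \sum_i F (inl i).
    rewrite big_sumType /= [X in _ + X]big1 ?addr0 => [|[q b] _]; last by rewrite mul0r.
    by apply: eq_bigr => i _; rewrite mul1r.
  transitivity (\sum_a \sum_b \sum_c coef3 kap3 (@phase3 R _) a b c *
    (oamp (inl a) * oamp (inl b) * oamp (inl c) *
      Y (ogen (inl a)) (ogen (inl b)) (ogen (inl c)))); last first.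
    transitivity (\sum_nu osmall 0 nu * \sum_mu (osmall 0 mu * \sum_la (osmall 0 la * tau nu mu la))).
      rewrite il; apply: eq_bigr => a _; rewrite il; apply: eq_bigr => b _.
      rewrite il; apply: eq_bigr => c _.
      have cE : coef3 okey ophase (inl a) (inl b) (inl c) = coef3 kap3 (@phase3 R _) a b c by [].
      by rewrite /tau cE mulrCA mulrA.
    apply: eq_bigr => nu _; rewrite mulr_sumr; apply: eq_bigr => mu _.
    by rewrite mulrA mulr_sumr; apply: eq_bigr => la _; rewrite mulrA.
  have k2E p : kap3 (2, p) = kap3 (0, p) + kap3 (1, p) by [].
  have k3E p : kap3 (3, p) = kap3 (1, p) - kap3 (0, p) by [].
  rewrite (coef3_sum kappa3_gt0 k2E k3E (kappa3_relations nres)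
    (fun a b c => oamp (inl a) * oamp (inl b) * oamp (inl c) *
      Y (ogen (inl a)) (ogen (inl b)) (ogen (inl c)))).
  apply: eq_bigr => p _; cbv beta zeta.
  set x : R := (kap3 (0, p))%:~R; set y : R := (kap3 (1, p))%:~R.
  have x0 : x != 0 by rewrite intr_eq0 gt_eqF// kappa3_gt0.
  have y0 : y != 0 by rewrite intr_eq0 gt_eqF// kappa3_gt0.
  have z0 : x + y != 0 by rewrite -intrD -k2E intr_eq0 gt_eqF// kappa3_gt0.
  have w0 : y - x != 0 by rewrite -intrB -k3E intr_eq0 gt_eqF// kappa3_gt0.
  have pn : (pi : R) != 0 by rewrite gt_eqF ?pi_gt0.
  have zE : (kap3 (2, p))%:~R = x + y :> R by rewrite k2E intrD.
  have wE : (kap3 (3, p))%:~R = y - x :> R by rewrite k3E intrB.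
  pose be := cbrt (a3 p 0) * (2 * cbrt (2 * pi ^+ 2 * (kap3 (2, p))%:~R * (kap3 (3, p))%:~R)).
  have be3 : be ^+ 3 = a3 p 0 * (16 * pi ^+ 2 * ((x + y) * (y - x))).
    have e3 (u v : R) : (cbrt u * (2 * cbrt v)) ^+ 3 = u * (8 * v).
      rewrite -[in RHS](cbrtK u) -[in RHS](cbrtK v).
      by move: (cbrt u) (cbrt v) => u' v'; ring.
    by rewrite /be e3 zE wE; ring.
  have [A0 A1 A2 A3] : [/\ oamp (inl (0, p)) = be, oamp (inl (1, p)) = be,
      oamp (inl (2, p)) = be / 2 & oamp (inl (3, p)) = be / 2].
    by split; rewrite /= ?mulr1.
  rewrite A0 A1 A2 A3 [ogen (inl (0, p))]/= [ogen (inl (1, p))]/= [ogen (inl (2, p))]/= [ogen (inl (3, p))]/=.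
  set a := (enum_val p).1.1; set b := (enum_val p).1.2; set c := (enum_val p).2.
  (* The terms with the third field in the middle cancel between kappa_3 and kappa_4. The partial
     fractions of the others combine into one over [16 pi^2 kappa_3 kappa_4], which is exactly the
     factor contained in [be ^+ 3]. *)
  transitivity (be ^+ 3 * (16 * pi ^+ 2 * ((x + y) * (y - x)))^-1 *
    (Y c b a - Y c a b - Y b a c + Y a b c)).
    by rewrite be3 mulfK// !mulf_neq0 ?expf_neq0.
  clear A0 A1 A2 A3 be3 zE wE; move: be pn z0 w0 x0 y0 => be.
  move: (pi : R) (x) (y) (Y c b a) (Y c a b) (Y b a c) (Y a b c) (Y a c b) (Y b c a).
  move=> q x' y' y1 y2 y3 y4 y5 y6 pn z0 w0 x0 y0; field.
  by rewrite pn z0 w0 x0 y0.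
rewrite -sumrB; apply: ler_norm_sum_const => nu.
rewrite -sumrB; apply: ler_norm_sum_const => mu.
rewrite -sumrB; apply: ler_norm_sum_const => la.
rewrite mE -mulrBl normrM ler_pM//.
have s0' := ltW s0.
have ss : s * s <= s by rewrite ler_piMr.
have sss : s * s * s <= s by rewrite (le_trans _ ss)// ler_piMr// mulr_ge0.
case: nu mu la => [i|[q b]] [j|[q' b']] [k|[q'' b'']] /=;
  rewrite ?(mulr1, mul1r, mulr0, mul0r, subrr, subr0, normr0)// ger0_norm ?mulr_ge0//.
Qed.
End MainTerms.

(** * One sampling interval *)

Lemma sac_opp (R : realType) (a b : R) p : sac a b p -> sac a b (fun t => - p t).
Proof.
move=> h e e0; have [d d0 dP] := h e e0; exists d => // N s t st dis lt_d.
apply: le_lt_trans (dP N s t st dis lt_d); apply: ler_sum => i _.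
by rewrite -opprD normrN.
Qed.

Lemma abs_cont_sub (R : realType) n (a b a' b' : R) (x : R -> 'cV[R]_n) :
  a <= a' -> b' <= b -> abs_cont a b x -> abs_cont a' b' x.
Proof.
move=> aa bb h e e0; have [d d0 dP] := h e e0; exists d => // N s t st.
by apply: dP => i; have [h1 h2 h3] := st i; rewrite (le_trans aa) ?(le_trans h3).
Qed.

Lemma abs_cont_sac (R : realType) n (a b : R) (x : R -> 'cV[R]_n) c :
  abs_cont a b x -> sac a b (fun t => x t c 0).
Proof.
move=> h e e0; have [d d0 dP] := h e e0; exists d => // N s t st dis lt_d.
apply: le_lt_trans (dP N s t st dis lt_d); apply: ler_sum => i _.
by rewrite (le_trans _ (coord_le_enorm _ c))// !mxE.
Qed.

Lemma lip_abs_cont (R : realType) n (a b M : R) (x : R -> 'cV[R]_n) : 0 <= M ->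
  (forall s t, a <= s <= b -> a <= t <= b -> s <= t -> `|x t - x s| <= M * (t - s)) ->
  abs_cont a b x.
Proof.
move=> M0 xM e e0; have nM : 0 < n%:R * M + 1 :> R by rewrite ltr_wpDl// mulr_ge0.
exists (e / (n%:R * M + 1)); first by rewrite divr_gt0.
move=> N s t st _; rewrite ltr_pdivlMr// => h.
apply: le_lt_trans h; rewrite mulrC mulr_sumr; apply: ler_sum => i _.
have [h1 h2 h3] := st i; rewrite (le_trans (enorm_le_norm _))//.
apply: (@le_trans _ _ (n%:R * (M * (t i - s i)))).
  by rewrite ler_wpM2l// xM// ?h1 ?h3 ?(le_trans h1 h2) ?(le_trans h2 h3).
by rewrite mulrA ler_wpM2r ?subr_ge0// lerDl.
Qed.

Lemma abs_cont_uniform (R : realType) n (a b : R) (x : R -> 'cV[R]_n) (e : R) :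
  abs_cont a b x -> 0 < e -> exists2 d : R, 0 < d &
    forall s t, a <= s -> s <= t -> t <= b -> t - s < d -> `|x t - x s| < e.
Proof.
move=> h e0; have [d d0 dP] := h e e0; exists d => // s t as_ st tb std.
have := dP 1%N (fun=> s) (fun=> t) (fun=> And3 as_ st tb).
rewrite !big_ord_recl !big_ord0 !addr0 => H.
apply: le_lt_trans (norm_le_enorm _) (H _ std) => i j.
by rewrite (ord1 i) (ord1 j) eqxx.
Qed.

Lemma is_derive_coord (R : realType) n (x : R -> 'cV[R]_n) (t : R) v c :
  is_derive t 1 x v -> is_derive t 1 (fun t => x t c 0) (v c 0).
Proof.
move=> [dx <-]; apply: DeriveDef; first by have /derivable_mxP := dx; exact.
by rewrite derive_mx// mxE.
Qed.

Lemma vec_increment_le (R : realType) n (a b M : R) (x : R -> 'cV[R]_n) :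
  0 <= M -> a <= b -> abs_cont a b x ->
  {ae (@lebesgue_measure R), forall t : R, a < t < b ->
    exists2 v, is_derive t 1 x v & `|v| <= M} ->
  `|x b - x a| <= M * (b - a).
Proof.
move=> M0 ab acx dx; apply: norm_le_coord => [|c]; first by rewrite mulr_ge0 ?subr_ge0.
rewrite !mxE ler_norml; apply/andP; split; last first.
  apply: (sac_increment_le M0 ab (abs_cont_sac c acx)).
  apply: ae_impl dx => t h tab; have [v dv vM] := h tab.
  exists (v c 0); first exact: is_derive_coord.
  by rewrite (le_trans (ler_norm _))// (le_trans (coord_le_norm _ _)).
rewrite lerNl opprB.
have := sac_increment_le M0 ab (sac_opp (abs_cont_sac c acx)).
rewrite opprK [- _ + _]addrC; apply.
apply: ae_impl dx => t h tab; have [v dv vM] := h tab.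
exists (- v c 0); first by apply: is_deriveN; exact: is_derive_coord.
by rewrite (le_trans (ler_norm _))// normrN (le_trans (coord_le_norm _ _)).
Qed.

(* A derivative bound that is known only near [x a] already confines [x], because the exit time from the neighbourhood cannot come before the end. *)
Lemma confined (R : realType) n (a b M r : R) (x : R -> 'cV[R]_n) :
  0 <= M -> a <= b -> 0 < r -> M * (b - a) < r -> abs_cont a b x ->
  {ae (@lebesgue_measure R), forall t : R, a < t < b -> `|x t - x a| <= r ->
    exists2 v, is_derive t 1 x v & `|v| <= M} ->
  forall t, a <= t <= b -> `|x t - x a| <= M * (t - a).
Proof.
move=> M0 ab r0 Mr acx dx.
have incr c : a <= c <= b -> (forall t, a <= t < c -> `|x t - x a| <= r) ->
    `|x c - x a| <= M * (c - a).
  move=> /andP[ac cb] hc; apply: vec_increment_le => //.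
    by apply: abs_cont_sub acx.
  apply: ae_impl dx => t h /andP[t1 t2]; apply: h; first by rewrite t1 (lt_le_trans t2).
  by apply: hc; rewrite ltW.
pose S := [set t | a <= t <= b /\ forall u, a <= u <= t -> `|x u - x a| <= r].
have Sa : S a.
  split; first by rewrite lexx ab.
  move=> u /andP[u1 u2]; have -> : u = a by apply/eqP; rewrite eq_le u1 u2.
  by rewrite subrr normr0 ltW.
have supS : has_sup S by split; [exists a | exists b => t []; case/andP].
pose c := sup S.
have ac : a <= c by exact: (sup_upper_bound supS).
have cb : c <= b by apply: ge_sup; [exists a | move=> t []; case/andP].
have below t : a <= t < c -> `|x t - x a| <= r.
  move=> /andP[t1 t2]; have ct : 0 < c - t by rewrite subr_gt0.
  have [s [_ sP]] := sup_adherent ct supS.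
  by rewrite -/c subKr => ts; apply: sP; rewrite t1 ltW.
have cE : c = b.
  apply/eqP; rewrite eq_le cb leNgt; apply/negP => cltb.
  have xc : `|x c - x a| <= M * (c - a) by apply: incr; rewrite ?ac ?cb.
  (* The strict inequality [M * (b - a) < r] leaves room at [c], so that [x] stays within [r]
     slightly beyond it. *)
  have e0 : 0 < r - M * (c - a).
    by rewrite subr_gt0 (le_lt_trans _ Mr)// ler_wpM2l// lerD2r.
  have [d d0 dP] := abs_cont_uniform acx e0.
  pose t := Num.min b (c + d / 2).
  have ct : c < t by rewrite lt_min cltb ltrDl divr_gt0.
  suff St : S t by have := sup_upper_bound supS St; rewrite leNgt -/c ct.
  split; first by rewrite (le_trans ac (ltW ct)) ge_min lexx.
  move=> u /andP[u1 u2]; have [uc|cu] := ltP u c; first by apply: below; rewrite u1.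
  rewrite -(subrKA (x c)) (le_trans (ler_normD _ _))//.
  have -> : r = (r - M * (c - a)) + M * (c - a) by rewrite subrK.
  rewrite lerD// ltW// dP//.
    by rewrite (le_trans u2)// ge_min lexx.
  rewrite ltrBlDl (le_lt_trans u2)// gt_min ltrD2l.
  by rewrite ltr_pdivrMr// ltr_pMr// ltr1n orbT.
move=> t /andP[t1 t2]; apply: incr => [|u /andP[u1 u2]]; first by rewrite t1.
by apply: below; rewrite u1 cE (lt_le_trans u2).
Qed.

(** Because each bound may be enlarged, the sum of the individual bounds serves for all indices at
    once. *)
Lemma fin_bound (R : realType) (T : finType) (P : T -> R -> Prop) :
  (forall t, exists2 B : R, 0 <= B & forall B', B <= B' -> P t B') ->
  exists2 B : R, 0 <= B & forall t, P t B.
Proof.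
move=> h.
have h' t : exists B : R, 0 <= B /\ forall B', B <= B' -> P t B'.
  by have [B B0 BP] := h t; exists B.
have [B BP] := choice h'.
exists (\sum_t B t); first by apply: sumr_ge0 => t _; have [] := BP t.
move=> t; have [_] := BP t; apply.
by rewrite (bigD1 t)//= lerDl sumr_ge0// => u _; have [] := BP u.
Qed.

(** * Uniform bounds for finite families of fields *)

Lemma fields_bounded (R : realType) n (T : finType) (D K : set 'cV[R]_n) k
    (F : T -> 'cV[R]_n -> R) :
  compact K -> K `<=` D -> (forall t, sC k D (F t)) ->
  exists2 B : R, 0 <= B & forall t y, K y -> `|F t y| <= B.
Proof.
move=> cK KD sF; apply: (fin_bound (P := fun t B => forall y, K y -> `|F t y| <= B)) => t.
have [B B0 BP] := sC_bounded (sF t) cK KD.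
by exists B => // B' BB' y Ky; rewrite (le_trans (BP _ Ky)).
Qed.

Lemma fields_lipschitz (R : realType) n (T : finType) (D K : set 'cV[R]_n)
    (F : T -> 'cV[R]_n -> R) :
  open D -> compact K -> K `<=` D -> segment_closed K -> (forall t, sC 1 D (F t)) ->
  exists2 L : R, 0 <= L & forall t y z, K y -> K z -> `|F t y - F t z| <= L * `|y - z|.
Proof.
move=> oD cK KD segK sF.
apply: (fin_bound (P := fun t L => forall y z, K y -> K z -> `|F t y - F t z| <= L * `|y - z|)) => t.
have [L L0 LP] := sC1_lipschitz oD (sF t) cK KD segK.
by exists L => // L' LL' y z Ky Kz; rewrite (le_trans (LP _ _ Ky Kz))// ler_wpM2r.
Qed.

Lemma fields_pd_bounded (R : realType) n (T : finType) (D K : set 'cV[R]_n)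
    (F : T -> 'cV[R]_n -> R) :
  compact K -> K `<=` D -> (forall t, sC 1 D (F t)) ->
  exists2 B : R, 0 <= B & forall t y, K y -> \sum_(i < n) `|pd i (F t) y| <= B.
Proof.
move=> cK KD sF.
have [B B0 BP] := @fields_bounded R n (T * 'I_n)%type D K 0 (fun ti => pd ti.2 (F ti.1))
  cK KD (fun ti => sC_pd ti.2 (sF ti.1)).
exists (n%:R * B) => [|t y Ky]; first by rewrite mulr_ge0.
rewrite (le_trans (ler_sum _ (fun i _ => BP (t, i) y Ky)))//.
by rewrite sumr_const card_ord -[leLHS]mulr_natl.
Qed.

(** The smoothness is spent here: two directional derivatives take [C^3] fields down to [C^1], from
    which [field3] gets its Lipschitz bound. *)
Lemma ex_field_bounds (R : realType) n (J : finType) (D K : set 'cV[R]_n)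
    (X : J -> 'cV[R]_n -> 'cV[R]_n) :
  open D -> compact K -> K `<=` D -> segment_closed K -> (forall nu, vC 3 D (X nu)) ->
  exists B L, field_bounds K X B L.
Proof.
move=> oD cK KD segK sX.
have s1 (t : J * 'I_n) : sC 1 D (fun y => X t.1 y t.2 0) by exact: sC_le (sX t.1 t.2).
have s2' nu mu : vC 2 D (field2 X nu mu).
  by apply: vC_valong => //; exact: vC_le (sX mu).
have s2 (t : J * J * 'I_n) : sC 1 D (fun y => field2 X t.1.1 t.1.2 y t.2 0).
  exact: sC_le (s2' t.1.1 t.1.2 t.2).
have s3 (t : J * J * J * 'I_n) : sC 1 D (fun y => field3 X t.1.1.1 t.1.1.2 t.1.2 y t.2 0).
  by apply: (vC_valong oD _ (s2' _ _)); exact: vC_le (sX t.1.2).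
have [B1 B10 B1P] := fields_pd_bounded cK KD s1.
have [B2 B20 B2P] := fields_pd_bounded cK KD s2.
have [L1 L10 L1P] := fields_lipschitz oD cK KD segK s1.
have [L2 L20 L2P] := fields_lipschitz oD cK KD segK s2.
have [L3 L30 L3P] := fields_lipschitz oD cK KD segK s3.
exists (B1 + B2), (L1 + L2 + L3); split; rewrite ?addr_ge0//.
- by move=> nu c y Ky; rewrite (le_trans (B1P (nu, c) y Ky))// lerDl.
- by move=> nu mu c y Ky; rewrite (le_trans (B2P (nu, mu, c) y Ky))// lerDr.
- move=> nu c y z Ky Kz; rewrite (le_trans (L1P (nu, c) y z Ky Kz))// ler_wpM2r//.
  by rewrite -addrA lerDl addr_ge0.
- move=> nu mu c y z Ky Kz; rewrite (le_trans (L2P (nu, mu, c) y z Ky Kz))// ler_wpM2r//.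
  by rewrite addrAC lerDr addr_ge0.
- move=> nu mu la c y z Ky Kz; rewrite (le_trans (L3P (nu, mu, la, c) y z Ky Kz))//.
  by rewrite ler_wpM2r// lerDr addr_ge0.
Qed.

Lemma ex_oamp_bound (R : realType) (m : nat) (S2 : {set 'I_m * 'I_m})
    (S3 : {set 'I_m * 'I_m * 'I_m}) (kj : 'I_m * 'I_m -> int)
    (k1 k2 : 'I_m * 'I_m * 'I_m -> int) (Ca : R) :
  0 <= Ca -> exists2 C : R, 0 <= C & forall (a2 : 'cV[R]_#|S2|) (a3 : 'cV[R]_#|S3|),
    (forall q, `|a2 q 0| <= Ca) -> (forall p, `|a3 p 0| <= Ca) ->
    forall j, `|oamp kj k1 k2 a2 a3 j| <= C.
Proof.
move=> Ca0.
have [C C0 CP] : exists2 C : R, 0 <= C & forall j : osc S2 S3,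
    forall (a2 : 'cV[R]_#|S2|) (a3 : 'cV[R]_#|S3|),
    (forall q, `|a2 q 0| <= Ca) -> (forall p, `|a3 p 0| <= Ca) ->
    `|oamp kj k1 k2 a2 a3 j| <= C; last by exists C => // a2 a3 h2 h3 j; exact: CP.
apply: (fin_bound (P := fun j C => forall (a2 : 'cV[R]_#|S2|) (a3 : 'cV[R]_#|S3|),
    (forall q, `|a2 q 0| <= Ca) -> (forall p, `|a3 p 0| <= Ca) ->
    `|oamp kj k1 k2 a2 a3 j| <= C)) => -[[s p]|[q b]].
- pose w : R := 2 * cbrt (2 * pi ^+ 2 * (kappa3 k1 k2 (2, p))%:~R * (kappa3 k1 k2 (3, p))%:~R).
  exists ((1 + Ca) * `|w|); first by rewrite mulr_ge0// addr_ge0.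
  move=> B' CB' a2 a3 h2 h3; rewrite (le_trans _ CB')// /oamp -/w normrM (normrM _ w).
  rewrite -[leRHS]mulr1 ler_pM ?mulr_ge0//.
    by rewrite ler_wpM2r// (le_trans (norm_cbrt_le _))// lerD2l.
  by case: ifP => _; rewrite ger0_norm// ?invr_ge0// invf_le1// ler1n.
- pose w : R := 2 * Num.sqrt (pi * (kj (enum_val q))%:~R).
  exists ((1 + Ca) * `|w|); first by rewrite mulr_ge0// addr_ge0.
  move=> B' CB' a2 a3 h2 h3; rewrite (le_trans _ CB')// /oamp -/w normrM (normrM _ w).
  rewrite -[leRHS]mulr1 ler_pM ?mulr_ge0//.
    rewrite ler_wpM2r// ger0_norm ?sqrtr_ge0// (le_trans (sqrt_le_add1 _))//.
    by rewrite lerD2l.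
  by case: b; rewrite ?normr1// normr_sg; case: (_ != 0).
Qed.

Lemma ler_norm_vec_sum_const (R : realType) n (T : finType) (F : T -> 'cV[R]_n) (C : R) :
  (forall j, `|F j| <= C) -> `|\sum_j F j| <= #|T|%:R * C.
Proof.
move=> h; rewrite (le_trans (ler_norm_sum _ _ _))//.
by rewrite (le_trans (ler_sum _ (fun j _ => h j)))// sumr_const mulr_natl.
Qed.

Lemma absorb_half (R : realType) (p q r w : R) :
  w <= p * q + r -> r <= 1 / 2 * w -> w <= p * (2 * q).
Proof. by rewrite mulrCA; move: (p * q) => pq; lra. Qed.

Ltac nonneg := repeat first [ done | assumption | apply: addr_ge0 | apply: mulr_ge0 | apply: exprn_ge0 ].

Section Step.
Context (R : realType) (n m : nat) (D : set 'cV[R]_n) (f : 'I_m -> 'cV[R]_n -> 'cV[R]_n)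
  (g : R -> 'cV[R]_n -> 'cV[R]_n)
  (S1 : {set 'I_m}) (S2 : {set 'I_m * 'I_m}) (S3 : {set 'I_m * 'I_m * 'I_m})
  (hn : (#|S1| + #|S2| + #|S3|)%N = n)
  (kj : 'I_m * 'I_m -> int) (k1 k2 : 'I_m * 'I_m * 'I_m -> int)
  (alpha delta d' Mg gamma : R).
Hypotheses (oD : open D) (sf : forall i, vC 3 D (f i))
  (Fu : forall x, D x -> Fmx f hn x \in unitmx)
  (alpha0 : 0 <= alpha) (Falpha : forall x, D x -> opnorm (invmx (Fmx f hn x)) <= alpha)
  (nres : non_resonant S2 S3 kj k1 k2)
  (delta0 : 0 < delta) (dd' : delta < d') (d'D : @eball R n d' `<=` D)
  (Mg0 : 0 <= Mg) (gM : forall t x, 0 <= t -> @eball R n d' x -> enorm (g t x) <= Mg)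
  (gamma0 : 0 < gamma).

Local Notation osc := (osc S2 S3).
Local Notation K := (@eball R n d').
Local Notation ctrl s t y := (control f hn kj k1 k2 gamma (s ^+ 6) t y).
Local Notation X := (fun j : osc => f (ogen j)).
Local Notation a1 y := (usubmx (usubmx (coef f hn gamma y))).
Local Notation a2 y := (dsubmx (usubmx (coef f hn gamma y))).
Local Notation a3 y := (dsubmx (coef f hn gamma y)).
Local Notation beta s y := (@obeta R m S2 S3 kj k1 k2 (a2 y) (a3 y) s).
Local Notation okey := (@okey m S2 S3 kj k1 k2).
Local Notation ophase := (@ophase R m S2 S3).

Definition usol (s a b : R) (y : 'cV[R]_n) (x : R -> 'cV[R]_n) :=
  [/\ x a = y, abs_cont a b x &
    {ae (@lebesgue_measure R), forall t : R, a < t < b ->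
      is_derive t 1 x (rhs g f t (x t) (ctrl s t y))}].

(** The first-order controls are constant on a sampling interval, so they join [g] in the bounded
    part of the velocity; everything else oscillates. *)
Lemma rhs_controlE (s t : R) (y z : 'cV[R]_n) : 0 < s ->
  rhs g f t z (ctrl s t y) =
  (g t z + \sum_(p < #|S1|) a1 y p 0 *: f (enum_val p) z) +
  \sum_(j : osc) (beta s y j * wave (s ^+ 6) (okey j) (ophase j) t) *: X j z.
Proof.
move=> s0; rewrite /rhs -addrA; congr (_ + _).
under eq_bigr => i _ do rewrite control_coord// scalerDl.
rewrite big_split /=; congr (_ + _).
  under eq_bigr => i _ do rewrite scaler_suml.
  rewrite exchange_big; apply: eq_bigr => p _.
  rewrite (bigD1 (enum_val p))//= eqxx mul1r big1 ?addr0// => i /negPf ip.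
  by rewrite ip mul0r scale0r.
under eq_bigr => i _ do rewrite scaler_suml.
rewrite exchange_big; apply: eq_bigr => j _.
rewrite (bigD1 (ogen j))//= eqxx mul1r big1 ?addr0// => i /negPf ip.
by rewrite ip mul0r scale0r.
Qed.

Let Ca := gamma * (alpha * delta).

Lemma coef_bound y p : @eball R n delta y -> `|coef f hn gamma y p 0| <= Ca.
Proof.
move=> yd; rewrite (le_trans (norm_coef_le _ _ _ _ (ltW gamma0)))//.
rewrite /Ca ler_wpM2l ?(ltW gamma0)//.
have Dy : D y by apply: d'D; rewrite /eball/= (le_trans yd)// ltW.
by rewrite (le_trans (ler_wpM2r (enorm_ge0 y) (Falpha Dy)))// ler_wpM2l.
Qed.

(** [field2] differentiates the first field along the second, so its antisymmetric part is minus the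
    bracket, which the sign of the second-order sum corrects. By [coef_sum] the total is [- gamma y]
    up to the discrepancy in the triple products. *)
Lemma main_term (s A Y3 : R) (y : 'cV[R]_n) c : 0 < s -> s <= 1 -> D y -> 0 <= A ->
  (forall j, `|oamp kj k1 k2 (a2 y) (a3 y) j| <= A) ->
  (forall i j k, `|valong (f k) (valong (f j) (f i)) y c 0| <= Y3) ->
  `|(\sum_(p < #|S1|) a1 y p 0 *: f (enum_val p) y) c 0
    - \sum_nu \sum_mu mean2 kj k1 k2 (a2 y) (a3 y) s nu mu * field2 X nu mu y c 0
    + \sum_nu \sum_mu \sum_la mean3 kj k1 k2 (a2 y) (a3 y) s nu mu la * field3 X nu mu la y c 0
    + gamma * y c 0|
  <= #|osc|%:R * (#|osc|%:R * (#|osc|%:R * (s * (A ^+ 3 * Y3)))).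
Proof.
move=> s0 s1 Dy A0 AB YB.
have alg (u1 u2 u3 t p : R) : u1 - u2 + p = - u3 -> u1 - u2 + t + u3 = t - p by lra.
have sf2 i : vC 2 D (f i) by exact: vC_le (sf i).
have sf1 i : vC 1 D (f i) by exact: vC_le (sf i).
rewrite (second_order_sum nres _ _ s0 (fun i j => valong (f j) (f i) y c 0)).
have := third_order_sum nres s0 s1 (Y := fun i j k => valong (f k) (valong (f j) (f i)) y c 0) A0 AB YB.
set T3 := \sum_nu _; set P3 := \sum_p _ => h3.
have := congr1 (fun M : 'cV[R]_n => M c 0) (coef_sum gamma (Fu Dy)).
have addE (P Q : 'cV[R]_n) : (P + Q) c 0 = P c 0 + Q c 0 by rewrite mxE.
have -> : (- gamma *: y) c 0 = - (gamma * y c 0) by rewrite mxE mulNr.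
rewrite !addE => e.
have e2 : (\sum_(p < #|S2|) a2 y p 0 *: bracket2 f (enum_val p) y) c 0 =
   - \sum_q a2 y q 0 * (valong (f (enum_val q).2) (f (enum_val q).1) y c 0 -
       valong (f (enum_val q).1) (f (enum_val q).2) y c 0).
  rewrite summxE -sumrN; apply: eq_bigr => q _.
  by rewrite mxE /bracket2 (bracketE oD (sf1 _) (sf1 _) Dy) !mxE -mulrN opprB.
have e3 : (\sum_(p < #|S3|) a3 y p 0 *: bracket3 f (enum_val p) y) c 0 = P3.
  rewrite summxE; apply: eq_bigr => p _.
  by rewrite mxE /bracket3 (bracket3E oD (sf2 _) (sf2 _) (sf2 _) Dy) !addE; congr (_ * (_ + _ + _ + _));
    rewrite mxE.
rewrite e2 e3 in e.
suff -> : (\sum_(p < #|S1|) a1 y p 0 *: f (enum_val p) y) c 0 -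
  \sum_q a2 y q 0 * (valong (f (enum_val q).2) (f (enum_val q).1) y c 0 -
       valong (f (enum_val q).1) (f (enum_val q).2) y c 0) + T3 + gamma * y c 0 = T3 - P3 by [].
exact: alg e.
Qed.

(** The constants depend on the gain but not on [s] or [y]. [Lam / s ^+ 4] bounds the velocity, so
    [Lam * s ^+ 2] bounds the excursion over a time [s ^+ 6]. Intervals shorter than a full step are
    included because partial solutions may stop anywhere. *)
Lemma one_step : exists C Lam s0 : R, [/\ 0 <= C, 0 <= Lam, 0 < s0 &
  forall s y, 0 < s <= s0 -> @eball R n delta y ->
    [/\ s <= 1, Lam * s ^+ 2 <= Lam * s,
      forall t z, 0 <= t -> K z -> `|rhs g f t z (ctrl s t y)| <= Lam / s ^+ 4 &
      forall a b x, 0 <= a -> a <= b <= a + s ^+ 6 -> usol s a b y x ->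
        (forall t, a <= t <= b -> K (x t) /\ `|x t - y| <= Lam * s ^+ 2) /\
        (b = a + s ^+ 6 -> forall c,
           `|x b c 0 - y c 0 + s ^+ 6 * (gamma * y c 0)| <= s ^+ 6 * (Mg + C * s))]].
Proof.
have cK : compact K by exact: eball_compact.
have segK : segment_closed K by exact: eball_segment_closed.
have sX (nu : osc) : vC 3 D (X nu) by exact: sf.
have [B [L fb]] := ex_field_bounds oD cK d'D segK sX.
have B0 := fb_B0 fb; have L0 := fb_L0 fb.
have sf0 (t : 'I_m * 'I_n) : sC 1 D (fun y => f t.1 y t.2 0) by exact: sC_le (sf t.1 t.2).
have [Bf Bf0 BfP] := fields_bounded cK d'D sf0.
have [Lf Lf0 LfP] := fields_lipschitz oD cK d'D segK sf0.
have fB i z : K z -> `|f i z| <= Bf.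
  by move=> Kz; apply: norm_le_coord => // c; exact: (BfP (i, c)).
have fL i y z : K y -> K z -> `|f i y - f i z| <= Lf * `|y - z|.
  move=> Ky Kz; apply: norm_le_coord => [|c]; first by rewrite mulr_ge0.
  by rewrite !mxE; exact: (LfP (i, c)).
have s3 (t : 'I_m * 'I_m * 'I_m * 'I_n) :
    sC 1 D (fun y => valong (f t.1.2) (valong (f t.1.1.2) (f t.1.1.1)) y t.2 0).
  apply: (vC_valong oD); first by exact: vC_le (sf _).
  by apply: (vC_valong oD _ (sf _)); exact: vC_le (sf _).
have [Y3 Y30 Y3P] := fields_bounded cK d'D s3.
have Ca0 : 0 <= Ca by rewrite !mulr_ge0// ltW.
have [A A0 AP] := ex_oamp_bound S2 S3 kj k1 k2 Ca0.
pose N : R := #|osc|%:R; pose S : R := #|S1|%:R.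
have N0 : 0 <= N by []. have S0 : 0 <= S by [].
pose M' := Mg + S * (Ca * Bf).
have M'0 : 0 <= M' by rewrite /M'; nonneg.
pose Lam := M' + N * (A * Bf).
have Lam0 : 0 <= Lam by rewrite /Lam; nonneg.
(* [E1] collects the integrated errors of [averaging], [E2] its boundary terms, [E3] the discrepancy
   in the triple products; [E4 * s ^+ 6] will bound [|x b - y|]. *)
pose E1 := S * (Ca * (Lf * Lam)) + N * (A * (B * M')) + N * (N * (A ^+ 2 * (B * M')))
  + N * (N * (A ^+ 2 * (L * Lam))) + N * (N * (N * (A ^+ 3 * (L * Lam)))).
have E10 : 0 <= E1 by rewrite /E1; nonneg.
pose E2 := (N * A + N * (N * A ^+ 2)) * L.
have E20 : 0 <= E2 by rewrite /E2; nonneg.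
pose E3 := N * (N * (N * (A ^+ 3 * Y3))).
have E30 : 0 <= E3 by rewrite /E3; nonneg.
pose E4 := 2 * (gamma * delta + E3 + Mg + E1).
have gd0 : 0 <= gamma * delta by rewrite mulr_ge0// ltW.
have E40 : 0 <= E4 by rewrite /E4; nonneg.
(* Dividing by [n + 1] passes from the max norm to the Euclidean one and is safe for [n = 0]. *)
pose r0 := (d' - delta) / (n%:R + 1).
have n10 : 0 < n%:R + 1 :> R by rewrite ltr_wpDl.
have r00 : 0 < r0 by rewrite divr_gt0// subr_gt0.
(* The three bounds on [s] give [s <= 1], an excursion smaller than [r0], and
   [E2 * s ^+ 2 <= 1 / 2]. *)
exists (E1 + E2 * E4 + E3), Lam, (Num.min 1 (Num.min (r0 / (Lam + 1)) ((2 * (E2 + 1))^-1))).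
have Lam1 : 0 < Lam + 1 by rewrite ltr_wpDl.
have E21 : 0 < 2 * (E2 + 1) by rewrite mulr_gt0// ltr_wpDl.
split => //; first exact: addr_ge0 (addr_ge0 E10 (mulr_ge0 E20 E40)) E30.
  by rewrite !lt_min ltr01 divr_gt0//= invr_gt0.
move=> s y /andP[s0 ]; rewrite !le_min => /and3P[s1 sr sE] yd.
have s0' := ltW s0.
have sn : s != 0 by rewrite gt_eqF.
have ss : s ^+ 2 <= s by rewrite expr2 ler_piMl.
have Ky : K y by apply: le_trans yd (ltW dd').
have Dy : D y by exact: d'D.
have Ls : Lam * s ^+ 2 <= Lam * s by rewrite ler_wpM2l.
have Lr : Lam * s ^+ 2 < r0.
  apply: le_lt_trans Ls _.
  have sr' : s * Lam + s <= r0 by rewrite -[X in _ + X]mulr1 -mulrDr -ler_pdivlMr.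
  by apply: lt_le_trans sr'; rewrite mulrC ltrDl.
have Es : E2 * s ^+ 2 <= 1 / 2.
  rewrite (le_trans (ler_wpM2l E20 ss))// ler_pdivlMr//.
  move: sE; rewrite -[_^-1]mul1r ler_pdivlMr// => sE.
  rewrite (_ : s * (2 * (E2 + 1)) = E2 * s * 2 + 2 * s) in sE; last by ring.
  by rewrite (le_trans _ sE)// lerDl mulr_ge0.
have a1B p : `|a1 y p 0| <= Ca by rewrite !mxE coef_bound.
have a2B q : `|a2 y q 0| <= Ca by rewrite !mxE coef_bound.
have a3B p : `|a3 y p 0| <= Ca by rewrite !mxE coef_bound.
have AB j : `|oamp kj k1 k2 (a2 y) (a3 y) j| <= A by exact: AP.
have s40 : 0 <= (s ^+ 4)^-1 by rewrite invr_ge0 exprn_ge0.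
have betaB j : `|beta s y j| <= (s ^+ 4)^-1 * A.
  rewrite /obeta normrM ler_pM// normrM (ger0_norm s40) ler_piMr//.
  by case: j => [i|[q b]] /=; rewrite ger0_norm.
have s41 : 1 <= (s ^+ 4)^-1 by rewrite invf_ge1 ?exprn_gt0// exprn_ile1.
have GB t z : 0 <= t -> K z ->
    `|g t z + \sum_(p < #|S1|) a1 y p 0 *: f (enum_val p) z| <= M'.
  move=> t0 Kz; rewrite (le_trans (ler_normD _ _))// lerD//.
    by rewrite (le_trans (norm_le_enorm _))// gM.
  rewrite /S -[X in _ <= X%:R * _]card_ord; apply: ler_norm_vec_sum_const => p.
  by rewrite normrZ ler_pM// fB.
have rhsB t z : 0 <= t -> K z -> `|rhs g f t z (ctrl s t y)| <= Lam / s ^+ 4.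
  move=> t0 Kz; rewrite rhs_controlE// (le_trans (ler_normD _ _))// /Lam mulrDl lerD//.
    by rewrite (le_trans (GB _ _ t0 Kz))// ler_peMr.
  rewrite -mulrA; apply: ler_norm_vec_sum_const => j.
  have -> : A * Bf / s ^+ 4 = (s ^+ 4)^-1 * A * Bf by ring.
  by rewrite normrZ ler_pM ?fB// normrM -[leRHS]mulr1 ler_pM ?norm_wave.
split => //.
move=> a b x a0 /andP[ab bs] [xa acx dx].
have near_K z : `|z - y| <= r0 -> K z.
  move=> zy; rewrite /eball/= -[z](subrK y) (le_trans (enormD _ _))//.
  have := enorm_le_norm (z - y); have : n%:R * `|z - y| <= (n%:R + 1) * r0.
    by rewrite ler_pM// lerDl.
  have -> : (n%:R + 1) * r0 = d' - delta by rewrite /r0 mulrC divfK// gt_eqF.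
  have : enorm y <= delta by [].
  move=> h1 h2 h3; have -> : d' = (d' - delta) + delta by rewrite subrK.
  by rewrite lerD// (le_trans h3).
have MbaE : Lam / s ^+ 4 * (b - a) <= Lam * s ^+ 2.
  have -> : Lam * s ^+ 2 = Lam / s ^+ 4 * s ^+ 6 by field.
  by rewrite ler_wpM2l ?mulr_ge0// lerBlDl.
have conf : forall t, a <= t <= b -> `|x t - x a| <= Lam / s ^+ 4 * (t - a).
  apply: (confined (r := r0)) => //; first by rewrite mulr_ge0.
    exact: le_lt_trans MbaE Lr.
  apply: ae_impl dx => t h tab; rewrite xa => ty; exists (rhs g f t (x t) (ctrl s t y)).
    exact: h.
  apply: rhsB; last exact: near_K.
  by case/andP: tab => t1 _; rewrite (le_trans a0)// ltW.
have xy t : a <= t <= b -> `|x t - y| <= Lam * s ^+ 2.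
  move=> /andP[t1 t2]; rewrite -xa (le_trans (conf t _)) ?t1//.
  by rewrite (le_trans _ MbaE)// ler_wpM2l ?mulr_ge0// lerD2r.
have xK t : a <= t <= b -> K (x t).
  by move=> tab; apply: near_K; rewrite (le_trans (xy t tab))// ltW.
split; first by move=> t tab; split; [exact: xK|exact: xy].
move=> bE c.
have eps0 : 0 < s ^+ 6 by rewrite exprn_gt0.
have [W0 W0P] := choice (fun t : osc * osc * osc =>
  mean_of_prim2 eps0 okey ophase t.1.1 t.1.2 t.2).
pose be := beta s y.
pose u j t := be j * wave (s ^+ 6) (okey j) (ophase j) t.
pose U j t := be j * wprim (s ^+ 6) (okey j) (ophase j) t.
pose V nu mu t := be nu * be mu * prim2 (s ^+ 6) okey ophase nu mu t.
pose W nu mu la t := be nu * be mu * be la * W0 (nu, mu, la) t.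
pose m2 := mean2 kj k1 k2 (a2 y) (a3 y) s.
pose m3 := mean3 kj k1 k2 (a2 y) (a3 y) s.
have dscale (c0 t dp : R) (p : R -> R) : is_derive t 1 p dp ->
    is_derive t 1 (fun t => c0 * p t) (c0 * dp).
  move=> h; have := is_derive_mul (is_derive_cst c0 t 1) h.
  by rewrite mul0r add0r.
have lscale (c0 : R) (p : R -> R) : lip a b p -> lip a b (fun t => c0 * p t).
  by move=> h; apply: lip_mul => //; exact: lip_cst.
have wmean0 j : wmean (okey j) (ophase j) = 0 :> R.
  by rewrite /wmean gt_eqF ?mul0r// okey_gt0.
have dU nu (t : R) : is_derive t 1 (U nu) (u nu t).
  have := dscale (be nu) _ _ _ (is_derive_wprim eps0 (okey nu) (ophase nu) t).
  by rewrite wmean0 subr0.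
have dV nu mu (t : R) : is_derive t 1 (V nu mu) (U nu t * u mu t - m2 nu mu).
  have := dscale (be nu * be mu) _ _ _ (is_derive_prim2 eps0 okey ophase nu mu t).
  by move=> H; apply: is_derive_eq H _; rewrite /U /u /m2 /mean2 -/be; ring.
have dW nu mu la (t : R) : is_derive t 1 (W nu mu la) (V nu mu t * u la t - m3 nu mu la).
  have [dW0 _ _] := W0P (nu, mu, la).
  have := dscale (be nu * be mu * be la) _ _ _ (dW0 t).
  by move=> H; apply: is_derive_eq H _; rewrite /V /u /m3 /mean3 -/be; ring.
have lwprim k0 ph : lip a b (wprim (s ^+ 6) k0 ph).
  have d0 := is_derive_wprim eps0 k0 ph; have H := @is_derive_lip R a b 2 _ (fun t => wave (s ^+ 6) k0 ph t - wmean k0 ph) (ler0n R 2) d0.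
  apply: H => t.
  rewrite (le_trans (ler_normB _ _))//.
  by rewrite -[2]/(1 + 1) lerD ?norm_wave ?norm_wmean.
have lU nu : lip a b (U nu) by apply: lscale.
have lV nu mu : lip a b (V nu mu).
  by apply: (lscale (be nu * be mu)); apply: (lscale _); apply: lip_add.
have lW nu mu la : lip a b (W nu mu la).
  have [dW0 _ [C0 C00 CP]] := W0P (nu, mu, la).
  by apply: lscale; apply: is_derive_lip CP.
have eU nu : U nu b = U nu a by rewrite /U bE wprim_period.
have eV nu mu : V nu mu b = V nu mu a by rewrite /V bE prim2_period.
have eW nu mu la : W nu mu la b = W nu mu la a.
  by have [_ pW _] := W0P (nu, mu, la); rewrite /W bE pW.
have bU nu t : `|U nu t| <= A * s ^+ 2.
  have -> : A * s ^+ 2 = (s ^+ 4)^-1 * A * s ^+ 6 by field.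
  by rewrite normrM ler_pM// norm_wprim.
have bbe nu mu : `|be nu * be mu| <= ((s ^+ 4)^-1 * A) * ((s ^+ 4)^-1 * A).
  by rewrite normrM ler_pM.
have bV nu mu t : `|V nu mu t| <= A ^+ 2 * s ^+ 4.
  have -> : A ^+ 2 * s ^+ 4 = ((s ^+ 4)^-1 * A) * ((s ^+ 4)^-1 * A) * (s ^+ 6 * s ^+ 6) by field.
  by rewrite normrM ler_pM// norm_prim2.
have bP nu mu la t : `|V nu mu t * u la t| <= A ^+ 3.
  have -> : A ^+ 3 = A ^+ 2 * s ^+ 4 * ((s ^+ 4)^-1 * A) by field.
  have hu : `|u la t| <= (s ^+ 4)^-1 * A.
    by rewrite /u normrM -[leRHS]mulr1 ler_pM ?norm_wave// betaB.
  by rewrite normrM ler_pM ?bV.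
have bm nu mu : `|m2 nu mu| <= A ^+ 2 by exact: norm_mean2.
(* [g] is left out of the reference velocity: being merely bounded, all of it counts as error, which
   is the origin of [Mg] in [M]. *)
pose G0 : 'cV[R]_n := \sum_(p < #|S1|) a1 y p 0 *: f (enum_val p) y.
pose M := Mg + S * (Ca * (Lf * (Lam * s ^+ 2))).
have M0 : 0 <= M by rewrite /M; nonneg.
have xd : {ae (@lebesgue_measure R), forall t : R, a < t < b -> exists G,
    [/\ is_derive t 1 x (G + \sum_nu u nu t *: X nu (x t)),
        `|G - G0| <= M & `|G| <= M']}.
  apply: ae_impl dx => t h tab; have tab' : a <= t <= b by case/andP: tab => ? ?; rewrite !ltW.
  have t0 : 0 <= t by rewrite (le_trans a0)//; case/andP: tab'.
  exists (g t (x t) + \sum_(p < #|S1|) a1 y p 0 *: f (enum_val p) (x t)); split.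
  - by have := h tab; rewrite rhs_controlE.
  - rewrite /G0 -addrA -sumrB (le_trans (ler_normD _ _))// lerD//.
      exact: le_trans (norm_le_enorm _) (gM t0 (xK _ tab')).
    rewrite /S -[X in _ <= X%:R * _]card_ord; apply: ler_norm_vec_sum_const => p.
    rewrite -scalerBr normrZ ler_pM// (le_trans (fL _ _ _ (xK _ tab') Ky))//.
    by rewrite ler_wpM2l// xy.
  - by apply: GB => //; exact: xK.
have Lx s' t : a <= s' <= b -> a <= t <= b -> `|x t - x s'| <= Lam / s ^+ 4 * `|t - s'|.
  have Lx' s1' t' : a <= s1' -> s1' <= t' -> t' <= b -> `|x t' - x s1'| <= Lam / s ^+ 4 * (t' - s1').
    move=> h1 h2 h3; apply: vec_increment_le => //; first by rewrite mulr_ge0.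
      exact: abs_cont_sub acx.
    apply: ae_impl dx => v h /andP[v1 v2]; exists (rhs g f v (x v) (ctrl s v y)).
      by apply: h; rewrite (le_lt_trans h1 v1) (lt_le_trans v2).
    apply: rhsB; first by rewrite (le_trans a0)// (le_trans h1)// ltW.
    by apply: xK; rewrite (le_trans h1 (ltW v1)) (le_trans (ltW v2)).
  move=> /andP[h1 h2] /andP[h3 h4]; have [st|ts] := leP s' t.
    by rewrite ger0_norm ?subr_ge0// Lx'.
  by rewrite distrC [`|t - s'|]distrC ger0_norm ?subr_ge0 ?(ltW ts)// Lx'// ltW.
have xr t : a <= t <= b -> `|x t - x a| <= Lam * s ^+ 2 by rewrite xa; exact: xy.
have avg := averaging oD d'D sX fb ab xK (mulr_ge0 Lam0 s40) Lx xr M0 M'0 xd dU dV dW lU lV lW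
  eU eV eW bU bV bP bm _ (erefl N).
have mt c0 : `|G0 c0 0 - \sum_nu \sum_mu m2 nu mu * field2 X nu mu y c0 0
    + \sum_nu \sum_mu \sum_la m3 nu mu la * field3 X nu mu la y c0 0
    + gamma * y c0 0| <= s * E3.
  have -> : s * E3 = N * (N * (N * (s * (A ^+ 3 * Y3)))) by rewrite /E3; ring.
  apply: main_term => // i j k.
  exact: (Y3P (i, j, k, c0)).
have ba : b - a = s ^+ 6 by rewrite bE addrC addKr.
pose e1 := S * (Ca * (Lf * Lam)) + N * (A * (B * M')) + N * (N * (A ^+ 2 * (L * Lam)))
  + N * (N * (N * (A ^+ 3 * (L * Lam)))).
pose e2 := N * (N * (A ^+ 2 * (B * M'))).
have e10 : 0 <= e1 by rewrite /e1; nonneg.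
have e20 : 0 <= e2 by rewrite /e2; nonneg.
have s4s : s ^+ 4 <= s ^+ 2 by rewrite -[4%N]/(2 + 2)%N exprD ler_piMr ?sqr_ge0// exprn_ile1.
have EB : M + N * (A * s ^+ 2 * (B * M')) + N * (N * (A ^+ 2 * s ^+ 4 * (B * M')))
    + N * (N * (A ^+ 2 * (L * (Lam * s ^+ 2)))) + N * (N * (N * (A ^+ 3 * (L * (Lam * s ^+ 2)))))
    <= Mg + E1 * s.
  have -> : E1 * s = e1 * s + e2 * s by rewrite /E1 /e1 /e2; ring.
  rewrite [leLHS](_ : _ = Mg + (e1 * s ^+ 2 + e2 * s ^+ 4)); last by rewrite /M /e1 /e2; ring.
  by rewrite lerD2l lerD// ler_wpM2l// (le_trans s4s).
pose De := `|x b - y|.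
have De0 : 0 <= De by exact: normr_ge0.
have E2B : (N * (A * s ^+ 2) + N * (N * (A ^+ 2 * s ^+ 4))) * (L * De) <= E2 * s ^+ 2 * De.
  rewrite (mulrA _ L De) ler_wpM2r// /E2 (mulrAC _ L (s ^+ 2)) ler_wpM2r//.
  rewrite [leRHS]mulrDl lerD//; first by rewrite mulrA.
  rewrite -(mulrA N) -(mulrA N) ler_wpM2l// ler_wpM2l// ler_wpM2l//.
  exact: sqr_ge0.
pose main c0 := G0 c0 0 - \sum_nu \sum_mu m2 nu mu * field2 X nu mu y c0 0
    + \sum_nu \sum_mu \sum_la m3 nu mu la * field3 X nu mu la y c0 0.
have avgc c0 : `|x b c0 0 - y c0 0 - s ^+ 6 * main c0| <= s ^+ 6 * (Mg + E1 * s) + E2 * s ^+ 2 * De.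
  have := avg c0; rewrite ba xa => /le_trans; apply.
  by rewrite lerD ?ler_wpM2l// ltW.
have mainB c0 : `|main c0| <= gamma * delta + E3.
  rewrite -[main c0](addrK (gamma * y c0 0)) addrC (le_trans (ler_normD _ _))// lerD//.
    rewrite normrN normrM (ger0_norm (ltW gamma0)) ler_wpM2l ?(ltW gamma0)//.
    exact: le_trans (coord_le_enorm _ _) yd.
  by rewrite (le_trans (mt c0))// ler_piMl.
(* The boundary terms are at most [E2 * s ^+ 2 * De], and the known [De <= Lam * s ^+ 2] would leave
   [s ^+ 4], too much against [s ^+ 6]. The estimate is therefore applied to itself: half of [De] is
   absorbed, and [De] improves to order [s ^+ 6]. *)
have DeQ : De <= s ^+ 6 * (gamma * delta + E3 + Mg + E1) + E2 * s ^+ 2 * De.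
  have Q0 : 0 <= s ^+ 6 * (gamma * delta + E3 + Mg + E1) + E2 * s ^+ 2 * De.
    apply: addr_ge0; last by apply: mulr_ge0 => //; apply: mulr_ge0 => //; exact: sqr_ge0.
    by apply: mulr_ge0; [exact: ltW|exact: addr_ge0 (addr_ge0 (addr_ge0 gd0 E30) Mg0) E10].
  apply: norm_le_coord Q0 _ => c0; rewrite !mxE.
  rewrite -[x b c0 0 - y c0 0](subrK (s ^+ 6 * main c0)) (le_trans (ler_normD _ _))//.
  rewrite (le_trans (lerD (avgc c0) (lexx _)))// addrAC lerD2r normrM (ger0_norm (ltW eps0)).
  rewrite -mulrDr ler_wpM2l ?(ltW eps0)// addrC -addrA lerD// lerD2l.
  by rewrite ler_piMr.
have DeB : De <= s ^+ 6 * E4.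
  have h : E2 * s ^+ 2 * De <= 1 / 2 * De by rewrite ler_wpM2r.
  exact: absorb_half DeQ h.
have -> : x b c 0 - y c 0 + s ^+ 6 * (gamma * y c 0) =
    (x b c 0 - y c 0 - s ^+ 6 * main c) + s ^+ 6 * (main c + gamma * y c 0) by ring.
rewrite (le_trans (ler_normD _ _))//.
rewrite (le_trans (lerD (avgc c) (lexx _)))// normrM (ger0_norm (ltW eps0)).
have h1 : E2 * s ^+ 2 * De <= s ^+ 6 * (E2 * E4 * s).
  have -> : s ^+ 6 * (E2 * E4 * s) = E2 * s * (s ^+ 6 * E4) by ring.
  apply: ler_pM => //; last by apply: ler_wpM2l.
  by apply: mulr_ge0 => //; exact: sqr_ge0.
have h2 : s ^+ 6 * `|main c + gamma * y c 0| <= s ^+ 6 * (s * E3).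
  by rewrite ler_wpM2l ?(ltW eps0)//; exact: mt.
have -> : s ^+ 6 * (Mg + (E1 + E2 * E4 + E3) * s) =
    s ^+ 6 * (Mg + E1 * s) + s ^+ 6 * (E2 * E4 * s) + s ^+ 6 * (s * E3) by ring.
by rewrite lerD// lerD2l.
Qed.

End Step.

(** * Global existence *)

Lemma ae_forall_nat (R : realType) (P : nat -> R -> Prop) :
  (forall j, {ae (@lebesgue_measure R), forall t, P j t}) ->
  {ae (@lebesgue_measure R), forall t, forall j, P j t}.
Proof.
move=> h; apply: negligibleS (negligible_bigcup h) => t /= /existsNP[j nP].
by exists j.
Qed.

Lemma ae_and (R : realType) (P Q : R -> Prop) :
  {ae (@lebesgue_measure R), forall t, P t} -> {ae (@lebesgue_measure R), forall t, Q t} ->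
  {ae (@lebesgue_measure R), forall t, P t /\ Q t}.
Proof.
move=> hP hQ; apply: negligibleS (negligibleU hP hQ) => t /= /not_andP[]; by [left|right].
Qed.

Lemma ae_neq (R : realType) (c : R) : {ae (@lebesgue_measure R), forall t, t != c}.
Proof.
exists [set c]; split => //; first exact: lebesgue_measure_set1.
by move=> t /= /negP/negPn/eqP.
Qed.

(** The glued function at [u] is [x (lo u) + z (hi u) - z c]. Clamping all intervals to either side
    of [c] thus treats those that straddle [c] like the others. *)
Lemma abs_cont_glue (R : realType) n (a c b : R) (x z : R -> 'cV[R]_n) :
  a <= c -> c <= b -> abs_cont a c x -> abs_cont c b z -> x c = z c ->
  abs_cont a b (fun t => if t <= c then x t else z t).
Proof.
move=> ac cb hx hz xz e e0.
have e20 : 0 < e / 2 by rewrite divr_gt0.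
have [d1 d10 d1P] := hx _ e20; have [d2 d20 d2P] := hz _ e20.
exists (Num.min d1 d2); first by rewrite lt_min d10.
move=> N s t st dis; rewrite lt_min => /andP[lt1 lt2].
pose lo (u : R) := Num.min u c; pose hi (u : R) := Num.max u c.
have loM u v : u <= v -> lo u <= lo v by move=> uv; rewrite /lo le_min !ge_min uv lexx orbT.
have hiM u v : u <= v -> hi u <= hi v by move=> uv; rewrite /hi ge_max !le_max uv lexx orbT.
have lohi u : lo u + hi u = u + c by rewrite /lo /hi addr_min_max.
have len_lo i : lo (t i) - lo (s i) <= t i - s i.
  have [_ sti _] := st i; have := hiM _ _ sti; have := lohi (t i); have := lohi (s i).
  by move: (lo _) (hi _) (lo _) (hi _) => p q p' q'; lra.
have len_hi i : hi (t i) - hi (s i) <= t i - s i.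
  have [_ sti _] := st i; have := loM _ _ sti; have := lohi (t i); have := lohi (s i).
  by move: (lo _) (hi _) (lo _) (hi _) => p q p' q'; lra.
have h1 : \sum_(i < N) enorm (x (lo (t i)) - x (lo (s i))) < e / 2.
  apply: d1P.
  - move=> i; have [as_ sti tb] := st i; split; [|exact: loM|by rewrite /lo ge_min lexx orbT].
    by rewrite /lo le_min as_.
  - by move=> i j /dis[] /loM; [left|right].
  - by apply: le_lt_trans lt1; apply: ler_sum => i _.
have h2 : \sum_(i < N) enorm (z (hi (t i)) - z (hi (s i))) < e / 2.
  apply: d2P.
  - move=> i; have [as_ sti tb] := st i; split; [by rewrite /hi le_max lexx orbT|exact: hiM|].
    by rewrite /hi ge_max tb.
  - by move=> i j /dis[] /hiM; [left|right].
  - by apply: le_lt_trans lt2; apply: ler_sum => i _.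
rewrite [e]splitr; apply: le_lt_trans (ltrD h1 h2); rewrite -big_split/=.
apply: ler_sum => i _; apply: le_trans (enormD _ _).
have clampE u : (if u <= c then x u else z u) = x (lo u) + z (hi u) - z c.
  rewrite /lo /hi; case: (leP u c) => uc; first by rewrite addrK.
  by rewrite xz addrAC subrr add0r.
rewrite !clampE le_eqVlt; apply/orP; left; apply/eqP; congr enorm.
by rewrite opprB addrA subrK opprD addrACA.
Qed.

(** [p t + M * t] is nondecreasing and bounded, so its supremum determines the limit. *)
Lemma lip_left_limit (R : realType) (p : R -> R) (M T : R) : 0 < T -> 0 <= M ->
  (forall s t, 0 <= s -> s <= t -> t < T -> `|p t - p s| <= M * (t - s)) ->
  exists l, forall t, 0 <= t < T -> `|l - p t| <= M * (T - t).
Proof.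
move=> T0 M0 pM; pose S := [set p t + M * t | t in [set t | 0 <= t < T]].
have key t : 0 <= t < T -> ubound S (p t + M * (T - t) + M * T).
  move=> /andP[t0 tT] _ [s /andP[s0 sT] <-].
  have MsT : M * s <= M * T by rewrite ler_wpM2l// ltW.
  have MtT : M * t <= M * T by rewrite ler_wpM2l// ltW.
  rewrite !mulrBr; have [st|/ltW ts] := leP s t.
    have := pM _ _ s0 st tT; rewrite ler_norml => /andP[+ _]; rewrite mulrBr.
    by move: (p s) (p t) (M * s) (M * t) (M * T) MsT MtT => a b c d e; lra.
  have := pM _ _ t0 ts sT; rewrite ler_norml => /andP[_]; rewrite mulrBr.
  by move: (p s) (p t) (M * s) (M * t) (M * T) MsT MtT => a b c d e; lra.
have S0 : S !=set0 by exists (p 0 + M * 0), 0 => //=; rewrite lexx.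
have supS : has_sup S.
  by split => //; exists (p 0 + M * (T - 0) + M * T); apply: key; rewrite lexx.
exists (sup S - M * T) => t tT.
have u1 := ge_sup S0 (key t tT).
have u2 : p t + M * t <= sup S by apply: sup_upper_bound => //; exists t.
move: u1 u2; rewrite !mulrBr ler_norml => u1 u2; apply/andP; split.
  by move: (p t) (M * t) (M * T) (sup S) u1 u2 => a b c d; lra.
by move: (p t) (M * t) (M * T) (sup S) u1 u2 => a b c d; lra.
Qed.

Section Existence.
Context (R : realType) (n m : nat) (D : set 'cV[R]_n)
  (g : R -> 'cV[R]_n -> 'cV[R]_n) (f : 'I_m -> 'cV[R]_n -> 'cV[R]_n)
  (h : R -> 'cV[R]_n -> 'cV[R]_m) (eps Lam d' : R) (x0 : 'cV[R]_n).

(** A solution up to time [T]. The equation is required only for [0 < t < T], since a two-sided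
    derivative at [T] would depend on values beyond [T]. *)
Definition psol (T : R) (x : R -> 'cV[R]_n) :=
  [/\ x 0 = x0, abs_cont 0 T x, forall t, 0 <= t <= T -> D (x t) &
    forall j : nat, {ae (@lebesgue_measure R), forall t : R,
      eps * j%:R <= t < eps * j.+1%:R -> 0 < t < T ->
      is_derive t 1 x (rhs g f t (x t) (h t (x (eps * j%:R))))}].

Hypotheses (eps0 : 0 < eps) (sol : locally_solvable D g f)
  (hc : forall y, continuous (h ^~ y)) (Dx0 : D x0) (d'D : @eball R n d' `<=` D)
  (Lam0 : 0 <= Lam)
  (apriori : forall T x, 0 <= T -> psol T x ->
    (forall t, 0 <= t <= T -> @eball R n d' (x t)) /\
    forall s t, 0 <= s -> s <= t -> t <= T -> `|x t - x s| <= Lam * (t - s)).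

Lemma sample_index (t : R) : 0 <= t ->
  exists j : nat, eps * j%:R <= t < eps * j.+1%:R.
Proof.
move=> t0; have te : 0 <= t / eps by rewrite divr_ge0// ltW.
exists (Num.truncn (t / eps)).
have /andP[h1 h2] := truncn_itv te.
by rewrite mulrC -ler_pdivlMr// h1 [eps * _]mulrC -ltr_pdivrMr// h2.
Qed.

Lemma sample_index_uniq (t t' : R) (i j : nat) : t <= t' ->
  eps * i%:R <= t -> t < eps * i.+1%:R -> eps * j%:R <= t' -> t' < eps * i.+1%:R ->
  t' < eps * j.+1%:R -> i = j.
Proof.
move=> tt h1 h2 h3 h4 h5; apply/eqP; rewrite eqn_leq; apply/andP; split; rewrite -ltnS.
  by rewrite -(ltr_nat R) -(ltr_pM2l eps0); apply: le_lt_trans h1 (le_lt_trans tt h5).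
by rewrite -(ltr_nat R) -(ltr_pM2l eps0); apply: le_lt_trans h3 h4.
Qed.

Definition extends (T : R) (x : R -> 'cV[R]_n) (T' : R) (x' : R -> 'cV[R]_n) :=
  T <= T' /\ forall t, t <= T -> x' t = x t.

Lemma psol_extend T x : 0 <= T -> psol T x ->
  exists T' x', [/\ T < T', psol T' x' & extends T x T' x'].
Proof.
move=> T0 [x0E acx Dx dx].
have [j /andP[j1 j2]] := sample_index T0.
have DT : D (x T) by apply: Dx; rewrite T0 lexx.
have [r [z [r0 zT Dz acz dz]]] := sol T0 DT (@hc (x (eps * j%:R))).
(* The extension stops at the next sampling time, beyond which the control is computed from a new
   sample. *)
pose r' := Num.min r (eps * j.+1%:R - T).
have r'0 : 0 < r' by rewrite lt_min r0 subr_gt0.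
have r'r : T + r' <= T + r by rewrite lerD2l ge_min lexx.
have r'j : T + r' <= eps * j.+1%:R by rewrite -lerBrDl ge_min lexx orbT.
pose x' t := if t <= T then x t else z t.
have x'x t : t <= T -> x' t = x t by rewrite /x' => ->.
have x'z t : T < t -> x' t = z t by rewrite /x' leNgt => ->.
exists (T + r'), x'; split; [by rewrite ltrDl| |by split => //; rewrite lerDl ltW].
split.
- by rewrite x'x.
- by apply: abs_cont_glue => //; [rewrite lerDl ltW|exact: abs_cont_sub acz].
- move=> t /andP[t0 tT]; have [tT'|Tt] := leP t T; first by rewrite x'x//; apply: Dx; rewrite t0.
  by rewrite x'z//; apply: Dz; rewrite (ltW Tt) (le_trans tT).
move=> i; have H := ae_and (dx i) (ae_and dz (ae_neq T)).
apply: ae_impl H => t [h1 [h2 tT]] /[dup] it /andP[i1 i2] /andP[t0 tTr].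
have [ltT|leT] := ltP t T.
  rewrite (x'x t (ltW ltT)) (x'x (eps * i%:R) (le_trans i1 (ltW ltT))).
  have := h1 it; rewrite t0 ltT => /(_ isT); apply: near_eq_is_derive.
  near=> u; rewrite x'x// ltW//; near: u; exact: lt_nbhsl.
have Tt : T < t by rewrite lt_neqAle eq_sym tT leT.
have ij : j = i by apply: (sample_index_uniq leT) => //; exact: lt_le_trans tTr r'j.
rewrite -ij (x'z t Tt) (x'x (eps * j%:R) j1).
have := h2; rewrite leT (ltW (lt_le_trans tTr r'r)) => /(_ isT); apply: near_eq_is_derive.
near=> u; rewrite x'z//; near: u; exact: lt_nbhsr.
Unshelve. all: by end_near. Qed.

(* The extension takes at least half of the largest possible length, so that iterating it can only stop at a maximal solution. *)
Lemma psol_greedy T x : 0 <= T -> psol T x ->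
  exists T' x', [/\ T < T', psol T' x', extends T x T' x' &
    T + 1 <= T' \/ forall T'' x'', psol T'' x'' -> extends T x T'' x'' ->
      T'' - T <= 2 * (T' - T)].
Proof.
move=> T0 px; have [T1 [x1 [TT1 px1 ex1]]] := psol_extend T0 px.
(* An extension by at least one is accepted at once; otherwise all extensions are shorter and the
   supremum below is finite. *)
have [[T' [x' [px' ex' T'1]]]|no] := pselect (exists T' x',
    [/\ psol T' x', extends T x T' x' & T + 1 <= T']).
  by exists T', x'; split=> //; [rewrite (lt_le_trans _ T'1)// ltrDl|left].
pose S := [set T' | exists x', psol T' x' /\ extends T x T' x'].
have S1 : S T1 by exists x1.
have supS : has_sup S.
  split; first by exists T1.
  exists (T + 1) => T' [x' [px' ex']]; rewrite leNgt; apply/negP => /ltW lt1.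
  by apply: no; exists T', x'.
have T1S : T1 <= sup S by exact: sup_upper_bound.
have e0 : 0 < (sup S - T) / 2 by rewrite divr_gt0// subr_gt0 (lt_le_trans TT1).
have [T' [x' [px' ex']] T'S] := sup_adherent e0 supS.
exists T', x'; split=> //; first by move: T'S T1S TT1 e0; move: (sup S) => z; lra.
right=> T'' x'' px'' ex''.
have : T'' <= sup S by apply: sup_upper_bound => //; exists x''.
by move: T'S; move: (sup S) => z; lra.
Qed.

Lemma psol_chain : exists (T : nat -> R) (x : nat -> R -> 'cV[R]_n),
  [/\ forall k, 0 <= T k, forall k, psol (T k) (x k), forall k, T k < T k.+1,
    forall k, extends (T k) (x k) (T k.+1) (x k.+1) &
    forall k, T k + 1 <= T k.+1 \/
      forall T'' x'', psol T'' x'' -> extends (T k) (x k) T'' x'' ->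
        T'' - T k <= 2 * (T k.+1 - T k)].
Proof.
have base : 0 <= 0 :> R /\ psol 0 (fun=> x0).
  split=> //; split=> //.
    by apply: (@lip_abs_cont _ _ _ _ 0) => // s t _ _ _; rewrite subrr normr0 mul0r.
  by move=> j; apply: aeW => t _ /andP[t1 t2]; have := lt_trans t1 t2; rewrite ltxx.
pose st := {p : R * (R -> 'cV[R]_n) | 0 <= p.1 /\ psol p.1 p.2}.
have next (p : st) : exists q : st, let: (T, x) := sval p in let: (T', x') := sval q in
    [/\ T < T', extends T x T' x' & T + 1 <= T' \/ forall T'' x'', psol T'' x'' ->
      extends T x T'' x'' -> T'' - T <= 2 * (T' - T)].
  case: p => -[T x] /= [T0 px]; have [T' [x' [TT' px' ex' gr]]] := psol_greedy T0 px.
  have q0 : 0 <= (T', x').1 /\ psol (T', x').1 (T', x').2.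
    by split=> //=; rewrite (le_trans T0 (ltW TT')).
  by exists (exist _ (T', x') q0).
have [F FP] := choice next.
pose s k := iter k F (exist _ (0, fun=> x0) base : st).
have sP k := svalP (s k); have sF k := FP (s k).
exists (fun k => (sval (s k)).1), (fun k => (sval (s k)).2).
split=> k.
- by have [] := sP k.
- by have [] := sP k.
- by have := sF k; rewrite -[F (s k)]/(s k.+1); case: (sval _) (sval _) => ? ? [? ?] [].
- by have := sF k; rewrite -[F (s k)]/(s k.+1); case: (sval _) (sval _) => ? ? [? ?] [].
- by have := sF k; rewrite -[F (s k)]/(s k.+1); case: (sval _) (sval _) => ? ? [? ?] [].
Qed.

Lemma psol_eq T x y : 0 <= T -> (forall t, t <= T -> y t = x t) -> psol T x -> psol T y.
Proof.
move=> T0 yx [x0E acx Dx dx]; split.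
- by rewrite yx.
- move=> e e0; have [d d0 dP] := acx e e0; exists d => // N s t st dis lt_d.
  apply: le_lt_trans (dP N s t st dis lt_d); apply: ler_sum => i _.
  by have [h1 h2 h3] := st i; rewrite !yx// (le_trans h2).
- by move=> t /[dup] /andP[_ tT] /Dx; rewrite yx.
move=> j; apply: ae_impl (dx j) => t H /[dup] /andP[j1 _] /H{}H /[dup] /andP[_ tT] /H.
rewrite (yx t (ltW tT)) (yx (eps * j%:R) (le_trans j1 (ltW tT))).
apply: near_eq_is_derive; near=> u; rewrite yx// ltW//; near: u; exact: lt_nbhsl.
Unshelve. all: by end_near. Qed.

(** The a priori Lipschitz bound provides a limit at [T], and the closed ball keeps it inside [D],
    so a solution on the half-open interval closes up. *)
Lemma psol_limit (T : R) (x : R -> 'cV[R]_n) (Tk : nat -> R) : 0 < T ->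
  (forall k, 0 <= Tk k < T) -> (forall t, t < T -> exists k, t < Tk k) ->
  (forall k, psol (Tk k) x) -> exists y, psol T y /\ forall t, t < T -> y t = x t.
Proof.
move=> T0 TkT cof px.
have xL s t : 0 <= s -> s <= t -> t < T -> `|x t - x s| <= Lam * (t - s).
  move=> s0 st /cof[k tk]; have /andP[k0 _] := TkT k.
  by apply: (apriori k0 (px k)).2 => //; exact: ltW.
have xB t : 0 <= t < T -> @eball R n d' (x t).
  move=> /andP[t0 /cof[k tk]]; have /andP[k0 _] := TkT k.
  by apply: (apriori k0 (px k)).1; rewrite t0 ltW.
have lim c : exists l, forall t, 0 <= t < T -> `|l - x t c 0| <= Lam * (T - t).
  apply: lip_left_limit => // s t s0 st tT; have := xL _ _ s0 st tT.
  by apply: le_trans; rewrite (le_trans _ (coord_le_norm _ c))// !mxE.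
have [l lP] := choice lim.
pose L : 'cV[R]_n := \col_c l c.
have LP t : 0 <= t < T -> `|L - x t| <= Lam * (T - t).
  move=> tT; apply: norm_le_coord => [|c]; last by rewrite !mxE lP.
  by case/andP: tT => _ tT; rewrite mulr_ge0// subr_ge0 ltW.
have LB : @eball R n d' L.
  apply/ler_addgt0Pr => e e0.
  have nL : 0 < n%:R * Lam + 1 :> R by rewrite ltr_wpDl// mulr_ge0.
  pose t := Num.max 0 (T - e / (n%:R * Lam + 1)).
  have tT : 0 <= t < T by rewrite le_max lexx gt_max T0 gtrBl divr_gt0.
  rewrite -(subrK (x t) L) addrC (le_trans (enormD _ _))// lerD//; first exact: xB.
  rewrite (le_trans (enorm_le_norm _))//.
  apply: (@le_trans _ _ (n%:R * (Lam * (T - t)))); first by rewrite ler_wpM2l// LP.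
  have Tt : T - t <= e / (n%:R * Lam + 1) by rewrite lerBlDr -lerBlDl le_max lexx orbT.
  rewrite mulrA; apply: (@le_trans _ _ ((n%:R * Lam + 1) * (T - t))).
    by rewrite ler_wpM2r ?lerDl// subr_ge0 ltW//; case/andP: tT.
  by rewrite mulrC -ler_pdivlMr.
pose y t := if t < T then x t else L.
have yx t : t < T -> y t = x t by rewrite /y => ->.
have yT t : T <= t -> y t = L by rewrite /y ltNge => ->.
exists y; split=> //; split.
- by rewrite yx//; have [] := px 0%N.
- apply: (@lip_abs_cont _ _ _ _ Lam) => // s t /andP[s0 sT] /andP[t0 tT] st.
  have [tT'|Tt] := ltP t T; first by rewrite !yx// ?xL// (le_lt_trans st).
  have -> : t = T by apply/eqP; rewrite eq_le tT.
  rewrite (yT T)//; have [sT'|Ts] := ltP s T; first by rewrite yx// LP// s0.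
  by rewrite yT// subrr normr0 mulr_ge0// subr_ge0.
- move=> t /andP[t0 tT]; have [tT'|Tt] := ltP t T.
    by rewrite yx//; apply: d'D; apply: xB; rewrite t0.
  by rewrite yT//; exact: d'D.
move=> j; have H : {ae (@lebesgue_measure R), forall t, forall k,
    eps * j%:R <= t < eps * j.+1%:R -> 0 < t < Tk k ->
    is_derive t 1 x (rhs g f t (x t) (h t (x (eps * j%:R))))}.
  by apply: ae_forall_nat => k; have [_ _ _] := px k.
apply: ae_impl H => t H jt /andP[t0 tT]; have [k tk] := cof _ tT.
have := H k jt; rewrite t0 tk => /(_ isT); case/andP: jt => j1 _.
rewrite (yx t tT) (yx (eps * j%:R) (le_lt_trans j1 tT)).
apply: near_eq_is_derive; near=> u; rewrite yx//; near: u; exact: lt_nbhsl.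
Unshelve. all: by end_near. Qed.

(** If the times of the greedy chain stayed bounded, the limit at their supremum [Ts] would extend
    to some [T' > Ts]. This extension competes at every stage, so every step would exceed a fixed
    length, a contradiction. *)
Lemma psol_global : exists x, pi_solution D g f h eps x0 x.
Proof.
have [T [x [T0 px TS ex gr]]] := psol_chain.
have exD i k : extends (T i) (x i) (T (i + k)%N) (x (i + k)%N).
  elim: k => [|k [IH1 IH2]]; first by rewrite addn0; split.
  rewrite addnS; have [e1 e2] := ex (i + k)%N; split; first exact: le_trans e1.
  by move=> t ti; rewrite e2 ?IH2// (le_trans ti).
(* Any stage that covers [t] gives the same value; the default stage 0 is taken only at times that
   no stage covers. *)
pose y t := x (xget 0%N [set k | t <= T k]) t.
have yx k t : t <= T k -> y t = x k t.
  move=> tk; rewrite /y; have : t <= T (xget 0%N [set k | t <= T k]).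
    exact: (@xgetPex _ 0%N [set k | t <= T k] (ex_intro _ k tk)).
  move: (xget _ _) => i ti; have [ik|/ltnW ki] := leqP i k.
    by rewrite -(subnKC ik) (exD i _).2.
  by rewrite -(subnKC ki) (exD k _).2.
have py k : psol (T k) y by apply: psol_eq (px k) => // t; exact: yx.
have TM : {homo T : i j / (i <= j)%N >-> i <= j}.
  by move=> i j ij; rewrite -(subnKC ij); exact: (exD _ _).1.
have [bnd|unb] := pselect (exists B, forall k, T k <= B); last first.
  have cof t : exists k, t < T k.
    by apply: contrapT => /forallNP no; apply: unb; exists t => k; rewrite leNgt; apply/negP.
  exists y; split.
  - by have [] := py 0%N.
  - move=> t t0; have [k tk] := cof t; have [_ _ + _] := py k.
    by apply; rewrite t0 ltW.
  - move=> t t0; have [k tk] := cof t; have [_ + _ _] := py k.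
    by apply: abs_cont_sub => //; exact: ltW.
  move=> j; have H : {ae (@lebesgue_measure R), forall t, forall k,
      eps * j%:R <= t < eps * j.+1%:R -> 0 < t < T k ->
      is_derive t 1 y (rhs g f t (y t) (h t (y (eps * j%:R))))}.
    by apply: ae_forall_nat => k; have [_ _ _] := py k.
  (* [psol] imposes no equation at time 0, which belongs to the first sampling interval. *)
  apply: ae_impl (ae_and H (ae_neq 0)) => t [{}H t0] jt; have [k tk] := cof t.
  apply: (H k) => //; rewrite tk andbT lt_neqAle eq_sym t0.
  by case/andP: jt => + _; apply: le_trans; rewrite mulr_ge0// ltW.
have supT : has_sup (range T).
  by split; [exists (T 0%N), 0%N|case: bnd => B TB; exists B => _ [k _ <-]].
pose Ts := sup (range T).
have TTs k : T k < Ts.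
  by apply: lt_le_trans (TS k) _; apply: sup_upper_bound => //; exists k.+1.
have cof t : t < Ts -> exists k, t < T k.
  move=> tT; have tT0 : 0 < Ts - t by rewrite subr_gt0.
  by have [_ [k _ <-]] := sup_adherent tT0 supT; rewrite -/Ts subKr => tk; exists k.
have Ts0 : 0 < Ts by exact: le_lt_trans (TTs 0%N).
have [z [pz zy]] := psol_limit Ts0 (fun k => introT andP (conj (T0 k) (TTs k))) cof py.
have [T' [x' [TsT' px' [_ ex']]]] := psol_extend (ltW Ts0) pz.
have exk k : extends (T k) (x k) T' x'.
  split; first by rewrite (ltW (lt_trans (TTs k) TsT')).
  by move=> t tk; have tTs := le_lt_trans tk (TTs k); rewrite ex' ?ltW// zy// (yx k).
(* The two alternatives of the greedy rule: a step of length one, or at least half of [T' - T k],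
   which exceeds [T' - Ts]. *)
pose r := Num.min 1 ((T' - Ts) / 2).
have r0 : 0 < r by rewrite lt_min ltr01 divr_gt0// subr_gt0.
have step k : T k + r <= T k.+1.
  have r1 : r <= 1 by rewrite ge_min lexx.
  have r2 : r <= (T' - Ts) / 2 by rewrite ge_min lexx orbT.
  have := TTs k; case: (gr k) => [|/(_ _ _ px' (exk k))]; move: r1 r2.
    by rewrite -/r; clearbody r; lra.
  by move: (T k) (T k.+1) (Ts) => b c d; clearbody r; lra.
have lin k : r * k%:R <= T k.
  elim: k => [|k IH]; first by rewrite mulr0.
  by rewrite (le_trans _ (step k))// -natr1 mulrDr mulr1 lerD2r.
have /andP[_ ] := truncn_itv (divr_ge0 (ltW Ts0) (ltW r0)).
rewrite ltr_pdivrMr// mulrC => Tsk.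
by have := lt_trans (le_lt_trans (lin (Num.truncn (Ts / r)).+1) (TTs _)) Tsk; rewrite ltxx.
Qed.

End Existence.

(** * Decay *)

Lemma expRN_lip (R : realType) (a b : R) : 0 <= a -> a <= b ->
  expR (- a) <= expR (- b) + (b - a).
Proof.
move=> a0 ab; have -> : - b = - a + (a - b) by ring.
have h1 : expR (- a) <= 1 by rewrite -expR0 ler_expR oppr_le0.
have h2 := expR_ge1Dx (a - b); have h3 := expR_gt0 (- a).
rewrite expRD; apply: (@le_trans _ _ (expR (- a) * (1 + (a - b)) + (b - a))).
  have : 0 <= (1 - expR (- a)) * (b - a) by rewrite mulr_ge0 ?subr_ge0.
  by move: (expR (- a)) => e; lra.
by rewrite lerD2r ler_wpM2l// ltW.
Qed.

Lemma pow_le_expR (R : realType) (q : R) (j : nat) : 0 <= q <= 1 ->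
  (1 - q) ^+ j <= expR (- (q * j%:R)).
Proof.
move=> /andP[q0 q1]; rewrite -mulNr mulrC expRM_natl.
by rewrite lerXn2r ?nnegrE ?subr_ge0 ?expR_ge0// expR_ge1Dx.
Qed.

Section Decay.
Context (R : realType) (n m : nat) (D : set 'cV[R]_n)
  (g : R -> 'cV[R]_n -> 'cV[R]_n) (f : 'I_m -> 'cV[R]_n -> 'cV[R]_n)
  (h : R -> 'cV[R]_n -> 'cV[R]_m) (eps gamma delta d' r B r1 q : R) (x0 : 'cV[R]_n).
Hypotheses (eps0 : 0 < eps) (gamma0 : 0 < gamma) (ge1 : gamma * eps <= 1)
  (r0 : 0 < r) (rdelta : r <= delta) (B0 : 0 <= B) (r10 : 0 <= r1) (q0 : 0 <= q)
  (r1r : n%:R * r1 <= r / 4) (qr : n%:R * q <= gamma * (r / 4))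
  (ged : gamma * eps * delta <= r / 4) (x0d : @eball R n delta x0).
Hypothesis rhsB : forall t y z, 0 <= t -> @eball R n delta y -> @eball R n d' z ->
  `|rhs g f t z (h t y)| <= B.
Hypothesis step : forall a b y x, 0 <= a -> a <= b <= a + eps -> @eball R n delta y ->
  x a = y -> abs_cont a b x ->
  {ae (@lebesgue_measure R), forall t : R, a < t < b ->
    is_derive t 1 x (rhs g f t (x t) (h t y))} ->
  (forall t, a <= t <= b -> @eball R n d' (x t) /\ `|x t - y| <= r1) /\
  (b = a + eps -> forall c, `|x b c 0 - y c 0 + eps * (gamma * y c 0)| <= eps * q).

Local Notation psol := (psol D g f h eps x0).

Lemma psol_piece T x (j : nat) b : psol T x -> eps * j%:R <= b -> b <= T ->
  b <= eps * j%:R + eps -> @eball R n delta (x (eps * j%:R)) ->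
  (forall t, eps * j%:R <= t <= b ->
    @eball R n d' (x t) /\ `|x t - x (eps * j%:R)| <= r1) /\
  (b = eps * j%:R + eps -> forall c, `|x b c 0 - x (eps * j%:R) c 0 +
    eps * (gamma * x (eps * j%:R) c 0)| <= eps * q).
Proof.
move=> [_ acx _ dx] jb bT bj yd; have j0 : 0 <= eps * j%:R by rewrite mulr_ge0// ltW.
apply: step => //; first by rewrite jb.
  exact: abs_cont_sub acx.
apply: ae_impl (dx j) => t H /andP[t1 t2]; apply: H.
  by rewrite (ltW t1) (lt_le_trans t2)// -natr1 mulrDr mulr1.
by rewrite (le_lt_trans j0 t1) (lt_le_trans t2).
Qed.

(** The recursion [|z| <= (1 - gamma eps) |y| + gamma eps (r / 4)] has fixed point [r / 4]. The
    bound by [delta] belongs to the induction, as the step estimate is available only from samples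
    in that ball. *)
Lemma psol_sample T x (j : nat) : psol T x -> eps * j%:R <= T ->
  enorm (x (eps * j%:R)) <= (1 - gamma * eps) ^+ j * enorm x0 + r / 4 /\
  enorm (x (eps * j%:R)) <= delta.
Proof.
move=> px; have ge0 : 0 <= gamma * eps by rewrite mulr_ge0// ltW.
elim: j => [|j IH].
  by rewrite mulr0 expr0 mul1r => _; have [-> _ _ _] := px; split; rewrite ?lerDl ?divr_ge0// ltW.
rewrite -natr1 mulrDr mulr1 => jT.
have jjT : eps * j%:R <= eps * j%:R + eps by rewrite lerDl ltW.
have [IH1 IH2] := IH (le_trans jjT jT).
have [_ /(_ erefl) H] := psol_piece px jjT jT (lexx _) IH2.
move: H IH1 IH2; set y := x (eps * _); set z := x (_ + _) => H IH1 IH2.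
pose w := z - y + (eps * gamma) *: y.
have wB : enorm w <= gamma * eps * (r / 4).
  have := @enorm_le_coord R n w (eps * q) (mulr_ge0 (ltW eps0) q0).
  rewrite mulrCA => /(_ _)/le_trans; apply=> [i|]; last first.
    by rewrite [gamma * eps]mulrC -mulrA ler_wpM2l// ltW.
  by rewrite !mxE -mulrA.
have zE : z = (1 - gamma * eps) *: y + w.
  by apply/colP => i; rewrite !mxE; ring.
have zB : enorm z <= (1 - gamma * eps) * enorm y + gamma * eps * (r / 4).
  by rewrite {1}zE (le_trans (enormD _ _))// enormZ ger0_norm ?subr_ge0// lerD2l.
have e1 : 0 <= 1 - gamma * eps by rewrite subr_ge0.
have r4 : 0 <= r / 4 by rewrite divr_ge0// ltW.
split; apply: le_trans zB _.
  have := ler_wpM2l e1 IH1; rewrite exprS.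
  move: (_ ^+ j) (enorm x0) (r / 4) (enorm y) => a b c d; move: (gamma * eps) => e.
  by rewrite -[_ * a * b]mulrA; move: (a * b) => ab; lra.
have r4d : r / 4 <= delta by move: rdelta r0; lra.
have := ler_wpM2l e1 IH2; have := ler_wpM2l ge0 r4d.
by move: (r / 4) (enorm y) => b c; move: (gamma * eps) => e; lra.
Qed.

Lemma psol_near_sample T x t : psol T x -> 0 <= t <= T -> exists j : nat,
  [/\ eps * j%:R <= t < eps * j.+1%:R, @eball R n d' (x t) &
      enorm (x t) <= enorm (x (eps * j%:R)) + r / 4].
Proof.
move=> px /andP[t0 tT]; have [j /andP[jt tj]] := sample_index eps0 t0.
have [_ yd] := psol_sample px (le_trans jt tT).
have tje : t <= eps * j%:R + eps by rewrite ltW//; rewrite -natr1 mulrDr mulr1 in tj.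
have [/(_ t)] := psol_piece px jt tT tje yd; rewrite jt lexx => /(_ isT)[K1 K2] _.
exists j; split=> //; first by rewrite jt.
rewrite -[x t](subrK (x (eps * j%:R))) addrC (le_trans (enormD _ _))// lerD2l.
by rewrite (le_trans (enorm_le_norm _))// (le_trans _ r1r)// ler_wpM2l.
Qed.

(** These are the bounds that the existence proof assumes; they hold for every partial solution,
    whether or not it extends. *)
Lemma psol_apriori T x : 0 <= T -> psol T x ->
  (forall t, 0 <= t <= T -> @eball R n d' (x t)) /\
  forall s t, 0 <= s -> s <= t -> t <= T -> `|x t - x s| <= B * (t - s).
Proof.
move=> T0 px; have K t : 0 <= t <= T -> @eball R n d' (x t).
  by move=> /(psol_near_sample px)[j []].
split=> // s t s0 st tT; have [_ acx _ dx] := px.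
apply: vec_increment_le => //; first exact: abs_cont_sub acx.
apply: ae_impl (ae_forall_nat dx) => u H /andP[su ut].
have u0 : 0 < u by exact: le_lt_trans su.
have uT : u < T by exact: lt_le_trans tT.
have [j ju] := sample_index eps0 (ltW u0); have := H j ju; rewrite u0 uT => /(_ isT) dxu.
exists (rhs g f u (x u) (h u (x (eps * j%:R)))) => //.
apply: rhsB; [exact: ltW|apply: (psol_sample px _).2|by apply: K; rewrite !ltW].
by case/andP: ju => ju _; rewrite (le_trans ju)// ltW.
Qed.

(** Three quarters of [r] are spent: on the motion since the last sample, on the residual error at
    samples, and on replacing the sampling time by [t] in the exponential. The fourth is kept for
    the exponential itself at late times. *)
Lemma psol_decay T x t : psol T x -> 0 <= t <= T ->
  enorm (x t) <= enorm x0 * expR (- gamma * t) + 3 / 4 * r.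
Proof.
move=> px tT; have [j [/andP[jt tj] _ xt]] := psol_near_sample px tT.
have /andP[_ tTT] := tT; have [xj _] := psol_sample px (le_trans jt tTT).
have ge0 : 0 <= gamma * eps by rewrite mulr_ge0// ltW.
have j0 : 0 <= gamma * eps * j%:R by rewrite mulr_ge0.
have jt' : gamma * eps * j%:R <= gamma * t by rewrite -mulrA ler_wpM2l// ltW.
have p1 : (1 - gamma * eps) ^+ j <= expR (- (gamma * eps * j%:R)).
  by apply: pow_le_expR; rewrite ge0.
have p2 := expRN_lip j0 jt'.
have p3 : gamma * t - gamma * eps * j%:R <= gamma * eps.
  rewrite -mulrA -mulrBr ler_wpM2l ?(ltW gamma0)// lerBlDl ltW//.
  by move: tj; rewrite -natr1 mulrDr mulr1.
have p4 : (1 - gamma * eps) ^+ j <= expR (- (gamma * t)) + gamma * eps.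
  by rewrite (le_trans p1)// (le_trans p2)// lerD2l.
have x00 := enorm_ge0 x0.
have p6 : gamma * eps * enorm x0 <= r / 4 by rewrite (le_trans _ ged)// ler_wpM2l.
have p5 : (1 - gamma * eps) ^+ j * enorm x0 <= enorm x0 * expR (- gamma * t) + r / 4.
  by rewrite (le_trans (ler_wpM2r x00 p4))// mulrDl mulrC mulNr lerD2l.
rewrite (le_trans xt)// -lerBrDr (le_trans xj)// -lerBrDr (le_trans p5)//.
by move: (_ * expR _) => a; lra.
Qed.

End Decay.

(** * Choice of the gain and of the sampling period *)

Lemma control_continuous (R : realType) (n m : nat)
    (f : 'I_m -> 'cV[R]_n -> 'cV[R]_n)
    (S1 : {set 'I_m}) (S2 : {set 'I_m * 'I_m}) (S3 : {set 'I_m * 'I_m * 'I_m})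
    (hn : (#|S1| + #|S2| + #|S3|)%N = n)
    (kj : 'I_m * 'I_m -> int) (k1 k2 : 'I_m * 'I_m * 'I_m -> int) (gamma s : R) y :
  0 < s -> continuous (fun t => control f hn kj k1 k2 gamma (s ^+ 6) t y).
Proof.
move=> s0 t; apply: differentiable_continuous; apply/derivable1_diffP.
apply/derivable_mxP => k j; rewrite (ord1 j).
under eq_fun => u do rewrite control_coord//.
apply: (@ex_derive _ _ _ _ _ _ _); apply: is_derive_add.
apply: is_derive_big => i; apply: is_derive_mul; apply: is_derive_mul.
Qed.

Lemma sixth_root (R : realType) (eps s : R) : 0 < s -> 0 < eps <= s ^+ 6 ->
  exists2 s', 0 < s' <= s & eps = s' ^+ 6.
Proof.
move=> s0 /andP[e0 es]; exists (eps `^ 6%:R^-1); last first.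
  by rewrite -powR_mulrn ?powR_ge0// -powRrM mulVf// powRr1// ltW.
rewrite powR_gt0//= -(@ler_pXn2r _ 6)// ?nnegrE ?powR_ge0 ?(ltW s0)//.
by rewrite -powR_mulrn ?powR_ge0// -powRrM mulVf// powRr1// ltW.
Qed.

Lemma expRN_small (R : realType) (delta r u : R) : 0 < r -> delta / (r / 4) <= u ->
  delta * expR (- u) <= r / 4.
Proof.
move=> r0 hu; have r4 : 0 < r / 4 by rewrite divr_gt0.
rewrite expRN -ler_pdivlMr ?invr_gt0 ?expR_gt0// invrK mulrC -ler_pdivrMr//.
rewrite (le_trans hu)// (le_trans _ (expR_ge1Dx u))// lerDr//.
Qed.

Lemma pi_solution_psol (R : realType) (n m : nat) (D : set 'cV[R]_n) g
    (f : 'I_m -> 'cV[R]_n -> 'cV[R]_n) h (eps T : R) x0 x : 0 < T ->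
  pi_solution D g f h eps x0 x -> psol D g f h eps x0 T x.
Proof.
move=> T0 [x0E Dx acx dx]; split=> //; first exact: acx.
  by move=> t /andP[t0 _]; exact: Dx.
by move=> j; apply: ae_impl (dx j) => t H jt _; exact: H.
Qed.

Theorem theorem1 (R : realType) (n m : nat) (D : set 'cV[R]_n) (hD : open D)
    (f : 'I_m -> 'cV[R]_n -> 'cV[R]_n) (hf : forall i, Ck_on 3 D (f i))
    (g : R -> 'cV[R]_n -> 'cV[R]_n) (hsol : locally_solvable D g f)
    (S1 : {set 'I_m}) (S2 : {set 'I_m * 'I_m}) (S3 : {set 'I_m * 'I_m * 'I_m})
    (hn : (#|S1| + #|S2| + #|S3|)%N = n)
    (hspan : forall x, D x ->
      (<<spanning_fields f S1 S2 S3 x>> = fullv :> {vspace 'cV[R]_n})%VS)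
    (hg : forall xi : set 'cV[R]_n, compact xi -> xi `<=` D ->
      exists tau Mg : R, [/\ 0 < tau, 0 <= Mg &
        forall t0, 0 <= t0 -> forall t x, t0 <= t <= t0 + tau -> xi x ->
          enorm (g t x) <= Mg])
    (hF : exists2 alpha : R, 0 < alpha &
      forall x, D x -> opnorm (invmx (Fmx f hn x)) <= alpha)
    (kj : 'I_m * 'I_m -> int) (k1 k2 : 'I_m * 'I_m * 'I_m -> int)
    (hkap : non_resonant S2 S3 kj k1 k2)
    (delta rho : R) (hdelta : 0 < delta) (hrho : 0 < rho)
    (hball : @eball R n delta `<=` D) :
  exists gamma ebar lambda t1 : R,
    [/\ 0 < gamma, 0 < ebar, 0 < lambda, 0 < t1 &
      forall (eps : R) (x0 : 'cV[R]_n), 0 < eps <= ebar -> @eball R n delta x0 ->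
        let h := control f hn kj k1 k2 gamma eps in
        (exists x : R -> 'cV[R]_n, pi_solution D g f h eps x0 x) /\
        (forall x : R -> 'cV[R]_n, pi_solution D g f h eps x0 x ->
          (forall t, 0 <= t < t1 ->
             enorm (x t) <= enorm x0 * expR (- lambda * t) + rho) /\
          (forall t, t1 <= t -> enorm (x t) <= rho))].

Proof.
have sf i : vC 3 D (f i) by exact: Ck_on_vC.
have Fu x : D x -> Fmx f hn x \in unitmx by move=> /hspan; exact: Fmx_unit.
have [alpha alpha0 Fa] := hF.
(* Samples stay in the ball of radius [delta], but the motion between samples may leave it; [d']
   gives it room inside [D]. *)
have [d' dd' d'D] := eball_thicken hD hdelta hball.
have [tau [Mg [tau0 Mg0 gB]]] := hg _ (@eball_compact R n d') d'D.
(* Taking the window [[t0, t0 + tau]] at [t0 = t] makes [Mg] uniform in time. *)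
have gM t x : 0 <= t -> @eball R n d' x -> enorm (g t x) <= Mg.
  by move=> t0; apply: (gB t t0); rewrite lexx lerDl ltW.
pose r := Num.min rho delta.
have r0 : 0 < r by rewrite lt_min hrho.
have rrho : r <= rho by rewrite ge_min lexx.
have rdelta : r <= delta by rewrite ge_min lexx orbT.
have r4 : 0 < r / 4 by rewrite divr_gt0.
(* Once [C * s <= 1], the error rate [Mg + C * s] of [one_step] is at most [Mg + 1], and with this
   gain [n] times it is at most [gamma * (r / 4)]. The added 1 keeps [gamma] positive for
   [n = 0]. *)
pose gamma := (n%:R + 1) * (Mg + 1) / (r / 4).
have gamma0 : 0 < gamma by rewrite divr_gt0// mulr_gt0 ?ltr_wpDl.
have gr : gamma * (r / 4) = (n%:R + 1) * (Mg + 1) by rewrite divfK// gt_eqF.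
clearbody gamma r.
have [C [Lam [s0 [C0 Lam0 s00 onestep]]]] :=
  one_step hD sf Fu (ltW alpha0) Fa hkap hdelta dd' d'D Mg0 gM gamma0.
(* The first four summands are the coefficients whose product with [s] must not exceed one, for
   [c3], [c2], [c1] and [c4] in this order; the last keeps [B] positive. *)
pose B := C + n%:R * Lam / (r / 4) + gamma + gamma * delta / (r / 4) + 1.
have p1 : 0 <= n%:R * Lam / (r / 4) by rewrite divr_ge0 ?mulr_ge0// ltW.
have p2 : 0 <= gamma * delta / (r / 4) by rewrite divr_ge0 ?mulr_ge0// ltW.
have B0 : 0 < B by rewrite ltr_wpDl// !addr_ge0// ltW.
pose sb := Num.min s0 B^-1.
have sb0 : 0 < sb by rewrite lt_min s00 invr_gt0.
have small s X : 0 < s <= sb -> X <= B -> X * s <= 1.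
  move=> /andP[s1 s2] XB; apply: (@le_trans _ _ (B * s)).
    by rewrite ler_wpM2r// ltW.
  by rewrite mulrC -ler_pdivlMr// mul1r (le_trans s2)// ge_min lexx orbT.
have [B1 B2 B3 B4] : [/\ C <= B, n%:R * Lam / (r / 4) <= B, gamma <= B &
    gamma * delta / (r / 4) <= B].
  rewrite /B; move: C0 p1 p2 (ltW gamma0).
  move: (n%:R * Lam / _) (gamma * delta / _) => a b; split; lra.
have tg0 : 0 < delta / (r / 4) / gamma by rewrite !divr_gt0.
(* The decay rate is the gain itself. At [t1] the exponent [gamma * t1] equals [delta / (r / 4)],
   and [exp u >= u] brings [delta * exp (- u)] below [r / 4] from then on. *)
exists gamma, (sb ^+ 6), gamma, (delta / (r / 4) / gamma); split=> //.
  exact: exprn_gt0.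
move=> eps x0 epsb x0d h.
have [s /andP[s1 s2] epsE] := sixth_root sb0 epsb.
have ss : 0 < s <= sb by rewrite s1.
have ss0 : 0 < s <= s0 by rewrite s1 (le_trans s2)// ge_min lexx.
have hE : h = fun t y => control f hn kj k1 k2 gamma (s ^+ 6) t y by rewrite /h epsE.
have eps0 : 0 < eps by case/andP: epsb.
have [sle1 Lss _ _] := onestep s x0 ss0 x0d.
have eps_s : eps <= s.
  by rewrite epsE exprSr ler_piMl ?(ltW s1)// exprn_ile1// ltW.
have q0 : 0 <= Mg + C * s by rewrite addr_ge0 ?mulr_ge0// ltW.
have c1 : gamma * eps <= 1.
  by rewrite (le_trans _ (small _ _ ss B3))// ler_wpM2l// ltW.
have c2 : n%:R * (Lam * s ^+ 2) <= r / 4.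
  apply: le_trans (ler_wpM2l (ler0n _ n) Lss) _.
  by have := small _ _ ss B2; rewrite mulrA mulrAC ler_pdivrMr// mul1r.
have c3 : n%:R * (Mg + C * s) <= gamma * (r / 4).
  rewrite gr ler_pM ?lerDl// lerD2l; exact: small.
have c4 : gamma * eps * delta <= r / 4.
  rewrite mulrAC; apply: le_trans (ler_wpM2l (mulr_ge0 (ltW gamma0) (ltW hdelta)) eps_s) _.
  by have := small _ _ ss B4; rewrite mulrAC ler_pdivrMr// mul1r.
have Bd0 : 0 <= Lam / s ^+ 4 by rewrite divr_ge0// exprn_ge0// ltW.
have L20 : 0 <= Lam * s ^+ 2 by rewrite mulr_ge0// exprn_ge0// ltW.
have rhsB t y z : 0 <= t -> @eball R n delta y -> @eball R n d' z ->
    `|rhs g f t z (h t y)| <= Lam / s ^+ 4.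
  by move=> t0 yd zd; rewrite hE; have [_ _ + _] := onestep s y ss0 yd; exact.
have step a b y x : 0 <= a -> a <= b <= a + eps -> @eball R n delta y ->
  x a = y -> abs_cont a b x ->
  {ae (@lebesgue_measure R), forall t : R, a < t < b ->
    is_derive t 1 x (rhs g f t (x t) (h t y))} ->
  (forall t, a <= t <= b -> @eball R n d' (x t) /\ `|x t - y| <= Lam * s ^+ 2) /\
  (b = a + eps -> forall c,
     `|x b c 0 - y c 0 + eps * (gamma * y c 0)| <= eps * (Mg + C * s)).
  move=> a0 ab yd xa acx dx; rewrite epsE in ab *.
  have [_ _ _] := onestep s y ss0 yd; apply=> //; split=> //.
  by move: dx; rewrite hE.
have x0D : D x0 by exact: hball.
split.
  apply: (@psol_global _ _ _ D g f h eps (Lam / s ^+ 4) d' x0) => //.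
    by move=> y; rewrite hE; exact: control_continuous.
  move=> T x T0 px.
  exact: (psol_apriori eps0 gamma0 c1 r0 rdelta Bd0 q0 c2 c3 x0d rhsB step T0 px).
move=> x px.
have dec t : 0 <= t -> enorm (x t) <= enorm x0 * expR (- gamma * t) + 3 / 4 * r.
  move=> t0; have T0 : 0 < t + 1 by rewrite ltr_wpDl.
  apply: (psol_decay eps0 gamma0 c1 r0 rdelta q0 c2 c3 c4 x0d step (pi_solution_psol T0 px)).
  by rewrite t0 lerDl ler01.
split=> t.
  move=> /andP[t0 _]; rewrite (le_trans (dec t t0))// lerD2l.
  by move: r0 rrho; clear; lra.
move=> tt1; have t0 : 0 <= t by rewrite (le_trans (ltW tg0)).
rewrite (le_trans (dec t t0))//.
have h1 : enorm x0 * expR (- gamma * t) <= r / 4.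
  rewrite mulNr; apply: (@le_trans _ _ (delta * expR (- (gamma * t)))).
    by rewrite ler_wpM2r// expR_ge0.
  by apply: expRN_small => //; rewrite [gamma * t]mulrC -ler_pdivrMr.
by move: (_ * expR _) h1 => a; move: rrho; clear; lra.
Qed.
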